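(* Let $k_3,k_4$ be integers with $10\leq k_3<k_4$ and $k_3\neq 11$. Then no tiling of $\mathbb{H}^2$ of type $[3,5,k_3,k_4]$ by regular polygons is strongly periodic. Consequently, the set $\mathcal{A}$ consisting of the four hyperbolic regular polygons with $3$, $5$, $k_3$ and $k_4$ sides, with common side length chosen so that one copy of each fits together around a vertex, is weakly aperiodic.
   Context: All tilings are edge-to-edge. A tiling of $\mathbb{H}^2$ by regular polygons is of type $[3,5,k_3,k_4]$ if exactly four tiles meet at each vertex, and they are, in some cyclic order that may depend on the vertex, a $3$-gon, a $5$-gon, a $k_3$-gon and a $k_4$-gon (such a tiling is called pseudo-homogeneous). The common side length in $\mathcal{A}$ is the unique length for which the interior angles of the regular $3$-, $5$-, $k_3$- and $k_4$-gons with that side length sum to $2\pi$. A tiling of $\mathbb{H}^2$ is strongly periodic if the quotient of $\mathbb{H}^2$ by the symmetry group of the tiling is compact. A set of tiles is weakly aperiodic if none of the tilings of $\mathbb{H}^2$ by isometric copies of its members is strongly periodic. *)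

(* Defs.v *)
From HB Require Import structures.
From mathcomp Require Import all_boot all_order all_algebra.
From mathcomp Require Import all_classical all_reals all_analysis.
Import numFieldNormedType.Exports.
Import Order.TTheory GRing.Theory Num.Theory.

Set Implicit Arguments.
Unset Strict Implicit.
Unset Printing Implicit Defensive.

Local Open Scope classical_set_scope.
Local Open Scope ring_scope.

(* The hyperbolic plane is the sheet z > 0 of the hyperboloid
   x^2 + y^2 - z^2 = -1 in Minkowski 3-space.  The sheet is the graph of
   z = sqrt (1 + x^2 + y^2), so a point is encoded by (x, y); this vertical
   projection is a homeomorphism from the hyperbolic plane onto R * R with the
   product topology. *)
Definition H2 (R : realType) : Type := (R * R)%type.

HB.instance Definition _ (R : realType) :=
  Topological.copy (H2 R) (R * R)%type.

Section HyperbolicGeometry.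
Variable R : realType.
Implicit Types (p q a b c : H2 R) (u w : 'rV[R]_3).

Definition hyperboloid p : 'rV[R]_3 :=
  \row_(i < 3) [:: p.1; p.2; Num.sqrt (1 + p.1 ^+ 2 + p.2 ^+ 2)]`_i.

Definition minkowski u w : R := u 0 0 * w 0 0 + u 0 1 * w 0 1 - u 0 2 * w 0 2.

Definition arcosh (t : R) : R := ln (t + Num.sqrt (t ^+ 2 - 1)).

Definition hdist p q : R :=
  arcosh (- minkowski (hyperboloid p) (hyperboloid q)).

Definition segment a b : set (H2 R) :=
  [set p | hdist a p + hdist p b = hdist a b].

(* The orthogonal projection of [a] to the tangent plane at [b], on which the
   Minkowski form is positive definite: it is the initial direction at [b] of
   the geodesic from [b] to [a] (up to a positive factor). *)
Definition direction b a : 'rV[R]_3 :=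
  hyperboloid a
  + minkowski (hyperboloid a) (hyperboloid b) *: hyperboloid b.

(* The angle at [b] between the geodesic segments from [b] to [a] and [c]. *)
Definition hangle a b c : R :=
  let u := direction b a in let w := direction b c in
  acos (minkowski u w
        / (Num.sqrt (minkowski u u) * Num.sqrt (minkowski w w))).

(* Geodesic lines are the intersections of the hyperboloid with planes through
   the origin, so [orientation a b p] is positive exactly when [p] lies
   strictly to the left of the geodesic line from [a] to [b]. *)
Definition orientation a b p : R :=
  \det (\matrix_(i < 3) [:: hyperboloid a; hyperboloid b; hyperboloid p]`_i).

(* [v] lists counterclockwise the vertices of a strictly convex [n]-gon: every
   other vertex is strictly to the left of each directed side. *)
Definition convex_polygon n (v : 'I_n -> H2 R) : Prop :=
  (2 < n)%N /\
  forall i j, j != i -> j != ordS i ->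
    0 < orientation (v i) (v (ordS i)) (v j).

Definition polygon_region n (v : 'I_n -> H2 R) : set (H2 R) :=
  [set p | forall i, 0 <= orientation (v i) (v (ordS i)) p].

(* [P] is a regular [n]-gon with side length [s] and interior angle [alpha]. *)
Definition regular_polygon (n : nat) (s alpha : R) (P : set (H2 R)) : Prop :=
  exists v : 'I_n -> H2 R,
    [/\ convex_polygon v,
        forall i, hdist (v i) (v (ordS i)) = s,
        forall i, hangle (v (ord_pred i)) (v i) (v (ordS i)) = alpha
      & P = polygon_region v].

Definition is_regular_ngon (n : nat) (P : set (H2 R)) : Prop :=
  exists s alpha, regular_polygon n s alpha P.

Definition vertex_of (P : set (H2 R)) (p : H2 R) : Prop :=
  exists (n : nat) (v : 'I_n -> H2 R),
    [/\ convex_polygon v, P = polygon_region v & exists i, p = v i].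

Definition side_of (P E : set (H2 R)) : Prop :=
  exists (n : nat) (v : 'I_n -> H2 R),
    [/\ convex_polygon v, P = polygon_region v
      & exists i, E = segment (v i) (v (ordS i))].

Definition isometry (g : H2 R -> H2 R) : Prop :=
  bijective g /\ forall p q, hdist (g p) (g q) = hdist p q.

Definition tiling (T : set (set (H2 R))) : Prop :=
  [/\ \bigcup_(t in T) t = setT,
      forall t t', T t -> T t' -> t <> t' -> t° `&` t'° = set0
    & forall p, exists2 U, nbhs p U
        & finite_set [set t | T t /\ t `&` U !=set0]].

Definition edge_to_edge (T : set (set (H2 R))) : Prop :=
  forall t t', T t -> T t' -> t <> t' ->
    [\/ t `&` t' = set0,
        exists p, [/\ vertex_of t p, vertex_of t' p & t `&` t' = [set p]]
      | exists E, [/\ side_of t E, side_of t' E & t `&` t' = E]].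

(* The cyclic order of the tiles around a vertex is arbitrary and may depend
   on the vertex, so it suffices to enumerate them without repetition. *)
Definition tiling_of_type (ks : seq nat) (T : set (set (H2 R))) : Prop :=
  [/\ tiling T, edge_to_edge T,
      forall t, T t -> exists n, is_regular_ngon n t
    & forall t0 p, T t0 -> vertex_of t0 p ->
        exists f : 'I_(size ks) -> set (H2 R),
          [/\ injective f,
              forall i : 'I_(size ks), is_regular_ngon (nth 0%N ks i) (f i)
            & [set t | T t /\ t p] = range f]].

Definition symmetry (T : set (set (H2 R))) (g : H2 R -> H2 R) : Prop :=
  isometry g /\ (fun t => g @` t) @` T = T.

Definition same_orbit (T : set (set (H2 R))) : rel (H2 R) :=
  fun p q => `[< exists2 g, symmetry T g & g p = q >].

Lemma same_orbit_refl T : reflexive (same_orbit T).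
Proof.
move=> p; apply/asboolP; exists id => //; split.
  by split=> //; exists id.
rewrite -[RHS]image_id; congr (_ @` _).
by apply/funext => t; rewrite image_id.
Qed.

Lemma same_orbit_symm T p q : same_orbit T p q -> same_orbit T q p.
Proof.
move=> /asboolP[g [[[h gK hK] gI] gT] <-]; apply/asboolP.
exists h => //; split; first split.
- by exists g.
- by move=> x y; rewrite -gI !hK.
- rewrite -{1}gT image_comp -[RHS]image_id; congr (_ @` _).
  apply/funext => t /=; rewrite image_comp -[RHS]image_id; congr (_ @` _).
  exact/funext.
Qed.

Lemma same_orbit_sym T : symmetric (same_orbit T).
Proof. by move=> p q; apply/idP/idP; exact: same_orbit_symm. Qed.

Lemma same_orbit_trans T : transitive (same_orbit T).
Proof.
move=> q p r /asboolP[g [[gb gI] gT] <-] /asboolP[h [[hb hI] hT] <-].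
apply/asboolP; exists (h \o g) => //; split; first split.
- exact: bij_comp.
- by move=> x y /=; rewrite hI gI.
- rewrite -{2}hT -{2}gT image_comp; congr (_ @` _).
  by apply/funext => t /=; rewrite image_comp.
Qed.

Canonical orbit_equiv T : equiv_rel (H2 R) :=
  EquivRel (same_orbit T) (@same_orbit_refl T) (@same_orbit_sym T)
    (@same_orbit_trans T).

(* The quotient of the hyperbolic plane by the symmetry group of [T], with the
   quotient topology. *)
Definition orbit_space (T : set (set (H2 R))) : topologicalType :=
  quotient_topology {eq_quot (orbit_equiv T)}%qT.

Definition strongly_periodic (T : set (set (H2 R))) : Prop :=
  compact [set: orbit_space T].

Definition tiling_by_copies (A T : set (set (H2 R))) : Prop :=
  [/\ tiling T, edge_to_edge T
    & forall t, T t -> exists P g, [/\ A P, isometry g & t = g @` P]].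

Definition weakly_aperiodic (A : set (set (H2 R))) : Prop :=
  forall T, tiling_by_copies A T -> ~ strongly_periodic T.

End HyperbolicGeometry.

(* Main.v *)
Require Import Defs.
From HB Require Import structures.
From mathcomp Require Import all_boot all_order all_algebra.
From mathcomp Require Import all_classical all_reals all_analysis.
From mathcomp Require Import ring lra zify.
(* Required again, so that [isometry] and [minkowski] have their hyperbolic meaning. *)
Require Import Defs.
Import Order.TTheory GRing.Theory Num.Theory.
Import numFieldNormedType.Exports.
Set Implicit Arguments.
Unset Strict Implicit.
Unset Printing Implicit Defensive.
Local Open Scope classical_set_scope.
Local Open Scope ring_scope.

(** Tilings of type [3, 5, k3, k4].  The kinds of the four tiles at a vertex are
    different.  Around a pentagon, the kinds of the five neighbors form a cyclic word
    in the letters 3, k3 and k4.  If a triangle occurs in it, then the letters before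
    and after it differ: otherwise the fourth tiles at the two ends of the side that the
    triangle shares with the pentagon would be of the same kind, although they meet at
    the third vertex of the triangle ([triangle_flanks]).  Hence at most one neighbor of
    a pentagon is a triangle ([pentagon_triangle]).  On the other hand, the three
    neighbors of a triangle are of different kinds, so one of them is a pentagon
    ([triangle_pentagon]) and a symmetry that preserves the triangle is trivial
    ([symmetry_fix_triangle]).

    If the quotient by the symmetry group is compact, then by local finiteness there are
    finitely many triangles up to symmetry, say [N].  Attach a pentagon to a
    representative of each.  The [5 * N] vertices of these pentagons are pairwise
    inequivalent under symmetries, whereas every vertex of the tiling belongs to a
    triangle and so is equivalent to one of the [3 * N] vertices of the
    representatives.  As [N] is positive, this is a contradiction
    ([type_not_strongly_periodic]).

    Tilings by copies of the four polygons.  It remains to show that they are of type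
    [3, 5, k3, k4] ([copies_tiling_of_type]).  The interior angles at a vertex add up to
    [2 * pi] ([angle_sum]), and one angle of each kind does too.  With [c] the hyperbolic
    cosine of the side, the interior angle [alpha] of a regular [n]-gon satisfies
    [sqrt ((c + 1) / 2) * sin (alpha / 2) = cos (pi / n)] ([regular_polygon_angle]).
    Numerical bounds leave two other ways to fill the angle around a vertex: with five
    triangles and one of the large polygons, or with two triangles and three pentagons.
    Each of them gives a second equation for the side and so a relation between [k3]
    and [k4].  By monotonicity, finitely many numerical comparisons show that the given
    integers satisfy neither relation ([five_triangles_false],
    [three_pentagons_false]).

    Points are handled in the hyperboloid model: [h] is the point of Minkowski space and
    [mk] the Minkowski form.  Lengths, angles and orientations are then polynomial
    expressions in the products and determinants of vectors, so that most geometric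
    facts reduce to [cramer] and [gram3]. *)

(** * The Minkowski form *)

Definition det3 (R : realType) (u v w : 'rV[R]_3) : R :=
  u 0 0 * (v 0 1 * w 0 2 - v 0 2 * w 0 1)
  - u 0 1 * (v 0 0 * w 0 2 - v 0 2 * w 0 0)
  + u 0 2 * (v 0 0 * w 0 1 - v 0 1 * w 0 0).

Ltac vring := rewrite /det3 /minkowski ?mxE; ring.

Section Minkowski.
Variable R : realType.
Implicit Types (p q a b c : H2 R) (u v w x y : 'rV[R]_3) (k l : R).

Notation h := (@hyperboloid R).
Notation mk := (@minkowski R).

Lemma row3P u v : u 0 0 = v 0 0 -> u 0 1 = v 0 1 -> u 0 2 = v 0 2 -> u = v.
Proof.
move=> e0 e1 e2; apply/rowP => -[[|[|[|//]]] i3].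
- by rewrite (_ : Ordinal i3 = 0) //; apply: val_inj.
- by rewrite (_ : Ordinal i3 = 1) //; apply: val_inj.
- by rewrite (_ : Ordinal i3 = 2) //; apply: val_inj.
Qed.

Definition height p : R := Num.sqrt (1 + p.1 ^+ 2 + p.2 ^+ 2).

Lemma h0 p : h p 0 0 = p.1. Proof. by rewrite mxE. Qed.
Lemma h1 p : h p 0 1 = p.2. Proof. by rewrite mxE. Qed.
Lemma h2 p : h p 0 2 = height p. Proof. by rewrite mxE. Qed.

Lemma orientationE a b c : orientation a b c = det3 (h a) (h b) (h c).
Proof.
rewrite /orientation /det3 (expand_det_row _ 0) !big_ord_recl big_ord0 /cofactor.
rewrite !(expand_det_row _ 0) !big_ord_recl !big_ord0 /cofactor !det_mx11.
by rewrite !mxE /= /bump /=; ring.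
Qed.

Lemma mkC u v : mk u v = mk v u. Proof. by vring. Qed.
Lemma mkDl u v w : mk (u + v) w = mk u w + mk v w. Proof. by vring. Qed.
Lemma mkDr u v w : mk u (v + w) = mk u v + mk u w. Proof. by vring. Qed.
Lemma mkZl k u w : mk (k *: u) w = k * mk u w. Proof. by vring. Qed.
Lemma mkZr k u w : mk u (k *: w) = k * mk u w. Proof. by vring. Qed.
Lemma mkNl u w : mk (- u) w = - mk u w. Proof. by vring. Qed.
Lemma mkNr u w : mk u (- w) = - mk u w. Proof. by vring. Qed.
Lemma mk0l w : mk 0 w = 0. Proof. by vring. Qed.
Definition mkE := (mkDl, mkDr, mkZl, mkZr, mkNl, mkNr).

Lemma det3D3 u v w x : det3 u v (w + x) = det3 u v w + det3 u v x.
Proof. by vring. Qed.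
Lemma det3Z3 k u v w : det3 u v (k *: w) = k * det3 u v w.
Proof. by vring. Qed.
Lemma det3N3 u v w : det3 u v (- w) = - det3 u v w.
Proof. by vring. Qed.
Lemma det3_rot u v w : det3 u v w = det3 v w u. Proof. by vring. Qed.
Lemma det3_swap u v w : det3 v u w = - det3 u v w. Proof. by vring. Qed.
Lemma det3_swap23 u v w : det3 u w v = - det3 u v w. Proof. by vring. Qed.
Lemma det3_23 u w : det3 w u u = 0. Proof. by vring. Qed.
Lemma det3_13 u w : det3 u w u = 0. Proof. by vring. Qed.

Lemma cramer u v w x : det3 u v w *: x
  = det3 x v w *: u + det3 u x w *: v + det3 u v x *: w.
Proof. by apply: row3P; vring. Qed.

(** The Minkowski form has signature (2, 1), whence the sign in its Gram
    determinants. *)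
Lemma gram3 u v w x y z : det3 u v w * det3 x y z
  = - (mk u x * (mk v y * mk w z - mk v z * mk w y)
       - mk u y * (mk v x * mk w z - mk v z * mk w x)
       + mk u z * (mk v x * mk w y - mk v y * mk w x)).
Proof. by vring. Qed.

Lemma sum_sqr_gt0 p : 0 < 1 + p.1 ^+ 2 + p.2 ^+ 2.
Proof. by have := sqr_ge0 p.1; have := sqr_ge0 p.2; lra. Qed.

Lemma height_gt0 p : 0 < height p.
Proof. by rewrite sqrtr_gt0 sum_sqr_gt0. Qed.

Lemma height_sqr p : height p ^+ 2 = 1 + p.1 ^+ 2 + p.2 ^+ 2.
Proof. by rewrite sqr_sqrtr // ltW // sum_sqr_gt0. Qed.

Lemma mkhE p q : mk (h p) (h q) = p.1 * q.1 + p.2 * q.2 - height p * height q.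
Proof. by rewrite /minkowski !h0 !h1 !h2. Qed.

Lemma mkhh p : mk (h p) (h p) = -1.
Proof. by rewrite mkhE; have := height_sqr p; lra. Qed.

Lemma h_inj p q : h p = h q -> p = q.
Proof.
move=> e; case: p q e => [p1 p2] [q1 q2] e.
have := congr1 (fun u : 'rV_3 => u 0 0) e; rewrite !h0 /= => ->.
by have := congr1 (fun u : 'rV_3 => u 0 1) e; rewrite !h1 /= => ->.
Qed.

(** The cone over the hyperboloid. *)
Definition future u : Prop := mk u u < 0 /\ 0 < u 0 2.

Lemma future_h p : future (h p).
Proof. by split; rewrite ?mkhh ?ltrN10 // h2 height_gt0. Qed.

Lemma future_point u : future u -> exists p, exists2 k : R, 0 < k & h p = k *: u.
Proof.
move=> [uu u2]; set N := Num.sqrt (- mk u u).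
have N0 : 0 < N by rewrite sqrtr_gt0 oppr_gt0.
have N2 : N ^+ 2 = - mk u u by rewrite sqr_sqrtr // oppr_ge0 ltW.
pose p : H2 R := (N^-1 * u 0 0, N^-1 * u 0 1).
have ip : 0 < N^-1 by rewrite invr_gt0.
exists p, N^-1 => //; apply: row3P; rewrite ?h0 ?h1 ?h2 ?mxE //.
have hp : 0 <= height p by rewrite ltW // height_gt0.
have hu : 0 <= N^-1 * u 0 2 by rewrite ltW // mulr_gt0.
apply/eqP; rewrite -(@eqrXn2 _ 2) // height_sqr /p /=; apply/eqP.
have -> : 1 = N^-1 ^+ 2 * N ^+ 2 by rewrite -exprMn mulVf ?expr1n // gt_eqF.
by rewrite N2 /minkowski; ring.
Qed.

Lemma mk_future_lt0 u v : future u -> future v -> mk u v < 0.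
Proof.
rewrite /future /minkowski => -[uu u2] [vv v2]; rewrite subr_lt0.
have [le0|gt0] := leP (u 0 0 * v 0 0 + u 0 1 * v 0 1) 0.
  by rewrite (le_lt_trans le0) // mulr_gt0.
rewrite -(@ltr_pXn2r _ 2) ?nnegrE ?ltW ?mulr_gt0 //.
have cs : (u 0 0 * v 0 0 + u 0 1 * v 0 1) ^+ 2
   <= (u 0 0 ^+ 2 + u 0 1 ^+ 2) * (v 0 0 ^+ 2 + v 0 1 ^+ 2).
  by have := sqr_ge0 (u 0 0 * v 0 1 - u 0 1 * v 0 0); nra.
apply: le_lt_trans cs _; rewrite exprMn.
have a1 : u 0 0 ^+ 2 + u 0 1 ^+ 2 < u 0 2 ^+ 2 by lra.
have a2 : v 0 0 ^+ 2 + v 0 1 ^+ 2 < v 0 2 ^+ 2 by lra.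
by rewrite ltr_pM // addr_ge0 // sqr_ge0.
Qed.

Lemma future_comb u v k l : future u -> future v -> 0 <= k -> 0 <= l ->
  0 < k + l -> future (k *: u + l *: v).
Proof.
move=> fu fv k0 l0 kl; have uv := mk_future_lt0 fu fv.
case: (fu) => uu u2; case: (fv) => vv v2; split; last first.
  rewrite !mxE; have [k1|k1] := ltP 0 k.
    by rewrite ltr_wpDr // ?mulr_gt0 // mulr_ge0 // ltW.
  have -> : k = 0 by lra.
  by rewrite mul0r add0r mulr_gt0 //; lra.
rewrite !mkE (mkC v u).
have -> : k * (k * mk u u + l * mk u v) + l * (k * mk u v + l * mk v v)
  = - (k ^+ 2 * - mk u u + l ^+ 2 * - mk v v + 2 * (k * l) * - mk u v) by ring.
rewrite oppr_lt0.
have A : 0 <= 2 * (k * l) * - mk u v by rewrite !mulr_ge0 // oppr_ge0 ltW.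
rewrite ltr_wpDr //; have [k1|k1] := ltP 0 k.
  by rewrite ltr_wpDr // ?mulr_gt0 ?exprn_gt0 ?oppr_gt0 // mulr_ge0 ?sqr_ge0 // oppr_ge0 ltW.
have -> : k = 0 by lra.
by rewrite expr0n mul0r add0r mulr_gt0 ?oppr_gt0 // exprn_gt0 //; lra.
Qed.

(** The reverse Cauchy-Schwarz inequality. *)
Lemma mk_le_N1 p q : mk (h p) (h q) <= -1.
Proof.
rewrite mkhE -lerN2 opprK opprB lerBrDr.
have H : 0 <= height p * height q by rewrite mulr_ge0 // ltW // height_gt0.
have [le0|gt0] := leP (1 + (p.1 * q.1 + p.2 * q.2)) 0.
  exact: le_trans H.
rewrite -(@ler_pXn2r _ 2) ?nnegrE // ?(ltW gt0) // exprMn !height_sqr.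
have := sqr_ge0 (p.1 * q.2 - p.2 * q.1); have := sqr_ge0 (p.1 - q.1).
by have := sqr_ge0 (p.2 - q.2); nra.
Qed.

(** The form is negative definite on the line of [v], so its signature leaves it
    positive definite on the orthogonal complement of [v]. *)
Lemma timelike_orth u v : future v -> mk u v = 0 -> mk u u <= 0 -> u = 0.
Proof.
rewrite /future /minkowski => -[vv v2] uv uu.
set a := u 0 0 in uv uu *; set b := u 0 1 in uv uu *; set c := u 0 2 in uv uu *.
set x := v 0 0 in vv uv; set y := v 0 1 in vv uv; set z := v 0 2 in vv uv v2.
have cz : c * z = a * x + b * y by lra.
have S : 0 <= a ^+ 2 + b ^+ 2 by rewrite addr_ge0 // sqr_ge0.
have cs : (a * x + b * y) ^+ 2 <= (a ^+ 2 + b ^+ 2) * (x ^+ 2 + y ^+ 2).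
  by have := sqr_ge0 (a * y - b * x); nra.
have ab : a ^+ 2 + b ^+ 2 = 0.
  apply/eqP; rewrite eq_le S andbT leNgt; apply/negP => S0.
  have : (a ^+ 2 + b ^+ 2) * (x ^+ 2 + y ^+ 2) < (a ^+ 2 + b ^+ 2) * z ^+ 2.
    by rewrite ltr_pM2l //; lra.
  apply/negP; rewrite -leNgt; apply: le_trans cs; rewrite -cz exprMn.
  by rewrite ler_wpM2r ?sqr_ge0 //; lra.
have a0 : a = 0 by apply/eqP; rewrite -sqrf_eq0; apply/eqP; have := sqr_ge0 a; have := sqr_ge0 b; lra.
have b0 : b = 0 by apply/eqP; rewrite -sqrf_eq0; apply/eqP; have := sqr_ge0 a; have := sqr_ge0 b; lra.
have c0 : c = 0.
  by apply/eqP; move: cz; rewrite a0 b0 !mul0r addr0 => /eqP; rewrite mulf_eq0 (gt_eqF v2) orbF.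
by apply: row3P; rewrite !mxE.
Qed.

Lemma mk_h_eqN1 p q : mk (h p) (h q) = -1 -> p = q.
Proof.
move=> e; apply: h_inj; apply/eqP; rewrite -subr_eq0; apply/eqP.
apply: (@timelike_orth _ (h p)); first exact: future_h.
  by rewrite !mkE mkhh mkC e; ring.
by rewrite !mkE !mkhh (mkC (h q)) e; lra.
Qed.

Lemma h_colinear p q k : h p = k *: h q -> p = q.
Proof.
move=> e; have k0 : 0 < k.
  have := height_gt0 p; rewrite -h2 e mxE h2 pmulr_lgt0 //; exact: height_gt0.
apply: h_inj; have := mkhh p; rewrite e !mkE mkhh => k2.
suff -> : k = 1 by rewrite scale1r.
by nra.
Qed.

Lemma form_nondegenerate u : (forall p, mk u (h p) = 0) -> u = 0.
Proof.
move=> e; apply: (@timelike_orth _ (h (0, 0))) => //; first exact: future_h.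
have e0 := e (0, 0); rewrite /minkowski !h0 !h1 !h2 in e0.
have e1 := e (1, 0); rewrite /minkowski !h0 !h1 !h2 in e1.
have e2 := e (0, 1); rewrite /minkowski !h0 !h1 !h2 in e2.
have u2 : u 0 2 = 0.
  apply/eqP; move: e0; rewrite /= !mulr0 !add0r => /eqP.
  by rewrite oppr_eq0 mulf_eq0 (gt_eqF (height_gt0 _)) orbF.
rewrite u2 /= in e1 e2.
have -> : u = 0 by apply: row3P; rewrite !mxE //; lra.
by rewrite mk0l.
Qed.
End Minkowski.

(** * Distances and segments *)

Section HyperbolicDistance.
Variable R : realType.
Implicit Types (p q a b c : H2 R) (u v w x y : 'rV[R]_3) (k l t s : R).

Notation h := (@hyperboloid R).
Notation mk := (@minkowski R).

(** The exponential of [arcosh t]. *)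
Definition expcosh t : R := t + Num.sqrt (t ^+ 2 - 1).

Lemma sqr_ge1 t : 1 <= t -> 0 <= t ^+ 2 - 1.
Proof. by move=> t1; rewrite subr_ge0 exprn_ege1. Qed.

Lemma expcosh_gt0 t : 1 <= t -> 0 < expcosh t.
Proof. by move=> t1; rewrite /expcosh ltr_wpDr ?sqrtr_ge0 //; lra. Qed.

Lemma expcosh_inj s t : 1 <= s -> 1 <= t -> expcosh s = expcosh t -> s = t.
Proof.
have lt (x y : R) : 1 <= x -> x < y -> expcosh x < expcosh y.
  move=> x1 xy; rewrite /expcosh ltr_leD // ler_sqrt ?sqr_ge1 //; last by lra.
  by rewrite lerD2r ler_pXn2r ?nnegrE //; lra.
move=> s1 t1 e; apply/eqP; rewrite eq_le !leNgt; apply/andP; split; apply/negP.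
  by move=> /(lt _ _ t1); rewrite e ltxx.
by move=> /(lt _ _ s1); rewrite e ltxx.
Qed.

Lemma arcosh_inj s t : 1 <= s -> 1 <= t -> arcosh s = arcosh t -> s = t.
Proof.
move=> s1 t1 e; apply: expcosh_inj => //.
by apply: ln_inj => //; rewrite posrE expcosh_gt0.
Qed.

(** The hyperbolic cosine of the distance.  As the restriction of a bilinear
    form, it is easier to handle than the distance itself. *)
Definition cdist p q : R := - mk (h p) (h q).

Lemma cdist_ge1 p q : 1 <= cdist p q.
Proof. by rewrite /cdist; have := mk_le_N1 p q; lra. Qed.

Lemma cdistC p q : cdist p q = cdist q p. Proof. by rewrite /cdist mkC. Qed.

Lemma cdist_eq1 p q : cdist p q = 1 -> p = q.
Proof. by rewrite /cdist => e; apply: mk_h_eqN1; lra. Qed.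

Lemma hdist_cdist p q a b : hdist p q = hdist a b -> cdist p q = cdist a b.
Proof. by apply: arcosh_inj; exact: cdist_ge1. Qed.

(** This is the addition formula for the hyperbolic cosine. *)
Lemma arcoshD s t (r : R) : 1 <= s -> 1 <= t -> 1 <= r ->
  arcosh s + arcosh t = arcosh r <->
  r = s * t + Num.sqrt (s ^+ 2 - 1) * Num.sqrt (t ^+ 2 - 1).
Proof.
move=> s1 t1 r1.
set S := Num.sqrt (s ^+ 2 - 1); set T := Num.sqrt (t ^+ 2 - 1).
have S0 : 0 <= S := sqrtr_ge0 _; have T0 : 0 <= T := sqrtr_ge0 _.
have S2 : S ^+ 2 = s ^+ 2 - 1 by rewrite sqr_sqrtr // sqr_ge1.
have T2 : T ^+ 2 = t ^+ 2 - 1 by rewrite sqr_sqrtr // sqr_ge1.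
have c1 : 1 <= s * t + S * T.
  have : 1 <= s * t by rewrite mulr_ege1.
  by have : 0 <= S * T := mulr_ge0 S0 T0; lra.
have cE : expcosh (s * t + S * T) = expcosh s * expcosh t.
  rewrite /expcosh -/S -/T.
  have -> : (s * t + S * T) ^+ 2 - 1 = (s * T + t * S) ^+ 2.
    rewrite !sqrrD !exprMn S2 T2; ring.
  rewrite sqrtr_sqr ger0_norm; first ring.
  by rewrite addr_ge0 // mulr_ge0 //; lra.
rewrite /arcosh -!/(expcosh _) -lnM ?posrE ?expcosh_gt0 // -cE.
split=> [e|->] //; apply: expcosh_inj => //.
by apply: ln_inj => //; rewrite posrE expcosh_gt0.
Qed.

Definition between a b p : Prop :=
  exists k l, [/\ 0 <= k, 0 <= l & h p = k *: h a + l *: h b].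

(** If [p] splits the distance from [a] to [b], then the coefficients [k] and [l]
    are quotients of hyperbolic sines of distances.  The difference of [h p] and
    [k *: h a + l *: h b] is orthogonal to [h a] and isotropic, hence zero. *)
Lemma segmentP a b p : segment a b p <-> between a b p.
Proof.
rewrite /segment /= /hdist -!/(cdist _ _) arcoshD ?cdist_ge1 //.
set C := cdist a b; set A := cdist a p; set B := cdist p b.
have C1 : 1 <= C := cdist_ge1 _ _.
have A1 : 1 <= A := cdist_ge1 _ _. have B1 : 1 <= B := cdist_ge1 _ _.
have mab : mk (h a) (h b) = - C by rewrite /C /cdist opprK.
have map : mk (h a) (h p) = - A by rewrite /A /cdist opprK.
have mpb : mk (h p) (h b) = - B by rewrite /B /cdist opprK.
split=> [e|[k [l [k0 l0 e]]]]; last first.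
  have eA : A = k + l * C.
    by have := map; rewrite e !mkE mkhh mab; lra.
  have eB : B = k * C + l.
    by have := mpb; rewrite e !mkE mkhh mab; lra.
  have e1 : k ^+ 2 + l ^+ 2 + 2 * (k * l * C) = 1.
    by have := mkhh p; rewrite e !mkE !mkhh (mkC (h b)) mab; lra.
  have -> : A ^+ 2 - 1 = l ^+ 2 * (C ^+ 2 - 1) by rewrite eA -[in LHS]e1; ring.
  have -> : B ^+ 2 - 1 = k ^+ 2 * (C ^+ 2 - 1) by rewrite eB -[in LHS]e1; ring.
  have sq (r X : R) : 0 <= r -> Num.sqrt (r ^+ 2 * X) = r * Num.sqrt X.
    by move=> r0; rewrite sqrtrM ?sqr_ge0 // sqrtr_sqr ger0_norm.
  rewrite !sq //.
  have -> : l * Num.sqrt (C ^+ 2 - 1) * (k * Num.sqrt (C ^+ 2 - 1))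
    = l * k * Num.sqrt (C ^+ 2 - 1) ^+ 2 by ring.
  rewrite sqr_sqrtr ?sqr_ge1 // eA eB.
  by rewrite -[LHS]mulr1 -[X in C * X]e1; ring.
move: e; set S := Num.sqrt (A ^+ 2 - 1); set T := Num.sqrt (B ^+ 2 - 1) => e.
have S0 : 0 <= S := sqrtr_ge0 _; have T0 : 0 <= T := sqrtr_ge0 _.
have S2 : S ^+ 2 = A ^+ 2 - 1 by rewrite sqr_sqrtr // sqr_ge1.
have T2 : T ^+ 2 = B ^+ 2 - 1 by rewrite sqr_sqrtr // sqr_ge1.
have [C1'|C1'] := eqVneq C 1.
  exists 1, 0; split=> //; rewrite scale1r scale0r addr0; congr (h _).
  apply/esym/cdist_eq1; rewrite -/A.
  have : A <= A * B by rewrite ler_peMr //; lra.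
  by have := mulr_ge0 S0 T0; lra.
have C2 : 0 < C ^+ 2 - 1.
  by rewrite subr_gt0 exprn_egt1 // lt_neqAle eq_sym C1' C1.
set D := Num.sqrt (C ^+ 2 - 1).
have D0 : 0 < D by rewrite sqrtr_gt0.
have DE : D = A * T + B * S.
  rewrite /D (_ : C ^+ 2 - 1 = (A * T + B * S) ^+ 2).
    by rewrite sqrtr_sqr ger0_norm // addr_ge0 // mulr_ge0 //; lra.
  by rewrite e !sqrrD !exprMn S2 T2; ring.
exists (T / D), (S / D); split; rewrite ?divr_ge0 // ?(ltW D0) //.
have eA : A = T / D + S / D * C.
  apply: (mulIf (lt0r_neq0 D0)).
  have -> : (T / D + S / D * C) * D = T + S * C by field; exact: lt0r_neq0.
  rewrite DE e; have -> : A * (A * T + B * S) = A ^+ 2 * T + A * B * S by ring.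
  have -> : A ^+ 2 = S ^+ 2 + 1 by rewrite S2; ring.
  ring.
have eB : B = T / D * C + S / D.
  apply: (mulIf (lt0r_neq0 D0)).
  have -> : (T / D * C + S / D) * D = T * C + S by field; exact: lt0r_neq0.
  rewrite DE e; have -> : B * (A * T + B * S) = B ^+ 2 * S + A * B * T by ring.
  have -> : B ^+ 2 = T ^+ 2 + 1 by rewrite T2; ring.
  ring.
apply/eqP; rewrite -subr_eq0; apply/eqP.
move: eA eB; set k := T / D; set l := S / D => eA eB.
apply: (@timelike_orth _ _ (h a)); first exact: future_h.
  by rewrite !mkE mkhh (mkC (h p)) (mkC (h b)) map mab; lra.
have -> : mk (h p - (k *: h a + l *: h b)) (h p - (k *: h a + l *: h b)) =
  mk (h p) (h p) + k ^+ 2 * mk (h a) (h a) + l ^+ 2 * mk (h b) (h b)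
  + 2 * (k * l) * mk (h a) (h b) - 2 * k * mk (h a) (h p) - 2 * l * mk (h p) (h b).
  by vring.
rewrite !mkhh map mab mpb.
suff : k ^+ 2 + l ^+ 2 + 2 * (k * l * C) = 1 by rewrite eA eB; lra.
have T' : T = k * D by rewrite /k divfK // gt_eqF.
have S' : S = l * D by rewrite /l divfK // gt_eqF.
have D2 : D ^+ 2 = C ^+ 2 - 1 by rewrite sqr_sqrtr // ltW.
have : S * T = l * k * (C ^+ 2 - 1) by rewrite S' T' -D2; ring.
move=> ST; have : (C ^+ 2 - 1) * (k ^+ 2 + l ^+ 2 + 2 * (k * l * C)) = (C ^+ 2 - 1) * 1.
  have l2 : l ^+ 2 * (C ^+ 2 - 1) = A ^+ 2 - 1 by rewrite -S2 S' -D2; ring.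
  have k2 : k ^+ 2 * (C ^+ 2 - 1) = B ^+ 2 - 1 by rewrite -T2 T' -D2; ring.
  have -> : (C ^+ 2 - 1) * (k ^+ 2 + l ^+ 2 + 2 * (k * l * C))
    = k ^+ 2 * (C ^+ 2 - 1) + l ^+ 2 * (C ^+ 2 - 1)
      + 2 * C * (l * k * (C ^+ 2 - 1)) by ring.
  rewrite l2 k2 -ST.
  have ABC : S * T = C - A * B by lra.
  have : (S * T) ^+ 2 = (A ^+ 2 - 1) * (B ^+ 2 - 1) by rewrite exprMn S2 T2.
  by rewrite ABC => H; lra.
by apply: mulfI; rewrite gt_eqF.
Qed.

Lemma between_l a b : between a b a.
Proof. by exists 1, 0; rewrite ler01 lexx scale1r scale0r addr0. Qed.

Lemma between_r a b : between a b b.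
Proof. by exists 0, 1; rewrite ler01 lexx scale1r scale0r add0r. Qed.

Lemma betweenC a b p : between a b p -> between b a p.
Proof. by move=> [k [l [k0 l0 e]]]; exists l, k; split=> //; rewrite addrC. Qed.

Lemma segmentC a b : segment a b = segment b a.
Proof.
by apply/seteqP; split=> p /segmentP/betweenC/segmentP.
Qed.

End HyperbolicDistance.

(** * Isometries *)

Section HyperbolicIsometries.
Variable R : realType.
Implicit Types (p q a b c : H2 R) (u v w x y : 'rV[R]_3) (k l t s : R).

Notation h := (@hyperboloid R).
Notation mk := (@minkowski R).

(** The points [h q + e *: u], projected radially to the hyperboloid, form a path
    that starts from [q] in the direction [u] and stays in [V] for small [e]. *)
Lemma perturb q u (V : set (H2 R)) : nbhs q V ->
  exists (e : R) p (k : R), [/\ 0 < e, 0 < k, V p & h p = k *: (h q + e *: u)].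
Proof.
move=> Vq.
pose w (e : R) : 'rV[R]_3 := h q + e *: u.
have wE i e : w e 0 i = h q 0 i + e * u 0 i by rewrite !mxE.
have cw i : (fun e => w e 0 i) @ (0 : R) --> (h q 0 i : R).
  rewrite [X in _ --> X](_ : _ = h q 0 i + 0 * u 0 i); last by rewrite mul0r addr0.
  under eq_fun do rewrite wE.
  by apply: cvgD; [exact: cvg_cst|apply: cvgM; [exact: cvg_id|exact: cvg_cst]].
have cm : (fun e => mk (w e) (w e)) @ (0 : R) --> (-1 : R).
  rewrite -(mkhh q) /minkowski.
  by apply: cvgB; [apply: cvgD|]; apply: cvgM; exact: cw.
have cn : (fun e => (Num.sqrt (- mk (w e) (w e)))^-1) @ (0 : R) --> (1 : R).
  rewrite [X in _ --> X](_ : _ = (Num.sqrt (- - 1))^-1); last first.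
    by rewrite opprK sqrtr1 invr1.
  have cs : (fun e => Num.sqrt (- mk (w e) (w e))) @ (0 : R) --> Num.sqrt (- - 1 : R).
    exact: (continuous_cvg _ (@sqrt_continuous R _) (cvgN cm)).
  have n0 : Num.sqrt (- - 1 : R) != 0 by rewrite opprK sqrtr1 oner_neq0.
  exact: (cvgV n0 cs).
pose f e : H2 R := ((Num.sqrt (- mk (w e) (w e)))^-1 * w e 0 0,
                    (Num.sqrt (- mk (w e) (w e)))^-1 * w e 0 1).
have cf : f @ (0 : R) --> q.
  rewrite [X in _ --> X](_ : _ = (1 * h q 0 0, 1 * h q 0 1)); last first.
    by rewrite h0 h1 !mul1r; case: (q).
  by exact: (cvg_pair (cvgM cn (cw 0)) (cvgM cn (cw 1))).
have [e e0 [Ve fut]] : exists2 e : R, 0 < e & V (f e) /\ future (w e).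
  have H : \forall e \near (0 : R), V (f e) /\ future (w e).
    near=> e; split; first by near: e; exact: cf.
    split; near: e.
      by apply: (cvgr_lt _ cm); rewrite ltrN10.
    by apply: (cvgr_gt _ (cw 2)); rewrite h2 height_gt0.
  have [e /= e0 He] := H.
  exists (e / 2); first by rewrite divr_gt0.
  apply: He; rewrite /ball_ /= sub0r normrN gtr0_norm ?divr_gt0 //.
  by rewrite ltr_pdivrMr //; lra.
exists e, (f e); have [p [k k0 pE]] := future_point fut.
exists k; split=> //.
have N0 : 0 < Num.sqrt (- mk (w e) (w e)).
  by rewrite sqrtr_gt0 oppr_gt0; case: fut.
suff kE : k = (Num.sqrt (- mk (w e) (w e)))^-1.
  have e1 : k * w e 0 0 = p.1 by rewrite -h0 pE [RHS]mxE.
  have e2 : k * w e 0 1 = p.2 by rewrite -h1 pE [RHS]mxE.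
  by have -> : f e = p by rewrite /f -kE e1 e2 -surjective_pairing.
have : k ^+ 2 * (- mk (w e) (w e)) = 1.
  by have := mkhh p; rewrite pE !mkE; lra.
rewrite -[X in _ * X](@sqr_sqrtr _ (- _)); last first.
  by rewrite oppr_ge0 ltW //; case: fut.
rewrite -exprMn => /eqP; rewrite -(expr1n _ 2) eqrXn2 ?mulr_ge0 ?ltW // => /eqP kN.
by rewrite -[LHS](mulfK (lt0r_neq0 N0)) kN mul1r.
Unshelve. all: by end_near.
Qed.

Section Isometry.
Variable g : H2 R -> H2 R.
Hypothesis gI : isometry g.

Lemma isometry_inj : injective g.
Proof. by case: gI => /bij_inj. Qed.

Lemma isometry_surj q : exists p, g p = q.
Proof. by case: gI => -[g' _ gK] _; exists (g' q). Qed.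

Lemma isometry_mk p q : mk (h (g p)) (h (g q)) = mk (h p) (h q).
Proof.
have := hdist_cdist (gI.2 p q); rewrite /cdist; lra.
Qed.

(** The two sides have the same products with all points of the hyperboloid,
    since [g] is onto and preserves these products. *)
Lemma isometry_comb p a b c k l t :
  h p = k *: h a + l *: h b + t *: h c ->
  h (g p) = k *: h (g a) + l *: h (g b) + t *: h (g c).
Proof.
move=> e; apply/eqP; rewrite -subr_eq0; apply/eqP/form_nondegenerate => q.
have [x <-] := isometry_surj q.
by rewrite !mkE !isometry_mk e !mkE; ring.
Qed.

Lemma isometry_segment a b : g @` segment a b = segment (g a) (g b).
Proof.
apply/seteqP; split=> [_ [p ap <-]|q]; rewrite /segment /= ?gI.2 //.
by have [p <-] := isometry_surj q; rewrite !gI.2 => ap; exists p.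
Qed.

Definition frame0 : H2 R := (0, 0).
Definition frame1 : H2 R := (1, 0).
Definition frame2 : H2 R := (0, 1).

Lemma frame_det : det3 (h frame0) (h frame1) (h frame2) != 0.
Proof.
rewrite /det3 !h0 !h1 !h2 /=.
have := height_gt0 (frame0 : H2 R) => H.
rewrite (_ : _ + _ = height frame0); first exact: lt0r_neq0.
by ring.
Qed.

(** A product of two determinants is a Gram determinant, which [g] preserves.
    Thus [e] is 1 if [g] preserves the orientation, and -1 if [g] reverses it. *)
Lemma isometry_det : exists2 e : R, e ^+ 2 = 1 & forall a b c,
  det3 (h (g a)) (h (g b)) (h (g c)) = e * det3 (h a) (h b) (h c).
Proof.
set d := det3 (h frame0) (h frame1) (h frame2).
set d' := det3 (h (g frame0)) (h (g frame1)) (h (g frame2)).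
have d0 : d != 0 := frame_det.
have dd a b c : det3 (h (g a)) (h (g b)) (h (g c)) * d' = det3 (h a) (h b) (h c) * d.
  by rewrite !gram3 !isometry_mk.
have d'2 : d' ^+ 2 = d ^+ 2 by rewrite !expr2 dd.
have d'0 : d' != 0 by rewrite -sqrf_eq0 d'2 sqrf_eq0.
exists (d / d'); first by rewrite expr_div_n d'2 divff // sqrf_eq0.
move=> a b c; apply: (mulIf d'0); rewrite dd.
by rewrite mulrAC divfK // mulrC.
Qed.

Lemma isometry_fix a b c : det3 (h a) (h b) (h c) != 0 ->
  g a = a -> g b = b -> g c = c -> forall p, g p = p.
Proof.
move=> d0 ga gb gc p; apply: h_inj.
have pE := cramer (h a) (h b) (h c) (h p).
set d := det3 (h a) (h b) (h c) in d0 pE.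
have {}pE : h p = (d^-1 * det3 (h p) (h b) (h c)) *: h a +
  (d^-1 * det3 (h a) (h p) (h c)) *: h b + (d^-1 * det3 (h a) (h b) (h p)) *: h c.
  by rewrite -!scalerA -!scalerDr -pE scalerA mulVf // scale1r.
by rewrite (isometry_comb pE) ga gb gc -pE.
Qed.

End Isometry.

Lemma height_continuous : continuous (@height R).
Proof.
move=> p.
have c1 : (fun p : H2 R => p.1) @ p --> p.1 by exact: cvg_fst.
have c2 : (fun p : H2 R => p.2) @ p --> p.2 by exact: cvg_snd.
have c3 : (fun p : H2 R => 1 + p.1 ^+ 2 + p.2 ^+ 2) @ p --> 1 + p.1 ^+ 2 + p.2 ^+ 2.
  exact: (cvgD (cvgD (cvg_cst _) (cvgM c1 c1)) (cvgM c2 c2)).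
exact: (continuous_cvg _ (@sqrt_continuous R _) c3).
Qed.

Lemma mk_continuous u : continuous (fun p => mk u (h p)).
Proof.
move=> p.
have c1 : (fun p : H2 R => p.1) @ p --> p.1 by exact: cvg_fst.
have c2 : (fun p : H2 R => p.2) @ p --> p.2 by exact: cvg_snd.
have c3 := @height_continuous p.
rewrite /minkowski; under eq_fun do rewrite h0 h1 h2.
exact: (cvgB (cvgD (cvgM (cvg_cst _) c1) (cvgM (cvg_cst _) c2)) (cvgM (cvg_cst _) c3)).
Qed.

Lemma det3_form u v : exists w, forall x, det3 u v x = mk w x.
Proof.
exists (\row_(i < 3) [:: u 0 1 * v 0 2 - u 0 2 * v 0 1;
  u 0 2 * v 0 0 - u 0 0 * v 0 2; - (u 0 0 * v 0 1 - u 0 1 * v 0 0)]`_i).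
by move=> x; rewrite /det3 /minkowski !mxE /=; ring.
Qed.

Lemma det3_continuous u v : continuous (fun p => det3 u v (h p)).
Proof.
have [w wE] := det3_form u v.
by under eq_fun do rewrite wE; exact: mk_continuous.
Qed.

(** The coordinates of [g p] are linear in those of [h p], by [cramer]. *)
Lemma isometry_continuous (g : H2 R -> H2 R) : isometry g -> continuous g.
Proof.
move=> gI; have [e e2 gdet] := isometry_det gI.
have e0 : e != 0 by rewrite -sqrf_eq0 e2 oner_neq0.
set d := det3 (h frame0) (h frame1) (h frame2).
have d0 : d != 0 := frame_det.
have gE p i : h (g p) 0 i = d^-1 * (
    det3 (h frame1) (h frame2) (h p) * h (g frame0) 0 i +
    det3 (h frame2) (h frame0) (h p) * h (g frame1) 0 i +
    det3 (h frame0) (h frame1) (h p) * h (g frame2) 0 i).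
  have := cramer (h (g frame0)) (h (g frame1)) (h (g frame2)) (h (g p)).
  rewrite !gdet -!scalerA -!scalerDr => /(scalerI e0).
  rewrite -/d => /(congr1 (fun u : 'rV_3 => d^-1 * u 0 i)).
  rewrite mxE mulKf // => ->; rewrite !mxE; congr (_ * (_ * _ + _ * _ + _)).
    by rewrite det3_rot.
  by rewrite -det3_rot.
have gc i : continuous (fun p => h (g p) 0 i).
  move=> p; under eq_fun do rewrite gE; rewrite gE.
  have dc u v : (fun p => det3 u v (h p)) @ p --> det3 u v (h p).
    exact: det3_continuous.
  apply: (cvgM (cvg_cst _)).
  exact: (cvgD (cvgD (cvgM (dc _ _) (cvg_cst _)) (cvgM (dc _ _) (cvg_cst _)))
    (cvgM (dc _ _) (cvg_cst _))).
have gE2 : g = fun p => (h (g p) 0 0, h (g p) 0 1).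
  by apply: funext => p; rewrite h0 h1 -surjective_pairing.
by rewrite gE2 => p; exact: (cvg_pair (@gc 0 p) (@gc 1 p)).
Qed.

Lemma isometry_inverse (g g' : H2 R -> H2 R) :
  cancel g g' -> cancel g' g -> isometry g -> isometry g'.
Proof.
move=> gK g'K [_ gI]; split; first by exists g.
by move=> p q; rewrite -gI !g'K.
Qed.

End HyperbolicIsometries.

(** * Convex polygons *)

Section CyclicOrdinals.
Variable n : nat.
Implicit Types i j : 'I_n.

Lemma val_ordS i : val (ordS i) = if i.+1 == n then 0%N else i.+1.
Proof.
rewrite /=; case: eqP => [->|/eqP ne]; first by rewrite modnn.
by rewrite modn_small // ltn_neqAle ne ltn_ord.
Qed.

Lemma ordS_neq i : (2 < n)%N -> ordS i != i.
Proof.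
move=> n2; apply/eqP => /(congr1 val); rewrite val_ordS.
by have := ltn_ord i; case: eqP => /=; lia.
Qed.

Lemma ordSS_neq i : (2 < n)%N -> ordS (ordS i) != i.
Proof.
move=> n2; apply/eqP => /(congr1 val); rewrite !val_ordS.
by have := ltn_ord i; case: (i.+1 =P n) => [e|ne]; case: eqP => /=; lia.
Qed.

End CyclicOrdinals.

Section ConvexPolygons.
Variable R : realType.
Implicit Types (p q a b c x m : H2 R) (P : set (H2 R)).

Notation h := (@hyperboloid R).
Notation mk := (@minkowski R).
Notation orient := (@orientation R).

Lemma orient_rot a b c : orient a b c = orient b c a.
Proof. by rewrite !orientationE det3_rot. Qed.
Lemma orient_swap a b c : orient b a c = - orient a b c.
Proof. by rewrite !orientationE det3_swap. Qed.
Lemma orient_l a b : orient a b a = 0.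
Proof. by rewrite orientationE det3_13. Qed.
Lemma orient_r a b : orient a b b = 0.
Proof. by rewrite orientationE det3_23. Qed.
Lemma orient_comb a b x p q (k l : R) : h x = k *: h p + l *: h q ->
  orient a b x = k * orient a b p + l * orient a b q.
Proof. by rewrite !orientationE => ->; rewrite det3D3 !det3Z3. Qed.
Lemma orient_perturb a b x p q (k l : R) : h x = k *: (h p + l *: h q) ->
  orient a b x = k * (orient a b p + l * orient a b q).
Proof. by rewrite !orientationE => ->; rewrite det3Z3 det3D3 det3Z3. Qed.
Lemma orient_perturbN a b x p q (k l : R) : h x = k *: (h p + l *: - h q) ->
  orient a b x = k * (orient a b p - l * orient a b q).
Proof. by rewrite !orientationE => ->; rewrite det3Z3 det3D3 det3Z3 det3N3 mulrN. Qed.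
Lemma orient_continuous a b : continuous (orient a b).
Proof.
rewrite (_ : orient a b = fun p => det3 (h a) (h b) (h p)).
  exact: det3_continuous.
by apply: funext => p; rewrite orientationE.
Qed.

Lemma orient_gt0_nbhs a b m : 0 < orient a b m -> \forall x \near m, 0 < orient a b x.
Proof. by move=> m0; apply: (cvgr_gt _ (@orient_continuous a b m)). Qed.

Lemma orient_ge0_closed a b : closed [set x | 0 <= orient a b x].
Proof.
have -> : [set x | 0 <= orient a b x] = orient a b @^-1` [set y | 0 <= y] by [].
apply: closed_comp; last exact: closed_ge.
by move=> x _; exact: orient_continuous.
Qed.

Section OnePolygon.
Variables (n : nat) (v : 'I_n -> H2 R).
Hypothesis cv : convex_polygon v.
Implicit Types i j : 'I_n.

Let n2 : (2 < n)%N := cv.1.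

Lemma side_vertex_ge0 i j : 0 <= orient (v i) (v (ordS i)) (v j).
Proof.
have [->|ji] := eqVneq j i; first by rewrite orient_l.
have [->|jSi] := eqVneq j (ordS i); first by rewrite orient_r.
by rewrite ltW // cv.2.
Qed.

Lemma side_vertex_eq0 i j :
  orient (v i) (v (ordS i)) (v j) = 0 -> j = i \/ j = ordS i.
Proof.
move=> e; have [->|ji] := eqVneq j i; first by left.
have [->|jSi] := eqVneq j (ordS i); first by right.
by have := cv.2 _ _ ji jSi; rewrite e ltxx.
Qed.

Lemma polygon_vertex j : polygon_region v (v j).
Proof. by move=> i; exact: side_vertex_ge0. Qed.

Lemma vertex_inj : injective v.
Proof.
move=> i j e; apply/eqP/contraT => ij.
have [ji|ji] := eqVneq j (ordS i).
  have : 0 < orient (v j) (v (ordS j)) (v i).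
    by apply: cv.2 => //; rewrite ji eq_sym ordSS_neq.
  by rewrite e orient_l ltxx.
have : 0 < orient (v i) (v (ordS i)) (v j) by apply: cv.2 => //; rewrite eq_sym.
by rewrite e orient_l ltxx.
Qed.

Lemma turn_gt0 i : 0 < orient (v (ord_pred i)) (v i) (v (ordS i)).
Proof.
rewrite -{2 3}(ord_predK i); apply: cv.2; rewrite ?ordS_neq // ordSS_neq //.
Qed.

(** By [cramer], [h p] is a combination of the ends of the side, whose coefficients
    are nonnegative as [p] is on the left of the next and of the previous side. *)
Lemma polygon_side i p : polygon_region v p ->
  orient (v i) (v (ordS i)) p = 0 -> between (v i) (v (ordS i)) p.
Proof.
move=> Pp e; have := turn_gt0 (ordS i); rewrite ordSK => D0.
set a := v i; set b := v (ordS i) in D0 *; set c := v (ordS (ordS i)) in D0.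
have := cramer (h a) (h b) (h c) (h p); rewrite -!orientationE.
rewrite e scale0r addr0 (orient_rot p) => pE.
set D := orient a b c in D0 pE; set l := orient b c p in pE.
set k := orient a p c in pE.
have {}pE : h p = (D^-1 * l) *: h a + (D^-1 * k) *: h b.
  by rewrite -!scalerA -scalerDr -pE scalerA mulVf ?scale1r // gt_eqF.
exists (D^-1 * l), (D^-1 * k); split => //.
  by rewrite mulr_ge0 ?invr_ge0 ?(ltW D0) //; exact: Pp.
have := Pp (ord_pred i); rewrite ord_predK (orient_comb _ _ pE) orient_r mulr0 add0r.
by rewrite pmulr_lge0 //; exact: turn_gt0.
Qed.

(** Both points lie on each of the two sides that meet at the vertex. *)
Lemma vertex_extreme j a b (k l : R) : polygon_region v a -> polygon_region v b ->
  0 < k -> 0 < l -> h (v j) = k *: h a + l *: h b -> a = v j /\ b = v j.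
Proof.
move=> Pa Pb k0 l0 e.
have zero i : orient (v i) (v (ordS i)) (v j) = 0 ->
    orient (v i) (v (ordS i)) a = 0 /\ orient (v i) (v (ordS i)) b = 0.
  rewrite (orient_comb _ _ e) => s0; have := Pa i; have := Pb i.
  set x := orient _ _ b; set y := orient _ _ a => x0 y0.
  have kx : 0 <= k * y by rewrite mulr_ge0 // ltW.
  have ly : 0 <= l * x by rewrite mulr_ge0 // ltW.
  have := s0; rewrite -/x -/y => s1.
  have /eqP : k * y = 0 by lra.
  have /eqP : l * x = 0 by lra.
  by rewrite !mulf_eq0 (gt_eqF k0) (gt_eqF l0) /= => /eqP -> /eqP ->.
have [aj bj] := zero j (orient_l _ _).
have [ap bp] : orient (v (ord_pred j)) (v (ordS (ord_pred j))) a = 0 /\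
   orient (v (ord_pred j)) (v (ordS (ord_pred j))) b = 0.
  by apply: zero; rewrite ord_predK orient_r.
have end_ c : polygon_region v c -> orient (v j) (v (ordS j)) c = 0 ->
    orient (v (ord_pred j)) (v (ordS (ord_pred j))) c = 0 -> c = v j.
  move=> Pc cj; have [s [t [s0 t0 cE]]] := polygon_side Pc cj.
  rewrite (orient_comb _ _ cE) ord_predK orient_r mulr0 add0r => /eqP.
  rewrite mulf_eq0 (gt_eqF (turn_gt0 j)) orbF => /eqP t00.
  by move: cE; rewrite t00 scale0r addr0; exact: h_colinear.
by split; exact: end_.
Qed.

Lemma strict_nbhs p : (forall i, 0 < orient (v i) (v (ordS i)) p) ->
  nbhs p [set x | forall i, 0 < orient (v i) (v (ordS i)) x].
Proof.
move=> sp; apply: (@filter_forall _ _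
  (fun i x => 0 < orient (v i) (v (ordS i)) x) (nbhs p)) => i.
exact: orient_gt0_nbhs.
Qed.

Lemma polygon_closed : closed (polygon_region v).
Proof.
have -> : polygon_region v
    = \bigcap_(i in [set: 'I_n]) [set x | 0 <= orient (v i) (v (ordS i)) x].
  by apply/seteqP; split=> x Px i //=; exact: Px.
by apply: closed_bigI => i _; exact: orient_ge0_closed.
Qed.

Lemma open_side_gt0 i j m (k l : R) : 0 < k -> 0 < l ->
  h m = k *: h (v i) + l *: h (v (ordS i)) ->
  j != i -> 0 < orient (v j) (v (ordS j)) m.
Proof.
move=> k0 l0 e ji; rewrite (orient_comb _ _ e).
have a0 := side_vertex_ge0 j i; have b0 := side_vertex_ge0 j (ordS i).
have ka := mulr_ge0 (ltW k0) a0; have lb := mulr_ge0 (ltW l0) b0.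
rewrite lt_neqAle addr_ge0 // andbT eq_sym; apply/eqP => s0.
have /eqP : k * orient (v j) (v (ordS j)) (v i) = 0 by lra.
rewrite mulf_eq0 (gt_eqF k0) /= => /eqP /side_vertex_eq0.
have /eqP : l * orient (v j) (v (ordS j)) (v (ordS i)) = 0 by lra.
rewrite mulf_eq0 (gt_eqF l0) /= => /eqP /side_vertex_eq0.
move=> B [A|A]; first by rewrite A eqxx in ji.
case: B => B; last by move/ordS_inj: B ji => ->; rewrite eqxx.
by have := ordSS_neq j n2; rewrite -A B eqxx.
Qed.

End OnePolygon.

(** The extreme points of a set, in terms of the linear structure of the
    hyperboloid model: they are defined by the set alone, which shows that a
    polygonal region determines its vertices. *)
Definition extreme P p : Prop := P p /\
  forall a b (k l : R), P a -> P b -> 0 < k -> 0 < l ->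
    h p = k *: h a + l *: h b -> a = p /\ b = p.

(** A point on the left of all sides can be moved both ways in some direction, and
    a point inside a side is a combination of the ends of the side. *)
Lemma extremeP n (v : 'I_n -> H2 R) p : convex_polygon v ->
  extreme (polygon_region v) p <-> exists i, p = v i.
Proof.
move=> cv; split=> [[Pp ep]|[i ->]]; last first.
  by split=> [|a b k l]; [exact: polygon_vertex|exact: vertex_extreme].
have [sp|] := pselect (forall i, 0 < orient (v i) (v (ordS i)) p).
  have i0 : 'I_n by case: cv => n2 _; exists 0%N; lia.
  have N := strict_nbhs sp.
  have [e [q [k [e0 k0 Sq qE]]]] := perturb (h (v i0)) N.
  have [e' [q' [k' [e0' k0' Sq' qE']]]] := perturb (- h (v i0)) N.
  have [] := ep q q' (e' / k / (e + e')) (e / k' / (e + e')).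
  - by move=> i; rewrite ltW // Sq.
  - by move=> i; rewrite ltW // Sq'.
  - by rewrite !divr_gt0 // addr_gt0.
  - by rewrite !divr_gt0 // addr_gt0.
  - rewrite qE qE'; move: (h p) (h (v i0)) => hp u; apply: row3P; rewrite !mxE;
    by field; rewrite !gt_eqF // addr_gt0.
  move=> qp _; exists i0; move: qE; rewrite qp => pE.
  apply/esym/(@h_colinear _ _ _ ((1 - k) / (k * e))).
  have : (1 - k) *: h p = (k * e) *: h (v i0).
    by rewrite scalerBl scale1r {1}pE scalerDr scalerA addrC addKr.
  move=> /(congr1 (fun u => (k * e)^-1 *: u)); rewrite !scalerA mulVf ?scale1r.
    by rewrite mulrC.
  by rewrite gt_eqF // mulr_gt0.
move=> /existsNP[i /negP]; rewrite -leNgt => le0.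
have /eqP e0 : orient (v i) (v (ordS i)) p == 0 by rewrite eq_le le0 Pp.
have [k [l [k0 l0 pE]]] := polygon_side cv Pp e0.
have [kz|kz] := eqVneq k 0.
  by exists (ordS i); move: pE; rewrite kz scale0r add0r; exact: h_colinear.
have [lz|lz] := eqVneq l 0.
  by exists i; move: pE; rewrite lz scale0r addr0; exact: h_colinear.
have [] := ep (v i) (v (ordS i)) k l; rewrite ?lt_neqAle ?(eq_sym 0) ?kz ?lz //.
- exact: polygon_vertex.
- exact: polygon_vertex.
by move=> <- _; exists i.
Qed.

End ConvexPolygons.

(** * Directed sides *)

Section Sides.
Variable R : realType.
Implicit Types (p q r a b c x m : H2 R) (P : set (H2 R)).

Notation h := (@hyperboloid R).
Notation orient := (@orientation R).

(** A side of [P] with the direction that has [P] on its left, as the darts of a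
    combinatorial map. *)
Definition dart P p q : Prop := exists n (v : 'I_n -> H2 R),
  [/\ convex_polygon v, P = polygon_region v & exists i, p = v i /\ q = v (ordS i)].

Definition polygonal P : Prop :=
  exists n (v : 'I_n -> H2 R), convex_polygon v /\ P = polygon_region v.

Section TwoPresentations.
Variables (n n' : nat) (v : 'I_n -> H2 R) (w : 'I_n' -> H2 R).
Hypotheses (cv : convex_polygon v) (cw : convex_polygon w).
Hypothesis vw : polygon_region v = polygon_region w.

Lemma same_vertex i : exists j, w j = v i.
Proof.
have /(extremeP _ cw)[j ->] : extreme (polygon_region w) (v i).
  by rewrite -vw; apply/(extremeP _ cv); exists i.
by exists j.
Qed.

End TwoPresentations.

(** If the successors of a common vertex differed, each of them would be strictly to
    the left of the side from that vertex to the other. *)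
Lemma same_side n n' (v : 'I_n -> H2 R) (w : 'I_n' -> H2 R) :
  convex_polygon v -> convex_polygon w -> polygon_region v = polygon_region w ->
  forall i, exists j, w j = v i /\ w (ordS j) = v (ordS i).
Proof.
move=> cv cw vw i; have [j wj] := same_vertex cv cw vw i.
have [k vk] := same_vertex cw cv (esym vw) (ordS j).
exists j; split=> //; have [<- //|ki] := eqVneq k (ordS i).
have [l wl] := same_vertex cv cw vw (ordS i).
have [ki'|ki'] := eqVneq k i.
  have /(vertex_inj cw)/eqP : w (ordS j) = w j by rewrite wj -vk ki'.
  by rewrite (negPf (ordS_neq _ cw.1)).
have := cv.2 _ _ ki' ki; rewrite -wj -wl vk => s1.
have := side_vertex_ge0 cw j l.
by rewrite orient_rot orient_swap -orient_rot oppr_ge0 leNgt s1.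
Qed.

Lemma same_size n n' (v : 'I_n -> H2 R) (w : 'I_n' -> H2 R) :
  convex_polygon v -> convex_polygon w -> polygon_region v = polygon_region w ->
  n = n'.
Proof.
have le (s s' : nat) (u : 'I_s -> H2 R) (u' : 'I_s' -> H2 R) : convex_polygon u ->
    convex_polygon u' -> polygon_region u = polygon_region u' -> (s <= s')%N.
  move=> cu cu' uu'.
  have [f fE] := choice (same_vertex cu cu' uu').
  have fi : injective f.
    by move=> i j fij; apply: (vertex_inj cu); rewrite -!fE fij.
  by have := leq_card f fi; rewrite !card_ord.
by move=> cv cw vw; apply/eqP; rewrite eqn_leq (le _ _ v w) ?(le _ _ w v).
Qed.

Lemma dart_rep n (v : 'I_n -> H2 R) p q : convex_polygon v ->
  dart (polygon_region v) p q -> exists i, p = v i /\ q = v (ordS i).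
Proof.
move=> cv [n' [w [cw vw [j [-> ->]]]]].
by have [i [<- <-]] := same_side cw cv (esym vw) j; exists i.
Qed.

Lemma rep_dart n (v : 'I_n -> H2 R) i : convex_polygon v ->
  dart (polygon_region v) (v i) (v (ordS i)).
Proof. by move=> cv; exists n, v; split=> //; exists i. Qed.

Lemma dart_polygonal P p q : dart P p q -> polygonal P.
Proof. by move=> [n [v [cv PE _]]]; exists n, v. Qed.

Lemma dart_next P p q q' : dart P p q -> dart P p q' -> q = q'.
Proof.
move=> [n [v [cv PE [i [-> ->]]]]]; rewrite PE => /(dart_rep cv)[j [/(vertex_inj cv)-> ->]].
by [].
Qed.

Lemma dart_prev P p p' q : dart P p q -> dart P p' q -> p = p'.
Proof.
move=> [n [v [cv PE [i [-> ->]]]]]; rewrite PE.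
by move=> /(dart_rep cv)[j [-> /(vertex_inj cv)/ordS_inj->]].
Qed.

Lemma dart_neq P p q : dart P p q -> p <> q.
Proof.
move=> [n [v [cv PE [i [-> ->]]]]] /(vertex_inj cv)/esym/eqP.
by rewrite (negPf (ordS_neq _ cv.1)).
Qed.

Lemma dart_asym P p q : dart P p q -> ~ dart P q p.
Proof.
move=> [n [v [cv PE [i [-> ->]]]]]; rewrite PE.
move=> /(dart_rep cv)[j [/(vertex_inj cv)<- /(vertex_inj cv)/esym/eqP]].
by rewrite (negPf (ordSS_neq _ cv.1)).
Qed.

Lemma vertex_ofP P p : vertex_of P p <-> exists q, dart P p q.
Proof.
split=> [[n [v [cv PE [i ->]]]]|[q [n [v [cv PE [i [-> _]]]]]]].
  by exists (v (ordS i)), n, v; split=> //; exists i.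
by exists n, v; split=> //; exists i.
Qed.

Lemma vertex_of_prev P p : vertex_of P p -> exists o, dart P o p.
Proof.
move=> [n [v [cv PE [i ->]]]]; exists (v (ord_pred i)), n, v; split=> //.
by exists (ord_pred i); rewrite ord_predK.
Qed.

Lemma dart_vertex_l P p q : dart P p q -> vertex_of P p.
Proof. by move=> d; apply/vertex_ofP; exists q. Qed.

Lemma dart_vertex_r P p q : dart P p q -> vertex_of P q.
Proof. by move=> [n [v [cv PE [i [_ ->]]]]]; exists n, v; split=> //; exists (ordS i). Qed.

Lemma side_ofP P E : side_of P E <-> exists p q, dart P p q /\ E = segment p q.
Proof.
split=> [[n [v [cv PE [i ->]]]]|[p [q [[n [v [cv PE [i [-> ->]]]]] ->]]]].
  by exists (v i), (v (ordS i)); split=> //; exists n, v; split=> //; exists i.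
by exists n, v; split=> //; exists i.
Qed.

Lemma vertex_of_in P p : vertex_of P p -> P p.
Proof. by move=> [n [v [cv -> [i ->]]]]; exact: polygon_vertex. Qed.

Lemma dart_ge0 P p q x : dart P p q -> P x -> 0 <= orient p q x.
Proof. by move=> [n [v [cv -> [i [-> ->]]]]]; exact. Qed.

Lemma polygonalP P x : polygonal P ->
  (forall p q, dart P p q -> 0 <= orient p q x) -> P x.
Proof.
by move=> [n [v [cv ->]]] H i; apply: H; exact: rep_dart.
Qed.

Lemma polygonal_closed P : polygonal P -> closed P.
Proof. by move=> [n [v [cv ->]]]; exact: polygon_closed. Qed.

Lemma dart_turn P o p q : dart P o p -> dart P p q -> 0 < orient o p q.
Proof.
move=> [n [v [cv PE [i [-> ->]]]]]; rewrite PE.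
move=> /(dart_rep cv)[j [/(vertex_inj cv)<- ->]].
by have := turn_gt0 cv (ordS i); rewrite ordSK.
Qed.

Lemma dart_gt0 P p q x : dart P p q -> vertex_of P x -> x <> p -> x <> q ->
  0 < orient p q x.
Proof.
move=> [n [v [cv PE [i [-> ->]]]]]; rewrite PE => /vertex_ofP[y].
move=> /(dart_rep cv)[j [-> _]] ji jSi; apply: cv.2.
  by apply/eqP => e; apply: ji; rewrite e.
by apply/eqP => e; apply: jSi; rewrite e.
Qed.

Lemma between_in P p q x : dart P p q -> between p q x -> P x.
Proof.
move=> d [k [l [k0 l0 e]]]; apply: polygonalP (dart_polygonal d) _ => a b ab.
rewrite (orient_comb _ _ e) addr_ge0 // mulr_ge0 // (dart_ge0 ab) //;
  apply: vertex_of_in; [exact: dart_vertex_l d|exact: dart_vertex_r d].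
Qed.

Lemma between_orient0 p q x : between p q x -> orient p q x = 0.
Proof.
move=> [k [l [_ _ e]]]; rewrite (orient_comb _ _ e) orient_l orient_r.
by rewrite !mulr0 addr0.
Qed.

Lemma vertex_between P p q x : dart P p q -> vertex_of P x -> between p q x ->
  x = p \/ x = q.
Proof.
move=> d vx /between_orient0 e; have [|xp] := pselect (x = p); first by left.
have [|xq] := pselect (x = q); first by right.
by have := dart_gt0 d vx xp xq; rewrite e ltxx.
Qed.

(** The points of [P] that lie on no side of it. *)
Definition interior_point P x : Prop := forall p q, dart P p q -> 0 < orient p q x.

Lemma interior_point_in P x : polygonal P -> interior_point P x -> P x.
Proof. by move=> pP ix; apply: polygonalP => // p q d; rewrite ltW // ix. Qed.

Lemma interior_point_side P x E : interior_point P x -> side_of P E -> ~ E x.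
Proof.
move=> ix /side_ofP[p [q [d ->]]] /segmentP/between_orient0.
by apply/eqP; rewrite gt_eqF // ix.
Qed.

Lemma interior_point_vertex P x : interior_point P x -> ~ vertex_of P x.
Proof. by move=> ix /vertex_ofP[q] /ix; rewrite orient_l ltxx. Qed.

Definition open_segment a b m : Prop :=
  exists k l : R, [/\ 0 < k, 0 < l & h m = k *: h a + l *: h b].

Lemma open_segment_between a b m : open_segment a b m -> between a b m.
Proof. by move=> [k [l [k0 l0 e]]]; exists k, l; split; rewrite ?ltW. Qed.

Lemma midpoint a b : exists m, open_segment a b m.
Proof.
have [m [k k0 mE]] : exists p, exists2 k : R, 0 < k & h p = k *: (1 *: h a + 1 *: h b).
  by apply/future_point/future_comb => //; exact: future_h.
by exists m, k, k; split=> //; rewrite mE !scale1r scalerDr.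
Qed.

Lemma open_side_gt0_dart P p q m a b : dart P p q -> open_segment p q m ->
  dart P a b -> (a, b) <> (p, q) -> 0 < orient a b m.
Proof.
move=> [n [v [cv PE [i [-> ->]]]]] [k [l [k0 l0 mE]]]; rewrite PE.
move=> /(dart_rep cv)[j [-> ->]] ji; apply: (open_side_gt0 cv k0 l0 mE).
by apply/eqP => e; apply: ji; rewrite e.
Qed.

Lemma other_sides_nbhs P p q m : dart P p q -> open_segment p q m ->
  nbhs m [set x | forall a b, dart P a b -> (a, b) <> (p, q) -> 0 < orient a b x].
Proof.
move=> [n [v [cv PE [i [pE qE]]]]] [k [l [k0 l0 mE]]]; rewrite PE.
have N : nbhs m [set x | forall j, j != i -> 0 < orient (v j) (v (ordS j)) x].
  apply: (@filter_forall _ _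
    (fun j x => j != i -> 0 < orient (v j) (v (ordS j)) x) (nbhs m)) => j.
  have [->|ji] := eqVneq j i; first exact: nearW.
  rewrite pE qE in mE; have := open_side_gt0 cv k0 l0 mE ji.
  by move/orient_gt0_nbhs; apply: filterS.
apply: filterS N => x H a b /(dart_rep cv)[j [-> ->]] ji; apply: H.
by apply/eqP => e; apply: ji; rewrite e pE qE.
Qed.

(** Start from an inner point of the side and move slightly to the left. *)
Lemma dart_overlap P P' p q : dart P p q -> dart P' p q ->
  exists x, interior_point P x /\ interior_point P' x.
Proof.
move=> d d'; have [m mS] := midpoint p q.
have [c [cP cp cq]] : exists c, [/\ vertex_of P c, c <> p & c <> q].
  have [c dc] := (vertex_ofP P q).1 (dart_vertex_r d).
  exists c; split; first exact: dart_vertex_r dc.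
    by move=> cp; move: dc; rewrite cp; exact: dart_asym d.
  by move=> /esym; exact: dart_neq dc.
have N := filterI (other_sides_nbhs d mS) (other_sides_nbhs d' mS).
have [e [x [k [e0 k0 [Sx Sx'] xE]]]] := perturb (h c) (N _).
have pq0 : 0 < orient p q x.
  rewrite (orient_perturb _ _ xE) (between_orient0 (open_segment_between mS)).
  by rewrite add0r !mulr_gt0 // (dart_gt0 d).
by exists x; split=> a b ab; have [[-> ->] //|ne] := pselect ((a, b) = (p, q));
  [exact: Sx|exact: Sx'].
Qed.

(** The polygon does not contain the points slightly to the right of its side. *)
Lemma dart_exit P p q m (V : set (H2 R)) : dart P p q -> open_segment p q m ->
  nbhs m V -> exists x, V x /\ ~ P x.
Proof.
move=> d mS N; have [c dc] := (vertex_ofP P q).1 (dart_vertex_r d).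
have [e [x [k [e0 k0 Vx xE]]]] := perturb (- h c) N.
exists x; split=> //; move/(dart_ge0 d).
rewrite (orient_perturbN _ _ xE) (between_orient0 (open_segment_between mS)).
rewrite sub0r mulrN oppr_ge0 leNgt; apply/negP; rewrite negbK.
by rewrite !mulr_gt0 // (dart_turn d dc).
Qed.

Lemma segment_end a b c d : a <> b -> segment a b = segment c d ->
  a = c \/ a = d.
Proof.
move=> ab e.
have : segment c d a by rewrite -e; apply/segmentP; exact: between_l.
move=> /segmentP[k [l [k0 l0 aE]]].
have [kz|kz] := eqVneq k 0.
  by right; move: aE; rewrite kz scale0r add0r; exact: h_colinear.
have [lz|lz] := eqVneq l 0.
  by left; move: aE; rewrite lz scale0r addr0; exact: h_colinear.
have : segment a b c by rewrite e; apply/segmentP; exact: between_l.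
move=> /segmentP[k1 [l1 [k10 l10 cE]]].
have : segment a b d by rewrite e; apply/segmentP; exact: between_r.
move=> /segmentP[k2 [l2 [k20 l20 dE]]].
left; have [l1z|l1z] := eqVneq l1 0.
  by apply/esym; move: cE; rewrite l1z scale0r addr0; exact: h_colinear.
have L : 0 < k * l1 + l * l2.
  by rewrite ltr_wpDr ?mulr_ge0 // mulr_gt0 // lt_neqAle eq_sym ?kz ?l1z.
case: ab; apply/esym.
apply: (@h_colinear _ _ _ ((1 - (k * k1 + l * k2)) / (k * l1 + l * l2))).
have -> : h b = (k * l1 + l * l2)^-1 *: ((k * l1 + l * l2) *: h b).
  by rewrite scalerA mulVf ?scale1r // gt_eqF.
have -> : (k * l1 + l * l2) *: h b = (1 - (k * k1 + l * k2)) *: h a.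
  rewrite scalerBl scale1r {1}aE cE dE !scalerDr !scalerA !scalerDl.
  apply: row3P; rewrite !mxE; ring.
by rewrite scalerA mulrC.
Qed.

Lemma segment_ends a b c d : a <> b -> segment a b = segment c d ->
  (a = c /\ b = d) \/ (a = d /\ b = c).
Proof.
move=> ab e; have [ac|ad] := segment_end ab e.
- have [|//|] := segment_end _ (etrans (segmentC b a) e); first by move/esym.
    by move=> bc; case: ab; rewrite ac bc.
  by left.
- have [|bc|bd] := segment_end _ (etrans (segmentC b a) e); first by move/esym.
    by right.
  by case: ab; rewrite ad bd.
Qed.

End Sides.

(** * Edge-to-edge tilings *)

Section EdgeToEdgeTilings.
Variable R : realType.
Implicit Types (p q o r a b c x m : H2 R) (t : set (H2 R)).

Notation h := (@hyperboloid R).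
Notation orient := (@orientation R).

Variable T : set (set (H2 R)).
Hypothesis tT : tiling T.
Hypothesis eT : edge_to_edge T.
Hypothesis pT : forall t, T t -> polygonal t.

Lemma tile_at p : exists2 t, T t & t p.
Proof.
have : (\bigcup_(t in T) t) p by have [-> _ _] := tT.
by move=> [t Tt tp]; exists t.
Qed.

Lemma interior_point_tile t t' x : T t -> T t' -> interior_point t x -> t' x -> t = t'.
Proof.
move=> Tt Tt' ix t'x; have tx := interior_point_in (pT Tt) ix.
have [//|tt'] := pselect (t = t').
have [e|[p [tp _ e]]|[E [tE _ e]]] := eT Tt Tt' tt'.
- by have : (t `&` t') x by []; rewrite e.
- have : (t `&` t') x by []; rewrite e => /= xp.
  by case: (interior_point_vertex ix); rewrite xp.
- have : (t `&` t') x by []; rewrite e => /=.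
  by move/(interior_point_side ix tE).
Qed.

Lemma dart_tile t t' p q : T t -> T t' -> dart t p q -> dart t' p q -> t = t'.
Proof.
move=> Tt Tt' d d'; have [x [ix ix']] := dart_overlap d d'.
exact: (interior_point_tile Tt Tt' ix (interior_point_in (pT Tt') ix')).
Qed.

(** The tiles share this vertex only, or a side, which has no vertices but its
    ends. *)
Lemma common_vertex t t' p : T t -> T t' -> vertex_of t p -> t' p -> vertex_of t' p.
Proof.
move=> Tt Tt' vp t'p; have tp := vertex_of_in vp.
have [<- //|tt'] := pselect (t = t').
have [e|[r [_ r' e]]|[E [/side_ofP[a [b [ab ->]]] /side_ofP[c [d [cd E2]]] e]]]
  := eT Tt Tt' tt'; have : (t `&` t') p by [].
- by rewrite e.
- by rewrite e => /= ->.
- rewrite e => /= /segmentP/(vertex_between ab vp).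
  have cv := dart_vertex_l cd. have dv := dart_vertex_r cd.
  by have [[-> ->]|[-> ->]] := segment_ends (dart_neq ab) E2; case=> ->.
Qed.

(** The other tiles near [m] are finitely many and closed.  If none of them
    contained [m], then [t] would cover a neighborhood of [m]. *)
Lemma another_tile t p q m : T t -> dart t p q -> open_segment p q m ->
  exists t', [/\ T t', t' <> t & t' m].
Proof.
move=> Tt d mS; apply: contrapT => no.
have [_ _ /(_ m)[U Um fU]] := tT.
set F := [set t' | T t' /\ t' `&` U !=set0] in fU.
have cl : closed (\bigcup_(t' in F `\ t) t').
  apply: closed_bigcup => [|t' [[Tt' _] _]]; last exact: polygonal_closed (pT Tt').
  exact: finite_setD.
have Nm : nbhs m (~` \bigcup_(t' in F `\ t) t').
  apply: open_nbhs_nbhs; split; first exact: closed_openC.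
  by move=> [t' [[Tt' _] t't] t'm]; apply: no; exists t'.
have [x [[Ux ncx] ntx]] := dart_exit d mS (filterI Um Nm).
have [t' Tt' t'x] := tile_at x; apply: ncx; exists t' => //.
split; first by split=> //; exists x.
by move=> e; rewrite e in t'x.
Qed.

Lemma dart_meet t t' p q : T t -> T t' -> dart t p q -> dart t' q p ->
  t `&` t' = segment p q.
Proof.
move=> Tt Tt' d d'.
have tt' : t <> t' by move=> e; case: (dart_asym d); rewrite e.
have tp : (t `&` t') p.
  by split; apply: vertex_of_in; [exact: dart_vertex_l d|exact: dart_vertex_r d'].
have tq : (t `&` t') q.
  by split; apply: vertex_of_in; [exact: dart_vertex_r d|exact: dart_vertex_l d'].
have [e|[r [_ _ e]]|[E [/side_ofP[a [b [ab ->]]] _ e]]] := eT Tt Tt' tt'.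
- by rewrite e in tp.
- rewrite e in tp tq; case: (dart_neq d).
  by rewrite (_ : p = r) //= (_ : q = r).
- rewrite e in tp tq *.
  have := vertex_between ab (dart_vertex_l d) ((segmentP _ _ _).1 tp).
  have := vertex_between ab (dart_vertex_r d) ((segmentP _ _ _).1 tq).
  move=> [qa|qb] [pa|pb].
  + by case: (dart_neq d); rewrite pa qa.
  + by rewrite pb qa segmentC.
  + by rewrite pa qb.
  + by case: (dart_neq d); rewrite pb qb.
Qed.

(** Another tile contains an inner point of this side, so it meets [t] along a whole
    side of both; it overlaps [t] unless the side has the opposite direction. *)
Lemma dart_reverse t p q : T t -> dart t p q -> exists2 t', T t' & dart t' q p.
Proof.
move=> Tt d; have [m mS] := midpoint p q.
have [t' [Tt' t't t'm]] := another_tile Tt d mS.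
have tm := between_in d (open_segment_between mS).
have : (t `&` t') m by [].
have mpq a b : dart t a b -> between a b m -> a = p /\ b = q.
  move=> ab /between_orient0 e.
  have [[-> ->] //|ne] := pselect ((a, b) = (p, q)).
  by have := open_side_gt0_dart d mS ab ne; rewrite e ltxx.
have [|e|[r [/vertex_ofP[s rs] _ e]]|[E [/side_ofP[a [b [ab E1]]] t'E e]]] := eT Tt Tt'.
- by move=> tt'; apply: t't.
- by rewrite e.
- rewrite e => /= mr; rewrite mr in mS mpq tm.
  have [z d_or] := vertex_of_prev (dart_vertex_l rs).
  have [rp _] := mpq _ _ rs (between_l _ _).
  have [_ rq] := mpq _ _ d_or (between_r _ _).
  by case: (dart_neq d); rewrite -rp.
rewrite e E1 => /segmentP/(mpq _ _ ab)[ap bq].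
move/side_ofP: t'E => [c [d' [cd E2]]]; exists t' => //.
have [[ac bd]|[ad bc]] := segment_ends (dart_neq ab) (etrans (esym E1) E2).
  by case: t't; apply: (dart_tile Tt' Tt cd); rewrite -ac -bd ap bq.
by rewrite -ap -bq ad bc.
Qed.

(** [turn p t t'] says that [t'] follows [t] counterclockwise around [p]. *)
Definition turn p t t' : Prop := exists o, dart t o p /\ dart t' p o.

Lemma turn_exists p t : T t -> vertex_of t p -> exists2 t', T t' & turn p t t'.
Proof.
move=> Tt /vertex_of_prev[z op]; have [t' Tt' po] := dart_reverse Tt op.
by exists t' => //; exists z.
Qed.

Lemma turn_inj p t1 t2 t' : T t1 -> T t2 -> turn p t1 t' -> turn p t2 t' -> t1 = t2.
Proof.
move=> T1 T2 [z [zp pz]] [z' [zp' /(dart_next pz) zz]]; subst z'.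
exact: dart_tile T1 T2 zp zp'.
Qed.

Lemma turn_vertex p t t' : turn p t t' -> vertex_of t' p.
Proof. by move=> [z [_ d]]; exact: dart_vertex_l d. Qed.

Lemma turn_neq p t t' : turn p t t' -> t <> t'.
Proof. by move=> [z [d d']] e; case: (dart_asym d); rewrite e. Qed.

(** Otherwise the two tiles would have two consecutive sides in common. *)
Lemma turn_asym p t t' : T t -> T t' -> turn p t t' -> ~ turn p t' t.
Proof.
move=> Tt Tt' [z [zp pz]] [q [qp pq]].
have := dart_meet Tt Tt' zp pz.
rewrite (dart_meet Tt Tt' pq qp) => /(segment_ends (dart_neq pq))[[pz' _]|[_ qz]].
  by case: (dart_neq zp).
by case: (dart_asym zp); rewrite -qz.
Qed.

End EdgeToEdgeTilings.

(** * Images of polygons by isometries *)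

Section IsometricImages.
Variable R : realType.
Implicit Types (p q o r a b c x m : H2 R) (t P : set (H2 R)) (g : H2 R -> H2 R).

Notation h := (@hyperboloid R).
Notation orient := (@orientation R).

Definition ngon n P : Prop :=
  exists v : 'I_n -> H2 R, convex_polygon v /\ P = polygon_region v.

Lemma ngon_polygonal n P : ngon n P -> polygonal P.
Proof. by move=> [v vP]; exists n, v. Qed.

Lemma ngon_inj n n' P : ngon n P -> ngon n' P -> n = n'.
Proof. by move=> [v [cv ->]] [w [cw e]]; exact: same_size cv cw e. Qed.

Lemma regular_ngon n P : is_regular_ngon n P -> ngon n P.
Proof. by move=> [s [alpha [v [cv _ _ ->]]]]; exists v. Qed.

Lemma rev_ordS n (i : 'I_n) : rev_ord (ordS i) = ord_pred (rev_ord i).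
Proof.
apply: (@ordS_inj n); rewrite ord_predK; apply: val_inj; rewrite val_ordS.
have /= -> := val_ordS i; have := ltn_ord i; rewrite /=.
by case: (i.+1 =P n) => [e|ne]; case: eqP => /=; lia.
Qed.

Lemma ord_pred_neqS n (i : 'I_n) : (2 < n)%N -> (ord_pred i == ordS i) = false.
Proof.
move=> n2; apply/eqP => /(congr1 (fun k => ordS k)); rewrite ord_predK => /esym/eqP.
by rewrite (negPf (ordSS_neq _ n2)).
Qed.

(** The images of the vertices are in counterclockwise order if [g] preserves the
    orientation; otherwise [f] lists them backwards. *)
Lemma isometry_polygon n (v : 'I_n -> H2 R) g : convex_polygon v -> isometry g ->
  exists2 f : 'I_n -> 'I_n,
    bijective f /\ ((forall i, f (ordS i) = ordS (f i)) \/
                    (forall i, f (ordS i) = ord_pred (f i))) &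
    convex_polygon (g \o v \o f) /\
    g @` polygon_region v = polygon_region (g \o v \o f).
Proof.
move=> cv gI; have [e e2 ge] := isometry_det gI.
have oe a b c : orient (g a) (g b) (g c) = e * orient a b c by rewrite !orientationE ge.
have reg (f : 'I_n -> 'I_n) : bijective f ->
    (forall i x, orient ((g \o v \o f) i) ((g \o v \o f) (ordS i)) (g x) =
       if f (ordS i) == ordS (f i) then orient (v (f i)) (v (ordS (f i))) x
       else orient (v (ord_pred (f i))) (v (f i)) x) ->
    (forall i, f (ordS i) = ordS (f i)) \/ (forall i, f (ordS i) = ord_pred (f i)) ->
    convex_polygon (g \o v \o f) /\
    g @` polygon_region v = polygon_region (g \o v \o f).
  move=> fb fo fS; have fi := bij_inj fb; have n2 := cv.1.
  have pS i := ord_pred_neqS i n2.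
  split; [split=> // i j ji jSi|apply/seteqP; split].
  - have fji : f j != f i by rewrite (inj_eq fi).
    have fjS : f j != f (ordS i) by rewrite (inj_eq fi).
    rewrite fo; case: fS => fS; rewrite fS in fjS *.
      by rewrite eqxx; apply: cv.2.
    by rewrite pS -{2}(ord_predK (f i)); apply: cv.2; rewrite // ord_predK.
  - move=> _ [x Px <-] i; rewrite fo; case: ifP => _; first exact: Px.
    by rewrite -{2}(ord_predK (f i)); exact: Px.
  - move=> y Py; have [x xy] := isometry_surj gI y; exists x => // i.
    have [f' f'K fK'] := fb.
    case: fS => fS.
      by have := Py (f' i); rewrite -xy fo fS eqxx fK'.
    have := Py (f' (ordS i)); rewrite -xy fo fS pS !fK' ordSK; exact.
have /orP[/eqP e1|/eqP e1] : (e == 1) || (e == -1).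
- by rewrite -eqf_sqr e2 expr1n.
- exists id; first by split; [exists id|left].
  apply: reg; [by exists id| |by left] => i x.
  by rewrite eqxx /= oe e1 mul1r.
- exists (@rev_ord n).
    by split; [exists (@rev_ord n); exact: rev_ordK|right; exact: rev_ordS].
  apply: reg; [by exists (@rev_ord n); exact: rev_ordK| |by right; exact: rev_ordS].
  move=> i x; rewrite rev_ordS /= oe e1 mulN1r -orient_swap.
  by rewrite ord_pred_neqS ?cv.1 // rev_ordS.
Qed.

Lemma isometry_ngon n t g : isometry g -> ngon n t -> ngon n (g @` t).
Proof.
move=> gI [v [cv ->]]; have [f _ [cf ->]] := isometry_polygon cv gI.
by exists (g \o v \o f).
Qed.

Lemma isometry_dart t g p q : isometry g -> dart t p q ->
  dart (g @` t) (g p) (g q) \/ dart (g @` t) (g q) (g p).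
Proof.
move=> gI [n [v [cv -> [i [-> ->]]]]].
have [f [[f' f'K fK'] fS] [cf ->]] := isometry_polygon cv gI.
case: fS => fS.
  left; exists n, (g \o v \o f); split=> //; exists (f' i).
  by rewrite /= fS fK'.
right; exists n, (g \o v \o f); split=> //; exists (f' (ordS i)).
by rewrite /= fS fK' ordSK.
Qed.

Lemma isometry_vertex t g p : isometry g -> vertex_of t p -> vertex_of (g @` t) (g p).
Proof.
move=> gI /vertex_ofP[q /(isometry_dart gI)[d|d]].
  exact: dart_vertex_l d.
exact: dart_vertex_r d.
Qed.

End IsometricImages.

(** * Symmetries and compactness *)

Section SymmetryGroup.
Variable R : realType.
Variable T : set (set (H2 R)).
Implicit Types (p q x y : H2 R) (t : set (H2 R)) (g : H2 R -> H2 R).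

Lemma symmetry_tile g t : symmetry T g -> T t -> T (g @` t).
Proof. by move=> [_ gT] Tt; rewrite -gT; exists t. Qed.

Lemma symmetry_comp g g' : symmetry T g -> symmetry T g' -> symmetry T (g' \o g).
Proof.
move=> [[gb gI] gT] [[gb' gI'] gT']; split.
  by split; [exact: bij_comp|move=> p q /=; rewrite gI' gI].
rewrite -{2}gT' -{2}gT image_comp; congr (_ @` _).
by apply: funext => t /=; rewrite image_comp.
Qed.

Lemma symmetry_inv g : symmetry T g ->
  exists g', [/\ symmetry T g', cancel g g' & cancel g' g].
Proof.
move=> [gI gT]; have [[g' gK g'K] _] := gI; exists g'; split=> //; split.
  exact: isometry_inverse gK g'K gI.
rewrite -{1}gT image_comp -[RHS]image_id; congr (_ @` _).
apply: funext => t /=; rewrite image_comp -[RHS]image_id; congr (_ @` _).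
exact: funext.
Qed.

Lemma image_cancel g g' t : cancel g g' -> g' @` (g @` t) = t.
Proof.
move=> gK; rewrite image_comp -[RHS]image_id; congr (_ @` _); exact: funext.
Qed.

Definition orbit x : orbit_space T := (\pi_(orbit_space T) x)%qT.

Lemma orbitP x y : orbit x = orbit y <-> exists2 g, symmetry T g & g x = y.
Proof.
split=> [e|gxy].
  have : (x = y %[mod {eq_quot (orbit_equiv T)}])%qT := e.
  by move=> /eqmodP/asboolP.
by have /eqmodP : orbit_equiv T x y by apply/asboolP.
Qed.

Lemma orbit_open (U : set (H2 R)) : open U ->
  open (orbit @` U).
Proof.
move=> oU; rewrite /open /= /quotient_open.
rewrite (_ : _ @^-1` _ = \bigcup_(g in [set g | symmetry T g]) (g @^-1` U)).
  apply: bigcup_open => g [gI _]; apply: open_comp => // x _.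
  exact: isometry_continuous gI x.
apply/seteqP; split=> [x [y Uy /esym/orbitP[g gs gx]]|x /= [g gs Ugx]].
  by exists g => //=; rewrite gx.
by exists (g x) => //; apply/esym/orbitP; exists g.
Qed.

(** Local finiteness and compactness of the quotient leave finitely many tiles
    up to symmetry. *)
Lemma finitely_many_tiles : tiling T -> strongly_periodic T ->
  exists L : seq (set (H2 R)), forall t x, T t -> t x ->
    exists2 g, symmetry T g & T (g @` t) /\ g @` t \in L.
Proof.
move=> [_ _ lf] sp; have cc : cover_compact [set: orbit_space T].
  (* [compact_cover] is about pointed spaces. *)
  pose Q : ptopologicalType := HB.pack_for ptopologicalType (orbit_space T)
    (isPointed.Build (orbit_space T) (orbit (0, 0))).
  have <- := @compact_cover Q.
  exact: sp.
have /choice[U UP] : forall x, exists U : set (H2 R), [/\ open U, U x &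
    finite_set [set t | T t /\ t `&` U !=set0]].
  move=> x; have [V Vx fV] := lf x; exists V°; split.
  - exact: open_interior.
  - exact: Vx.
  - apply: sub_finite_set fV => t [Tt [y [ty Vy]]]; split=> //.
    by exists y; split=> //; exact: interior_subset.
pose f x := orbit @` U x.
have [] := cc _ [set: H2 R] f.
- by move=> x _; apply: orbit_open; have [] := UP x.
- move=> z _; exists (repr z) => //; exists (repr z); first by have [] := UP (repr z).
  exact: reprK.
move=> D _ Dc; pose S x := finmap.enum_fset (fset_set [set t | T t /\ t `&` U x !=set0]).
exists (flatten [seq S x | x <- finmap.enum_fset D]).
move=> t x Tt tx; have [//|y /= Dy [u Uu /esym/orbitP[g gs gx]]] := Dc (orbit x).
exists g => //.
have Tgt := symmetry_tile gs Tt; split=> //.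
apply/flattenP; exists (S y).
  by apply/mapP; exists y.
rewrite [_ \in _]in_fset_set; last by have [] := UP y.
rewrite inE; split=> //; exists u; split=> //; by exists x.
Qed.

End SymmetryGroup.

Lemma representatives (A : choiceType) (E : A -> A -> Prop) (P : A -> Prop) (L : seq A) :
  (forall a, E a a) -> (forall a b, E a b -> E b a) ->
  (forall a b c, E a b -> E b c -> E a c) ->
  exists N, exists r : 'I_N -> A, [/\ forall i, P (r i),
    forall i j, E (r i) (r j) -> i = j &
    forall a, a \in L -> P a -> exists i, E a (r i)].
Proof.
move=> Er Es Et; elim: L => [|a L [N [r [rP rinj rL]]]].
  have r0 : 'I_0 -> A by case.
  by exists 0%N, r0; split=> [[]|[]|].
have [[Pa nE]|no] := pselect (P a /\ forall i, ~ E a (r i)); last first.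
  exists N, r; split=> // b; rewrite inE => /predU1P[->|bL] Pb; last exact: rL.
  apply: contrapT => nE; apply: no; split=> // i Ei; apply: nE; by exists i.
exists N.+1, (fun i => if unlift ord0 i is Some j then r j else a); split.
- by move=> i; case: unliftP => [j _|_].
- move=> i j; case: unliftP => [i' ->|->]; case: unliftP => [j' ->|->] //.
  + by move/rinj ->.
  + by move/Es => /nE.
  + by move/nE.
- move=> b; rewrite inE => /predU1P[->|bL] Pb.
    by exists ord0; rewrite unlift_none.
  by have [i Ei] := rL _ bL Pb; exists (lift ord0 i); rewrite liftK.
Qed.

(** * Pseudo-homogeneous tilings *)

Section PseudoHomogeneous.
Variable R : realType.
Variables k3 k4 : nat.
Hypotheses (hk3 : (10 <= k3)%N) (hk34 : (k3 < k4)%N).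
Variable T : set (set (H2 R)).
Implicit Types (p q r s z x y : H2 R) (t Q N M A B C D : set (H2 R)).

Let ks : seq nat := [:: 3; 5; k3; k4]%N.
Hypothesis typeT : tiling_of_type ks T.

Let tT : tiling T. Proof. by case: typeT. Qed.
Let eT : edge_to_edge T. Proof. by case: typeT. Qed.
Let pT t : T t -> polygonal t.
Proof.
by case: typeT => _ _ rT _ /rT[n /regular_ngon nt]; exact: ngon_polygonal nt.
Qed.

Lemma ks_uniq : uniq ks.
Proof. by rewrite /ks /= !inE; lia. Qed.

Lemma tiles_at p t0 : T t0 -> vertex_of t0 p -> exists f : 'I_4 -> set (H2 R),
  [/\ injective f, forall i : 'I_4, ngon (nth 0%N ks i) (f i) &
      forall t, T t /\ t p <-> exists i, t = f i].
Proof.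
move=> Tt0 vp; case: typeT => _ _ _ /(_ t0 p Tt0 vp)[f [fi fk fE]].
exists f; split=> // [i|t]; first exact: regular_ngon (fk i).
have -> : (T t /\ t p) = [set t | T t /\ t p] t by [].
by rewrite fE; split=> [[i _ <-]|[i ->]]; exists i.
Qed.

Lemma kind_at p t0 n : T t0 -> vertex_of t0 p -> n \in ks ->
  exists t, [/\ T t, t p & ngon n t].
Proof.
move=> Tt0 vp nks; have [f [fi fk fE]] := tiles_at Tt0 vp.
have ilt : (index n ks < 4)%N by rewrite -(index_mem n ks) in nks.
exists (f (Ordinal ilt)); have [Tf fp] := (fE _).2 (ex_intro _ (Ordinal ilt) erefl).
by split=> //; have := fk (Ordinal ilt); rewrite nth_index.
Qed.

Lemma kind_unique p t0 t t' n : T t0 -> vertex_of t0 p -> T t -> T t' ->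
  t p -> t' p -> ngon n t -> ngon n t' -> t = t'.
Proof.
move=> Tt0 vp Tt Tt' tp t'p nt nt'; have [f [fi fk fE]] := tiles_at Tt0 vp.
have [i ti] := (fE t).1 (conj Tt tp); have [j tj] := (fE t').1 (conj Tt' t'p).
rewrite ti tj in nt nt' *; congr f; apply: val_inj; apply/eqP.
have ni := ngon_inj nt (fk i); have nj := ngon_inj nt' (fk j).
rewrite -(@nth_uniq _ 0%N ks) ?ks_uniq //; first by rewrite -ni -nj.
  exact: ltn_ord i.
exact: ltn_ord j.
Qed.

Lemma tile_kind t : T t -> exists2 n, n \in ks & ngon n t.
Proof.
move=> Tt; have [n [v [cv tE]]] := pT Tt.
have i0 : 'I_n by exists 0%N; case: cv; lia.
have vp : vertex_of t (v i0) by exists n, v; split=> //; exists i0.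
have [f [fi fk fE]] := tiles_at Tt vp.
have [i ti] := (fE t).1 (conj Tt (vertex_of_in vp)).
exists (nth 0%N ks i); first by rewrite mem_nth.
by rewrite ti.
Qed.

(** The four tiles at a vertex form a single cycle: having four elements, they
    admit no 3-cycle without a fixed tile. *)
Lemma turn_no3cycle p A B C : T A -> T B -> T C ->
  turn p A B -> turn p B C -> turn p C A -> False.
Proof.
move=> TA TB TC AB BC CA.
have vA := turn_vertex CA; have vB := turn_vertex AB; have vC := turn_vertex BC.
have [f [fi fk fE]] := tiles_at TA vA.
have [a Aa] := (fE A).1 (conj TA (vertex_of_in vA)).
have [b Bb] := (fE B).1 (conj TB (vertex_of_in vB)).
have [c Cc] := (fE C).1 (conj TC (vertex_of_in vC)).
have /existsP[d dabc] : [exists d, d \notin [:: a; b; c]].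
  apply: contraT; rewrite negb_exists => /forallP H.
  have : (#|'I_4| <= #|[:: a; b; c]|)%N.
    by apply/subset_leq_card/fintype.subsetP => d _; have := H d; rewrite negbK.
  by rewrite card_ord => le4; have := leq_trans le4 (card_size _).
have [TD Dp] := (fE (f d)).2 (ex_intro _ d erefl).
have vD := common_vertex eT TA TD vA Dp.
have [E TE DE] := turn_exists tT eT pT TD vD.
have [e Ee] := (fE E).1 (conj TE (vertex_of_in (turn_vertex DE))).
move: dabc; rewrite !inE !negb_or => /and3P[da db dc].
have neq g : d != g -> f d <> f g by move=> /eqP dg /fi.
have [ea|ea] := eqVneq e a.
  by apply: (neq c dc); rewrite -Cc; apply: (turn_inj eT pT TD TC DE); rewrite Ee ea -Aa.
have [eb|eb] := eqVneq e b.
  by apply: (neq a da); rewrite -Aa; apply: (turn_inj eT pT TD TA DE); rewrite Ee eb -Bb.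
have [ec|ec] := eqVneq e c.
  by apply: (neq b db); rewrite -Bb; apply: (turn_inj eT pT TD TB DE); rewrite Ee ec -Cc.
have ed : e != d by apply/eqP => ed; apply: (turn_neq DE); rewrite Ee ed.
have ab : a != b by apply/eqP => e'; apply: (turn_neq AB); rewrite Aa Bb e'.
have bc : b != c by apply/eqP => e'; apply: (turn_neq BC); rewrite Bb Cc e'.
have ca : c != a by apply/eqP => e'; apply: (turn_neq CA); rewrite Cc Aa e'.
have : uniq [:: a; b; c; d; e].
  rewrite /= !inE !negb_or ab bc (eq_sym a c) ca (eq_sym a d) da (eq_sym b d) db.
  by rewrite (eq_sym c d) dc (eq_sym a e) ea (eq_sym b e) eb (eq_sym c e) ec (eq_sym d e) ed.
by move=> /card_uniqP u; have := max_card (mem [:: a; b; c; d; e]); rewrite u card_ord.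
Qed.

Lemma kinds_neq p t0 t t' n n' : T t0 -> vertex_of t0 p -> T t -> T t' ->
  t p -> t' p -> ngon n t -> ngon n' t' -> t <> t' -> n != n'.
Proof.
move=> Tt0 vp Tt Tt' tp t'p nt nt' tt'; apply/eqP => nn'; apply: tt'.
by apply: (kind_unique Tt0 vp) => //; [exact: nt|rewrite nn'].
Qed.

Lemma fourth_kind (a b c d d' : nat) : all (fun k => k \in ks) [:: a; b; c; d; d'] ->
  uniq [:: a; b; c; d] -> uniq [:: a; b; c; d'] -> d = d'.
Proof.
move=> sub u u'; apply/eqP/contraT => dd'.
have u5 : uniq [:: a; b; c; d; d'] by move: u u' dd'; rewrite /= !inE; lia.
by have := uniq_leq_size u5 (allP sub).
Qed.

Lemma ngon3_close t p q r : ngon 3 t -> dart t p q -> dart t q r -> dart t r p.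
Proof.
move=> [v [cv ->]] /(dart_rep cv)[i [-> ->]] /(dart_rep cv)[j [/(vertex_inj cv)<- ->]].
have {2}<- : ordS (ordS (ordS i)) = i by apply: val_inj; case: i => [[|[|[]]]].
exact: rep_dart.
Qed.

(** If a triangle is attached to the side from [p] to [q] of a tile [Q], then the
    tiles attached to the previous and the next side of [Q] are of different
    kinds.  Otherwise the tiles opposite to [Q] at [p] and at [q] would also be
    of the same kind; both are attached to the triangle and they meet at its
    third vertex. *)
Lemma triangle_flanks Q t N M z p q r n : T Q -> T t -> T N -> T M ->
  dart Q z p -> dart Q p q -> dart Q q r -> ngon 3 t -> dart t q p ->
  dart N p z -> dart M r q -> ngon n N -> ngon n M -> False.
Proof.
move=> TQ Tt TN TM Qzp Qpq Qqr t3 tqp Npz Mrq nN nM.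
have [s tps] := (vertex_ofP _ _).1 (dart_vertex_r tqp).
have tsq := ngon3_close t3 tqp tps.
have [C TC Csp] := dart_reverse tT eT pT Tt tps.
have [D TD Dqs] := dart_reverse tT eT pT Tt tsq.
have asym := turn_asym eT.
have QN : turn p Q N by exists z.
have tQ : turn p t Q by exists q.
have Ct : turn p C t by exists s.
have Qt : turn q Q t by exists p.
have MQ : turn q M Q by exists r.
have tD : turn q t D by exists s.
have [kQ kQs nQ] := tile_kind TQ. have [kC kCs nC] := tile_kind TC.
have [kD kDs nD] := tile_kind TD. have [kN kNs nN'] := tile_kind TN.
have nE := ngon_inj nN nN'; subst kN.
have vQp := dart_vertex_r Qzp; have vQq := dart_vertex_r Qpq.
have Np := vertex_of_in (turn_vertex QN).
have Qp := vertex_of_in vQp; have tp := vertex_of_in (turn_vertex Ct).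
have Cp := vertex_of_in (dart_vertex_r Csp).
have Qq := vertex_of_in vQq; have tq := vertex_of_in (dart_vertex_l tqp).
have Mq := vertex_of_in (dart_vertex_r Mrq).
have Dq := vertex_of_in (dart_vertex_l Dqs).
have kinds := kinds_neq TQ vQp; have kinds' := kinds_neq TQ vQq.
have tN : t <> N by move=> e; subst N; exact: asym QN.
have CQ : C <> Q by move=> e; subst C; exact: asym tQ.
have CN : C <> N by move=> e; subst N; exact: (turn_no3cycle TQ TC Tt QN Ct tQ).
have Mt : M <> t by move=> e; subst M; exact: asym Qt.
have DQ : D <> Q by move=> e; subst D; exact: asym tD.
have DM : D <> M by move=> e; subst M; exact: (turn_no3cycle TQ Tt TD Qt tD MQ).
have Qt' := nesym (turn_neq tQ).
have kQt := kinds _ _ _ _ TQ Tt Qp tp nQ t3 Qt'.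
have kQN := kinds _ _ _ _ TQ TN Qp Np nQ nN (turn_neq QN).
have kQC := kinds _ _ _ _ TQ TC Qp Cp nQ nC (nesym CQ).
have ktN := kinds _ _ _ _ Tt TN tp Np t3 nN tN.
have ktC := kinds _ _ _ _ Tt TC tp Cp t3 nC (nesym (turn_neq Ct)).
have kNC := kinds _ _ _ _ TN TC Np Cp nN nC (nesym CN).
have kQM := kinds' _ _ _ _ TQ TM Qq Mq nQ nM (nesym (turn_neq MQ)).
have kQD := kinds' _ _ _ _ TQ TD Qq Dq nQ nD (nesym DQ).
have ktD := kinds' _ _ _ _ Tt TD tq Dq t3 nD (turn_neq tD).
have kMD := kinds' _ _ _ _ TM TD Mq Dq nM nD (nesym DM).
have kCD : kC = kD.
  apply: (@fourth_kind kQ 3%N n).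
  - by rewrite /= kQs kNs kCs kDs.
  - by rewrite /= !inE !negb_or kQt kQN kQC ktN ktC kNC.
  - by rewrite /= !inE !negb_or kQt kQN kQD ktN ktD kMD.
have Cs := vertex_of_in (dart_vertex_l Csp).
have Ds := vertex_of_in (dart_vertex_r Dqs).
have CD : C = D.
  by apply: (kind_unique Tt (dart_vertex_r tps) TC TD Cs Ds nC); rewrite kCD.
have tC : turn s t C by exists p.
have Dt : turn s D t by exists q.
by subst D; exact: asym Dt.
Qed.

Definition adjacent t t' : Prop := exists p q, dart t p q /\ dart t' q p.

(** Two letters 3 would be at distance two in the cyclic word [c], and the other
    three letters would be pairwise distinct, although each is [k3] or [k4]. *)
Lemma pentagon_word (c : 'I_5 -> nat) :
  (forall i, c i \in [:: 3; k3; k4]%N) -> (forall i, c i != c (ordS i)) ->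
  (forall i, c (ordS i) = 3%N -> c i != c (ordS (ordS i))) ->
  forall i j, c i = 3%N -> c j = 3%N -> i = j.
Proof.
move=> cks c1 c2.
have S5 (i : 'I_5) : ordS (ordS (ordS (ordS (ordS i)))) = i.
  by apply: val_inj; case: i => [[|[|[|[|[|[]]]]]]].
have two i : c i = 3%N -> c (ordS (ordS i)) = 3%N -> False.
  move=> ci ci2; have a1 := c1 i; have a2 := c1 (ordS i).
  have a3 := c1 (ordS (ordS i)); have a4 := c1 (ordS (ordS (ordS i))).
  have a5 := c1 (ordS (ordS (ordS (ordS i)))).
  have f1 := c2 (ordS i); have f2 := c2 (ordS (ordS (ordS (ordS i)))).
  rewrite S5 in a5 f2; have {f1} := f1 ci2; have {f2} := f2 ci.
  have := cks (ordS i); have := cks (ordS (ordS (ordS i))).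
  have := cks (ordS (ordS (ordS (ordS i)))); rewrite !inE.
  by move: a1 a2 a3 a4 a5; rewrite ci ci2; lia.
have dist (i j : 'I_5) : [|| i == j, j == ordS i, i == ordS j,
    j == ordS (ordS i) | i == ordS (ordS j)].
  by move: i j => [[|[|[|[|[|//]]]]] ?] [[|[|[|[|[|//]]]]] ?].
move=> i j ci cj.
have /or4P[/eqP//|/eqP ij|/eqP ji|/orP[/eqP ij|/eqP ji]] := dist i j.
- by have := c1 i; rewrite -ij ci cj.
- by have := c1 j; rewrite -ji ci cj.
- by case: (two i) => //; rewrite -ij.
- by case: (two j) => //; rewrite -ji.
Qed.

(** The kinds of the neighbors of a pentagon satisfy the hypotheses of
    [pentagon_word]. *)
Lemma pentagon_triangle Q t t' : T Q -> T t -> T t' -> ngon 5 Q ->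
  ngon 3 t -> ngon 3 t' -> adjacent Q t -> adjacent Q t' -> t = t'.
Proof.
move=> TQ Tt Tt' Q5 t3 t3' [p [q [pq qp]]] [p' [q' [pq' qp']]].
have [v [cv QE]] := Q5.
have dv i : dart Q (v i) (v (ordS i)) by rewrite QE; exact: rep_dart.
have /choice[N NP] : forall i, exists N, T N /\ dart N (v (ordS i)) (v i).
  by move=> i; have [N TN NP] := dart_reverse tT eT pT TQ (dv i); exists N.
have /choice[c cP] : forall i, exists c, c \in ks /\ ngon c (N i).
  by move=> i; have [c cks Nc] := tile_kind (NP i).1; exists c.
rewrite QE in pq pq'; have [i [pi qi]] := dart_rep cv pq.
have [j [pj qj]] := dart_rep cv pq'.
have ti : t = N i by apply: (dart_tile eT pT Tt (NP i).1 qp); rewrite pi qi; exact: (NP i).2.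
have tj : t' = N j by apply: (dart_tile eT pT Tt' (NP j).1 qp'); rewrite pj qj; exact: (NP j).2.
rewrite ti tj; congr N; apply: (@pentagon_word c).
- move=> k; have [cks Nc] := cP k; move: cks; rewrite !inE.
  have : 5%N != c k.
    apply: (kinds_neq TQ (dart_vertex_l (dv k)) TQ (NP k).1 _ _ Q5 Nc).
    + exact: vertex_of_in (dart_vertex_l (dv k)).
    + exact: vertex_of_in (dart_vertex_r (NP k).2).
    + by move=> e; apply: (dart_asym (dv k)); rewrite e; exact: (NP k).2.
  by rewrite eq_sym => /negPf ->.
- move=> k; have vS := dart_vertex_r (dv k).
  have t1 : turn (v (ordS k)) Q (N k) by exists (v k); split=> //; exact: (NP k).2.
  have t2 : turn (v (ordS k)) (N (ordS k)) Q.
    by exists (v (ordS (ordS k))); split=> //; exact: (NP _).2.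
  apply: (kinds_neq TQ vS (NP _).1 (NP _).1 _ _ (cP _).2 (cP _).2).
  + exact: vertex_of_in (turn_vertex t1).
  + exact: vertex_of_in (dart_vertex_r (NP _).2).
  + by move=> e; rewrite -e in t2; exact: (turn_asym eT TQ (NP k).1 t1).
- move=> k ck; apply/eqP => ckk.
  apply: (@triangle_flanks Q (N (ordS k)) (N k) (N (ordS (ordS k))) (v k)
    (v (ordS k)) (v (ordS (ordS k))) (v (ordS (ordS (ordS k)))) (c k)) => //.
  + exact: (NP _).1.
  + exact: (NP _).1.
  + exact: (NP _).1.
  + by have := (cP (ordS k)).2; rewrite ck.
  + exact: (NP _).2.
  + exact: (NP _).2.
  + exact: (NP _).2.
  + exact: (cP _).2.
  + by rewrite ckk; exact: (cP _).2.
- by apply: (ngon_inj (cP i).2); rewrite -ti.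
- by apply: (ngon_inj (cP j).2); rewrite -tj.
Qed.

(** Any two sides of a triangle have a common end, so the neighbors of a
    triangle are told apart by their kinds. *)
Lemma triangle_neighbor_unique t N N' n : T t -> T N -> T N' -> ngon 3 t ->
  adjacent t N -> adjacent t N' -> ngon n N -> ngon n N' -> N = N'.
Proof.
move=> Tt TN TN' t3 [p [q [pq qp]]] [p' [q' [pq' qp']]] nN nN'.
have Np := vertex_of_in (dart_vertex_r qp); have Nq := vertex_of_in (dart_vertex_l qp).
have Np' := vertex_of_in (dart_vertex_r qp'); have Nq' := vertex_of_in (dart_vertex_l qp').
have : exists2 r, vertex_of t r & N r /\ N' r.
  have [v [cv tE]] := t3; rewrite tE in pq pq'.
  have [i [pi qi]] := dart_rep cv pq; have [j [pj qj]] := dart_rep cv pq'.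
  have vt k : vertex_of t (v k) by exists 3%N, v; split=> //; exists k.
  have [ij|[ij|ij]] : i = j \/ j = ordS i \/ i = ordS j.
    have : val i = val j \/ val j = val (ordS i) \/ val i = val (ordS j).
      case: (i) (j) => [[|[|[|//]]] /= _] [[|[|[|//]]] /= _]; auto.
    by move=> [/val_inj|[/val_inj|/val_inj]]; auto.
  - by exists (v i); [exact: vt|rewrite -{1}pi ij -pj].
  - by exists (v j); [exact: vt|rewrite -{2}pj ij -qi].
  - by exists (v i); [exact: vt|rewrite -{1}pi ij -qj].
by move=> [r vr [Nr N'r]]; exact: (kind_unique Tt vr TN TN' Nr N'r nN nN').
Qed.

(** The three neighbors of a triangle are of different kinds, among which there is
    no triangle. *)
Lemma triangle_pentagon t : T t -> ngon 3 t ->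
  exists Q, [/\ T Q, ngon 5 Q & adjacent t Q].
Proof.
move=> Tt t3; have [v [cv tE]] := t3.
have dv i : dart t (v i) (v (ordS i)) by rewrite tE; exact: rep_dart.
have /choice[N NP] : forall i, exists N, T N /\ dart N (v (ordS i)) (v i).
  by move=> i; have [N TN NP] := dart_reverse tT eT pT Tt (dv i); exists N.
have /choice[c cP] : forall i, exists c, c \in ks /\ ngon c (N i).
  by move=> i; have [c cks Nc] := tile_kind (NP i).1; exists c.
have [[i ci]|no] := pselect (exists i, c i = 5%N).
  exists (N i); split; [exact: (NP i).1|rewrite -ci; exact: (cP i).2|].
  by exists (v i), (v (ordS i)); split=> //; exact: (NP i).2.
have adj i : adjacent t (N i).
  by exists (v i), (v (ordS i)); split=> //; exact: (NP i).2.
have cinj i j : i != j -> c i != c j.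
  apply: contra => /eqP cij; have Nij : N i = N j.
    apply: (triangle_neighbor_unique Tt (NP i).1 (NP j).1 t3 (adj i) (adj j) (cP i).2).
    by rewrite cij; exact: (cP j).2.
  have := dart_meet eT Tt (NP i).1 (dv i) (NP i).2.
  rewrite Nij (dart_meet eT Tt (NP j).1 (dv j) (NP j).2).
  move=> /(segment_ends (dart_neq (dv j)))[[/(vertex_inj cv)-> _]|[ji Sji]] //.
  by case: (dart_asym (dv i)); rewrite -Sji -ji; exact: dv.
have c3 i : 3%N != c i.
  apply: (kinds_neq Tt (dart_vertex_l (dv i)) Tt (NP i).1 _ _ t3 (cP i).2).
  + exact: vertex_of_in (dart_vertex_l (dv i)).
  + exact: vertex_of_in (dart_vertex_r (NP i).2).
  + by move=> e; apply: (dart_asym (dv i)); rewrite e; exact: (NP i).2.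
have c5 i : c i != 5%N by apply/eqP => ci; apply: no; exists i.
pose i0 : 'I_3 := ord0; pose i1 := ordS i0; pose i2 := ordS i1.
have := cinj i0 i1 isT; have := cinj i1 i2 isT; have := cinj i0 i2 isT.
have := (cP i0).1; have := (cP i1).1; have := (cP i2).1; rewrite !inE.
have := c3 i0; have := c3 i1; have := c3 i2; have := c5 i0; have := c5 i1; have := c5 i2.
by lia.
Qed.

Lemma image_inj (g : H2 R -> H2 R) t t' : isometry g -> g @` t = g @` t' -> t = t'.
Proof.
move=> [[g' gK _] _] e; by rewrite -(image_cancel t gK) e image_cancel.
Qed.

Lemma symmetry_adjacent g t t' : symmetry T g -> T t -> T t' ->
  adjacent t t' -> adjacent (g @` t) (g @` t').
Proof.
move=> gs Tt Tt' [p [q [d d']]]; have gI := gs.1.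
have tt' : g @` t <> g @` t'.
  by move=> /(image_inj gI) e; apply: (dart_asym d); rewrite e.
have Tgt := symmetry_tile gs Tt; have Tgt' := symmetry_tile gs Tt'.
have [gd|gd] := isometry_dart gI d; have [gd'|gd'] := isometry_dart gI d'.
- by exists (g p), (g q).
- by case: tt'; exact: (dart_tile eT pT Tgt Tgt' gd gd').
- by case: tt'; exact: (dart_tile eT pT Tgt Tgt' gd gd').
- by exists (g q), (g p).
Qed.

(** The three neighbors of a triangle are of different kinds, so a symmetry that
    preserves the triangle preserves each of its sides. *)
Lemma symmetry_fix_triangle g t : symmetry T g -> T t -> ngon 3 t ->
  g @` t = t -> forall p, g p = p.
Proof.
move=> gs Tt t3 gt; have gI := gs.1.
have side p q : dart t p q -> (p = g p /\ q = g q) \/ (p = g q /\ q = g p).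
  move=> d; have [N TN d'] := dart_reverse tT eT pT Tt d.
  have [n nks nN] := tile_kind TN.
  have tN : adjacent t N by exists p, q.
  have gN : g @` N = N.
    apply: (triangle_neighbor_unique Tt _ TN t3 _ tN _ nN).
    + exact: symmetry_tile.
    + by rewrite -{1}gt; exact: symmetry_adjacent.
    + exact: isometry_ngon.
  apply: segment_ends (dart_neq d) _.
  rewrite -(isometry_segment gI) -(dart_meet eT Tt TN d d').
  apply/seteqP; split=> x.
    move=> [tx Nx]; move: (tx); rewrite -{1}gt => -[y ty yx]; exists y => //; split=> //.
    move: Nx; rewrite -{1}gN => -[y' Ny' y'x].
    by rewrite (isometry_inj gI (etrans yx (esym y'x))).
  by move=> [y [ty Ny] <-]; split; [rewrite -gt|rewrite -gN]; exists y.
have fix_ p : vertex_of t p -> g p = p.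
  move=> vp; have [q pq] := (vertex_ofP _ _).1 vp; have [z zp] := vertex_of_prev vp.
  have [[//]|[_ qp]] := side _ _ pq; have [[_ //]|[zp' _]] := side _ _ zp.
  by case: (dart_asym pq); rewrite qp -zp'.
have [v [cv tE]] := t3.
have vt k : vertex_of t (v k) by exists 3%N, v; split=> //; exists k.
pose k : 'I_3 := ord0.
apply: (@isometry_fix _ _ gI (v (ord_pred k)) (v k) (v (ordS k))); rewrite ?fix_ //.
by rewrite -orientationE gt_eqF // turn_gt0.
Qed.

Let tile_equiv t t' := exists2 g, symmetry T g & g @` t = t'.

(** If there were finitely many tiles up to symmetry, choose representatives of
    the triangles.  Every vertex lies on a single triangle, hence is equivalent to
    one of the [3 * N] vertices of these representatives; but the pentagons
    attached to them have [5 * N] vertices, no two of which are equivalent: such a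
    symmetry would map a chosen pentagon to another one, and the triangle attached
    to the former to the triangle attached to the latter; so the triangles would
    be the same, and the symmetry would be trivial. *)
Lemma type_not_strongly_periodic : ~ strongly_periodic T.
Proof.
move=> sp; have [L LP] := finitely_many_tiles tT sp.
have Er t : tile_equiv t t.
  by exists id; rewrite ?image_id //; split;
    [split=> //; exists id|rewrite -[RHS]image_id; congr (_ @` _);
     apply: funext => x; rewrite image_id].
have Es t t' : tile_equiv t t' -> tile_equiv t' t.
  move=> [g gs <-]; have [g' [gs' gK _]] := symmetry_inv gs.
  by exists g' => //; exact: image_cancel.
have Et t t' t'' : tile_equiv t t' -> tile_equiv t' t'' -> tile_equiv t t''.
  move=> [g gs <-] [g' gs' <-]; exists (g' \o g); first exact: symmetry_comp.
  by rewrite image_comp.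
have [N [r [rP rinj rL]]] := representatives (fun t => T t /\ ngon 3 t) L Er Es Et.
have cover t x : T t -> ngon 3 t -> t x -> exists i, tile_equiv t (r i).
  move=> Tt t3 tx; have [g gs [Tgt gtL]] := LP _ _ Tt tx.
  have [i ri] := rL _ gtL (conj Tgt (isometry_ngon gs.1 t3)).
  by exists i; apply: Et ri; exists g.
have /choice[Q QP] : forall i, exists Q, [/\ T Q, ngon 5 Q & adjacent (r i) Q].
  by move=> i; have [Tr r3] := rP i; exact: triangle_pentagon.
have /choice[v vP] : forall i, exists v : 'I_3 -> H2 R,
    convex_polygon v /\ r i = polygon_region v by move=> i; exact: (rP i).2.
have /choice[w wP] : forall i, exists w : 'I_5 -> H2 R,
    convex_polygon w /\ Q i = polygon_region w by move=> i; have [] := QP i.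
have wV i j : vertex_of (Q i) (w i j).
  by have [cw QE] := wP i; exists 5%N, (w i); split=> //; exists j.
have /choice[phi phiP] : forall ij : 'I_N * 'I_5, exists kl : 'I_N * 'I_3,
    exists2 g, symmetry T g & g (w ij.1 ij.2) = v kl.1 kl.2.
  move=> [i j] /=; have [TQ _ _] := QP i.
  have [t [Tt tw t3]] := kind_at TQ (wV i j) (isT : 3%N \in ks).
  have [k [g gs gt]] := cover _ _ Tt t3 tw.
  have := isometry_vertex gs.1 (common_vertex eT TQ Tt (wV i j) tw).
  rewrite gt; have [cv rE] := vP k; rewrite rE => /vertex_ofP[x].
  by move=> /(dart_rep cv)[l [gw _]]; exists (k, l), g.
have phi_inj : injective phi.
  move=> [i j] [a b] e; have [g1 s1 e1] := phiP (i, j); have [g2 s2 e2] := phiP (a, b).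
  rewrite e in e1; rewrite /= in e1 e2.
  have [g2' [s2' g2K _]] := symmetry_inv s2.
  have [TQi Qi5 ai] := QP i; have [TQa Qa5 aa] := QP a.
  have [Ti ti3] := rP i; have [Ta ta3] := rP a.
  pose g := g2' \o g1; have gs : symmetry T g := symmetry_comp s1 s2'.
  have gw : g (w i j) = w a b by rewrite /g /= e1 -e2 g2K.
  have gQ : g @` Q i = Q a.
    apply: (kind_unique TQa (wV a b) _ TQa _ _ _ Qa5).
    + exact: symmetry_tile.
    + by rewrite -gw; exists (w i j) => //; exact: vertex_of_in.
    + exact: vertex_of_in.
    + exact: isometry_ngon gs.1 Qi5.
  have adjC t t' : adjacent t t' -> adjacent t' t.
    by move=> [p [q [pq qp]]]; exists q, p.
  have gr : g @` r i = r a.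
    apply: (pentagon_triangle TQa _ Ta Qa5 _ ta3 _ (adjC _ _ aa)).
    + exact: symmetry_tile.
    + exact: isometry_ngon gs.1 ti3.
    + by rewrite -gQ; apply: symmetry_adjacent => //; exact: adjC.
  have ia : i = a by apply: rinj; exists g.
  subst a; have gid := symmetry_fix_triangle gs Ti ti3 gr.
  by move: gw; rewrite gid => /(vertex_inj (wP i).1) ->.
have := leq_card phi phi_inj; rewrite !card_prod !card_ord.
suff : (0 < N)%N by lia.
have [t0 Tt0 _] := tile_at tT (0, 0).
have [n [u [cu t0E]]] := pT Tt0.
have k : 'I_n by exists 0%N; case: cu; lia.
have vk : vertex_of t0 (u k) by exists n, u; split=> //; exists k.
have [t [Tt tu t3]] := kind_at Tt0 vk (isT : 3%N \in ks).
have [i _] := cover _ _ Tt t3 tu.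
by case: (N) i => [[]|].
Qed.

End PseudoHomogeneous.

(** * Numerical bounds for trigonometric functions *)

Section TrigonometricBounds.
Variable R : realType.
Implicit Types (x y : R) (n : nat).

Lemma ge0_of_derive (f df : R -> R) : (forall x, is_derive x 1 f (df x)) ->
  0 <= f 0 -> (forall x, 0 <= x -> 0 <= df x) -> forall x, 0 <= x -> 0 <= f x.
Proof.
move=> fd f0 df0 x x0.
have fc : {within `[0, x], continuous f}.
  apply: derivable_within_continuous => y _; have := fd y.
  by move=> fdy; exact: ex_derive.
have [c cx e] := MVT_segment x0 (fun y _ => fd y) fc.
move: cx; rewrite in_itv /= => /andP[c0 _].
have : 0 <= df c * (x - 0) by rewrite mulr_ge0 ?df0 // subr0.
by rewrite -e subr_ge0; exact: le_trans.
Qed.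

(** The nonzero coefficients of the Taylor series. *)
Fixpoint cosC n : R :=
  if n is n'.+1 then - cosC n' / (n'.*2.+1 * n'.*2.+2)%:R else 1.
Definition sinC n : R := cosC n / n.*2.+1%:R.

(** Taylor polynomials with [n] terms. *)
Fixpoint cosP n : {poly R} :=
  if n is n'.+1 then cosP n' + cosC n' *: 'X^(n'.*2) else 0.
Fixpoint sinP n : {poly R} :=
  if n is n'.+1 then sinP n' + sinC n' *: 'X^(n'.*2.+1) else 0.

Lemma deriv_sinP n : (sinP n)^`() = cosP n.
Proof.
elim: n => [|n IHn]; first exact: deriv0.
rewrite [sinP _]/= [cosP _]/= derivD IHn derivZ derivXn /= /sinC.
by rewrite -scalerMnr scalerMnl -mulr_natr divfK // pnatr_eq0.
Qed.

Lemma deriv_cosP n : (cosP n.+1)^`() = - sinP n.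
Proof.
elim: n => [|n IHn].
  by rewrite /= add0r double0 expr0 derivZ derivC scaler0 oppr0.
rewrite [cosP _]/= -/(cosP n.+1) derivD IHn [sinP _.+1]/= opprD; congr (_ + _).
rewrite derivZ derivXn doubleS /=.
rewrite -scalerMnr scalerMnl -mulr_natr -scaleNr /sinC /=; congr (_ *: _).
by rewrite natrM invfM mulrA divfK ?pnatr_eq0 // mulNr.
Qed.

Lemma horner_cosP0 n : (cosP n.+1).[0] = 1.
Proof.
elim: n => [|n IHn]; first by rewrite /= !hornerE.
rewrite [cosP _]/= -/(cosP n.+1) hornerD IHn hornerZ hornerXn doubleS expr0n.
by rewrite mulr0 addr0.
Qed.

Lemma horner_sinP0 n : (sinP n).[0] = 0.
Proof.
elim: n => [|n IHn]; first by rewrite horner0.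
by rewrite [sinP _]/= hornerD IHn hornerZ hornerXn expr0n mulr0 addr0.
Qed.

(** Each bound is obtained from the previous one by integration. *)
Lemma taylor_bounds n : (forall x, 0 <= x ->
  0 <= (-1) ^+ n.+1 * (cos x - (cosP n.+1).[x])) /\ (forall x, 0 <= x ->
  0 <= (-1) ^+ n.+1 * (sin x - (sinP n.+1).[x])).
Proof.
have step (k : nat) : (forall x, 0 <= x -> 0 <= (-1) ^+ k * (cos x - (cosP k).[x])) ->
    forall x, 0 <= x -> 0 <= (-1) ^+ k * (sin x - (sinP k).[x]).
  move=> H; apply: ge0_of_derive H => [x|].
    have := is_deriveZ ((-1) ^+ k) (is_deriveB (is_derive_sin x) (is_derive_poly (sinP k) x)).
    by rewrite deriv_sinP.
  by rewrite sin0 horner_sinP0 subr0 mulr0.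
have step2 (k : nat) : (forall x, 0 <= x -> 0 <= (-1) ^+ k * (sin x - (sinP k).[x])) ->
    forall x, 0 <= x -> 0 <= (-1) ^+ k.+1 * (cos x - (cosP k.+1).[x]).
  move=> H; apply: (@ge0_of_derive _ (fun x => (-1) ^+ k.+1 * (- sin x - - (sinP k).[x]))).
  - move=> x.
    have := is_deriveZ ((-1) ^+ k.+1)
      (is_deriveB (is_derive_cos x) (is_derive_poly (cosP k.+1) x)).
    by rewrite deriv_cosP hornerN.
  - by rewrite cos0 horner_cosP0 subrr mulr0.
  - move=> x x0; rewrite exprS; have := H x x0; lra.
elim: n => [|n [_ IHn]].
  have c1 x : 0 <= x -> 0 <= (-1) ^+ 1 * (cos x - (cosP 1).[x]).
    move=> _; rewrite /= !hornerE expr1.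
    by have := cos_le1 x; lra.
  by split=> //; exact: step.
by have c1 := step2 _ IHn; split=> //; exact: step.
Qed.

Ltac expand_taylor :=
  rewrite /= /sinC /= !hornerE /=;
  repeat match goal with |- context [?n.*2] =>
    let m := eval compute in n.*2 in change n.*2 with m
  end.

Lemma cos_ub x : 0 <= x -> cos x <= 1 - x ^+ 2 / 2 + x ^+ 4 / 24.
Proof. by move=> x0; have := (taylor_bounds 2).1 x x0; expand_taylor; lra. Qed.

Lemma cos_lb x : 0 <= x ->
  1 - x ^+ 2 / 2 + x ^+ 4 / 24 - x ^+ 6 / 720 <= cos x.
Proof. by move=> x0; have := (taylor_bounds 3).1 x x0; expand_taylor; lra. Qed.

Lemma sin_ub x : 0 <= x -> sin x <= x - x ^+ 3 / 6 + x ^+ 5 / 120.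
Proof. by move=> x0; have := (taylor_bounds 2).2 x x0; expand_taylor; lra. Qed.

Lemma sin_lb x : 0 <= x ->
  x - x ^+ 3 / 6 + x ^+ 5 / 120 - x ^+ 7 / (720 * 7) <= sin x.
Proof. by move=> x0; have := (taylor_bounds 3).2 x x0; expand_taylor; lra. Qed.

Lemma cos_lb14 x : 0 <= x ->
  1 - x ^+ 2 / 2 + x ^+ 4 / 24 - x ^+ 6 / 720 + x ^+ 8 / (720 * 56)
  - x ^+ 10 / (720 * 56 * 90) + x ^+ 12 / (720 * 56 * 90 * 132)
  - x ^+ 14 / (720 * 56 * 90 * 132 * 182) <= cos x.
Proof. by move=> x0; have := (taylor_bounds 7).1 x x0; expand_taylor; lra. Qed.

Lemma cos_ub16 x : 0 <= x -> cos x <=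
  1 - x ^+ 2 / 2 + x ^+ 4 / 24 - x ^+ 6 / 720 + x ^+ 8 / (720 * 56)
  - x ^+ 10 / (720 * 56 * 90) + x ^+ 12 / (720 * 56 * 90 * 132)
  - x ^+ 14 / (720 * 56 * 90 * 132 * 182)
  + x ^+ 16 / (720 * 56 * 90 * 132 * 182 * 240).
Proof. by move=> x0; have := (taylor_bounds 8).1 x x0; expand_taylor; lra. Qed.

(** Decimal numbers. *)
Local Notation "n 'e-' k" := (n%N%:R / 10%:R ^+ k%N) (at level 2).

Lemma cos_le x y : 0 <= x -> x <= y -> y <= pi -> cos y <= cos x.
Proof.
move=> x0 xy yp; rewrite leNgt ltr_cos ?in_itv /= -?leNgt //; apply/andP; lra.
Qed.

Lemma cos_lt_pihalf x : 0 <= x -> x <= 2 -> 0 < cos x -> x < pi / 2.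
Proof.
move=> x0 x2 cx; rewrite ltNge; apply/negP => px.
have pi2 := pi_ge2 R; have : cos x <= cos (pi / 2).
  by apply: cos_le => //; lra.
by rewrite cos_pihalf leNgt cx.
Qed.

(** The sign of the cosine at a decimal compares it with [pi / 2]. *)
Lemma pi_lb : 3141592652 e- 9 < pi :> R.
Proof.
have x0 : 0 <= 1570796326 e- 9 :> R by lra.
have : 0 < cos (1570796326 e- 9 : R).
  apply: lt_le_trans (cos_lb14 x0); lra.
move=> /(cos_lt_pihalf x0) H; have : 1570796326 e- 9 < pi / 2 :> R by apply: H; lra.
lra.
Qed.

Lemma pi_ub : pi < 3141592654 e- 9 :> R.
Proof.
have x0 : 0 <= 1570796327 e- 9 :> R by lra.
have c0 : cos (1570796327 e- 9 : R) < 0.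
  apply: le_lt_trans (cos_ub16 x0) _; lra.
suff : pi / 2 < 1570796327 e- 9 :> R by lra.
rewrite ltNge; apply/negP => px.
have := @cos_ge0_pihalf R (1570796327 e- 9); have := pi_ge0 R.
move: px c0; set c := cos _ => px c0 p0 H.
have : 0 <= c by apply: H; lra.
lra.
Qed.

End TrigonometricBounds.

(** * Five triangles at a vertex *)

Section Chords.
Variable R : realType.
Implicit Types (k l p q : nat) (y g t : R).

Local Notation "n 'e-' k" := (n%N%:R / 10%:R ^+ k%N) (at level 2).

(** The first diagonal of a regular [k]-gon of side 1. *)
Definition chord k : R := 2 * cos (pi / k%:R).

Lemma pi_div_bounds k : (0 < k)%N -> 0 < (pi / k%:R : R) <= pi.
Proof.
move=> k0; have p0 := pi_gt0 R.
by rewrite divr_gt0 ?ltr0n //= ler_pdivrMr ?ltr0n // ler_peMr ?ler1n // ltW.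
Qed.

Lemma chord_lt k l : (0 < k)%N -> (k < l)%N -> chord k < chord l.
Proof.
move=> k0 kl; have l0 : (0 < l)%N := leq_ltn_trans (leq0n _) kl.
have /andP[a1 a2] := pi_div_bounds k0; have /andP[b1 b2] := pi_div_bounds l0.
rewrite /chord ltr_pM2l // ltr_cos ?in_itv /= ?a2 ?b2 ?ltW //.
by rewrite ltr_pM2l ?pi_gt0 // ltf_pV2 ?posrE ?ltr0n // ltr_nat.
Qed.

Lemma chord_le k l : (0 < k)%N -> (k <= l)%N -> chord k <= chord l.
Proof.
by move=> k0; rewrite leq_eqVlt => /predU1P[->//|kl]; rewrite ltW // chord_lt.
Qed.

Lemma chord_lt2 k : (0 < k)%N -> chord k < 2.
Proof.
move=> k0; have /andP[a1 a2] := pi_div_bounds k0.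
rewrite /chord -[ltRHS]mulr1 -[X in _ < _ * X](@cos0 R) ltr_pM2l //.
by rewrite ltr_cos ?in_itv /= ?lexx ?a2 ?pi_ge0 ?(ltW a1).
Qed.

Lemma chord_ub k (x : R) : (0 < k)%N -> x = 3141592652 e- 9 / k%:R ->
  chord k <= 2 * (1 - x ^+ 2 / 2 + x ^+ 4 / 24).
Proof.
move=> k0 xE; rewrite /chord ler_pM2l //.
have x0 : 0 <= x by rewrite xE divr_ge0 ?ler0n //; lra.
apply: le_trans (cos_ub x0); apply: cos_le => //; last by case/andP: (pi_div_bounds k0).
by rewrite xE ler_wpM2r ?invr_ge0 ?ler0n // ltW // pi_lb.
Qed.

Lemma chord_lb k (x : R) : (1 < k)%N -> x = 3141592654 e- 9 / k%:R ->
  2 * (1 - x ^+ 2 / 2 + x ^+ 4 / 24 - x ^+ 6 / 720) <= chord k.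
Proof.
move=> k1 xE; rewrite /chord ler_pM2l //.
have k0 : (0 < k)%N by lia.
have x0 : 0 <= x by rewrite xE divr_ge0 ?ler0n //; lra.
apply: le_trans (cos_lb x0) _; apply: cos_le; first by case/andP: (pi_div_bounds k0) => /ltW.
  by rewrite xE ler_wpM2r ?invr_ge0 ?ler0n // ltW // pi_ub.
rewrite xE ler_pdivrMr ?ltr0n //; apply: (@le_trans _ _ (pi * 2)).
  by have := pi_lb R; lra.
by rewrite ler_wpM2l ?pi_ge0 // ler_nat.
Qed.

Lemma chord3 : chord 3 = 1.
Proof.
rewrite /chord; set x : R := pi / 3%:R.
have e : x + x = pi - x by rewrite /x; field.
have := cosD x x; rewrite e cosB cospi sinpi mul0r addr0 mulN1r => c2.
have s2 := cos2Dsin2 x.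
have p0 := pi_gt0 R.
have : 0 < cos x by apply: cos_gt0_pihalf; rewrite /x; apply/andP; lra.
have /eqP : (2 * cos x - 1) * (cos x + 1) = 0 by nra.
by rewrite mulf_eq0 => /orP[] /eqP; lra.
Qed.

Lemma golden_gt0 : 0 < chord 5.
Proof.
rewrite /chord mulr_gt0 //; have p0 := pi_gt0 R.
by apply: cos_gt0_pihalf; apply/andP; lra.
Qed.

Lemma golden_sqr : chord 5 ^+ 2 = chord 5 + 1.
Proof.
have := golden_gt0; rewrite /chord; set x : R := pi / 5%:R => c0.
have e : x + x + x = pi - (x + x) by rewrite /x; field.
have := cosD (x + x) x; rewrite e cosB cospi sinpi mul0r addr0 mulN1r.
rewrite !cosD !sinD; have := cos2Dsin2 x.
move: c0; set c := cos x; set s := sin x => c0 s2 c3.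
have s2' : s * s = 1 - c * c by lra.
have {}c3 : - (c * c - s * s) = (c * c - s * s) * c - 2 * c * (s * s) by lra.
rewrite s2' in c3.
have /eqP : (4 * c ^+ 2 - 2 * c - 1) * (c + 1) = 0 by lra.
by rewrite mulf_eq0 => /orP[] /eqP; lra.
Qed.

Lemma golden_bounds : 1618033988 e- 9 < chord 5 < 1618033989 e- 9.
Proof.
have g0 := golden_gt0; have g2 := golden_sqr; set g := chord 5 in g0 g2 *.
by apply/andP; split; rewrite ltNge; apply/negP => H; nra.
Qed.

Lemma chord10_sqr : chord 10 ^+ 2 = chord 5 + 2.
Proof.
rewrite /chord (_ : pi / 5%:R = pi / 10%:R + pi / 10%:R :> R); last by field.
by rewrite cosD; have := cos2Dsin2 (pi / 10%:R : R); lra.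
Qed.

Notation phi := (chord 5).

(** Suppose that a triangle, a pentagon, a [p]-gon and a [q]-gon fit around a vertex,
    and that five triangles and a [p]-gon also do.  Let [y] be the inverse of the
    square of the hyperbolic cosine of half the common side.  The angles of five
    triangles and of the [p]-gon give [chord p = y ^+ 2 - 5 * y + 5].  Comparing the
    angles of four triangles with those of the pentagon and the [q]-gon shows that
    [defect y (chord q)] vanishes. *)
Definition defect y g : R := y ^+ 3 - 8 * y ^+ 2 + 20 * y - 16 + phi * g * (y ^+ 2 - 4 * y + 2)
             + phi ^+ 2 + g ^+ 2.

Lemma defect_mono (y1 y2 g1 g2 : R) : 69 e- 2 <= y1 -> y1 <= y2 -> y2 <= 76 e- 2 ->
  19 e- 1 <= g1 -> g1 <= g2 -> g2 <= 2 -> defect y1 g1 <= defect y2 g2.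
Proof.
move=> y1l y12 y2u g1l g12 g2u; have /andP[phl phu] := golden_bounds.
rewrite -subr_ge0.
have -> : defect y2 g2 - defect y1 g1 =
  (y2 - y1) * (y2 ^+ 2 + y1 * y2 + y1 ^+ 2 - 8 * (y1 + y2) + 20
               - phi * (g2 * (4 - y1 - y2)))
  + (g2 - g1) * (g1 + g2 - phi * (4 * y1 - 2 - y1 ^+ 2)) by rewrite /defect; ring.
have A : g2 * (4 - y1 - y2) <= 524 e- 2 by nra.
have A' : phi * (g2 * (4 - y1 - y2)) <= 1619 e- 3 * (524 e- 2) by nra.
have B : 4 * y1 - 2 - y1 ^+ 2 <= 47 e- 2 by nra.
have B' : phi * (4 * y1 - 2 - y1 ^+ 2) <= 1619 e- 3 * (47 e- 2) by nra.
have Q : 1428 e- 3 <= y2 ^+ 2 + y1 * y2 + y1 ^+ 2 by clear -y1l y12; nra.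
rewrite addr_ge0 // mulr_ge0 ?subr_ge0 //; last by clear -B' g1l g12; lra.
by clear -Q A' y2u y12; lra.
Qed.

(** The first equation makes [y] decrease as [p] increases, and then the second one
    makes [q] increase. *)
Lemma bracket_lt p q y p0 q0 (ghi yhi : R) : (10 <= q)%N ->
  69 e- 2 <= y -> y <= 76 e- 2 -> chord p = y ^+ 2 - 5 * y + 5 ->
  defect y (chord q) = 0 -> (0 < p0)%N -> (0 < q0)%N ->
  yhi ^+ 2 - 5 * yhi + 5 <= chord p0.+1 -> 69 e- 2 <= yhi -> yhi <= 76 e- 2 ->
  chord q0 <= ghi -> ghi <= 2 -> defect yhi ghi < 0 -> (p0 < p)%N -> (q0 < q)%N.
Proof.
move=> q10 yl yu yp yq p00 q00 yhip yhil yhiu gq g2 E0 pp; rewrite ltnNge; apply/negP => qq.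
have gg : chord q <= chord q0 by apply: chord_le => //; exact: leq_trans q10.
have dd : chord p0.+1 <= chord p by exact: chord_le.
have yy : y <= yhi.
  rewrite leNgt; apply/negP => lt.
  have : 0 < (y - yhi) * (5 - y - yhi) by apply: mulr_gt0; lra.
  by rewrite yp in dd; lra.
have g19 : 19 e- 1 <= chord q.
  by apply: le_trans (chord_le _ q10) => //; have := @chord_lb 10 _ isT erefl; lra.
have := defect_mono yl yy yhiu g19 (le_trans gg gq) g2.
by rewrite yq leNgt E0.
Qed.

Lemma bracket_gt p q y p0 q0 (glo ylo : R) : (0 < p)%N -> (0 < q)%N ->
  y <= 76 e- 2 -> chord p = y ^+ 2 - 5 * y + 5 -> defect y (chord q) = 0 -> (0 < p0)%N -> (0 < q0)%N ->
  chord p0 <= ylo ^+ 2 - 5 * ylo + 5 -> 69 e- 2 <= ylo -> ylo <= 76 e- 2 ->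
  glo <= chord q0 -> 19 e- 1 <= glo -> 0 < defect ylo glo -> (p <= p0)%N -> (q < q0)%N.
Proof.
move=> p0' q0' yu yp yq p00 q00 ylop ylol ylou gq g2 E0 pp; rewrite ltnNge; apply/negP => qq.
have gg : chord q0 <= chord q by exact: chord_le.
have dd : chord p <= chord p0 by exact: chord_le.
have yy : ylo <= y.
  rewrite leNgt; apply/negP => lt.
  have : 0 < (ylo - y) * (5 - y - ylo) by apply: mulr_gt0; lra.
  by rewrite yp in dd; lra.
have gu : chord q <= 2 by rewrite ltW // chord_lt2.
have := defect_mono ylol yy yu g2 (le_trans gq gg) gu.
by rewrite yq leNgt E0.
Qed.


(* Each bound on a chord is decided by the Taylor bounds, and the value of [defect]
   at a rational point is linear in [phi], as [phi ^+ 2 = phi + 1]. *)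
Ltac bracket k l :=
  try exact: isT;
  rewrite /defect ?golden_sqr; have /andP[? ?] := golden_bounds;
  have := @chord_ub k _ isT erefl; have := @chord_lb k _ isT erefl;
  have := @chord_ub l _ isT erefl; have := @chord_lb l.+1 _ isT erefl;
  try (move=> ? ? ? ?; apply/andP; split); lra.

(** [crossing q0 p0] locates the solutions of the two equations on one side of
    [q0], according to the position of [p] with respect to [p0]: among the real
    solutions, [q] increases with [p] and attains the value [q0] for some [p]
    strictly between [p0] and [p0 + 1]. *)
Definition crossing q0 p0 : Prop := forall p q y, (10 <= p)%N -> (10 <= q)%N ->
  69 e- 2 <= y -> y <= 76 e- 2 -> chord p = y ^+ 2 - 5 * y + 5 ->
  defect y (chord q) = 0 -> ((p0 < p)%N -> (q0 < q)%N) /\ ((p <= p0)%N -> (q < q0)%N).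

Lemma crossing_intro q0 p0 (glo ghi ylo yhi : R) : (0 < p0)%N -> (0 < q0)%N ->
  69 e- 2 <= yhi -> yhi <= 76 e- 2 -> 69 e- 2 <= ylo -> ylo <= 76 e- 2 ->
  yhi ^+ 2 - 5 * yhi + 5 <= chord p0.+1 -> chord p0 <= ylo ^+ 2 - 5 * ylo + 5 ->
  glo <= chord q0 <= ghi -> 19 e- 1 <= glo -> ghi <= 2 ->
  defect yhi ghi < 0 < defect ylo glo -> crossing q0 p0.
Proof.
move=> p00 q00 h1 h2 h3 h4 h5 h6 /andP[h7 h8] h9 h10 /andP[h11 h12] p q y p10 q10 yl yu yp yq.
split; first exact: (bracket_lt q10 yl yu yp yq p00 q00 h5 h1 h2 h8 h10 h11).
apply: (bracket_gt _ _ yu yp yq p00 q00 h6 h3 h4 h7 h9 h12).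
  exact: leq_trans p10.
exact: leq_trans q10.
Qed.

(* The decimals are bounds for [chord q0], a lower bound for the value of [y] at [p0]
   and an upper bound for its value at [p0 + 1]. *)
Lemma crossing20 : crossing 20 9.
Proof.
by apply: (@crossing_intro _ _ (197537668 e- 8) (197537673 e- 8) (73099172 e- 8) (72458089 e- 8));
  bracket 20%N 9%N.
Qed.

Lemma crossing21 : crossing 21 10.
Proof.
by apply: (@crossing_intro _ _ (197766165 e- 8) (197766169 e- 8) (72458013 e- 8) (71983542 e- 8));
  bracket 21%N 10%N.
Qed.

Lemma crossing22 : crossing 22 11.
Proof.
by apply: (@crossing_intro _ _ (197964288 e- 8) (197964291 e- 8) (71983499 e- 8) (71622545 e- 8));
  bracket 22%N 11%N.
Qed.

Lemma crossing23 : crossing 23 12.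
Proof.
by apply: (@crossing_intro _ _ (198137189 e- 8) (198137192 e- 8) (71622519 e- 8) (71341566 e- 8));
  bracket 23%N 12%N.
Qed.

Lemma crossing24 : crossing 24 13.
Proof.
by apply: (@crossing_intro _ _ (198288972 e- 8) (198288974 e- 8) (71341549 e- 8) (71118592 e- 8));
  bracket 24%N 13%N.
Qed.

Lemma crossing25 : crossing 25 15.
Proof.
by apply: (@crossing_intro _ _ (198422940 e- 8) (198422942 e- 8) (70938685 e- 8) (70791447 e- 8));
  bracket 25%N 15%N.
Qed.

Lemma crossing26 : crossing 26 16.
Proof.
by apply: (@crossing_intro _ _ (198541774 e- 8) (198541776 e- 8) (70791442 e- 8) (70669407 e- 8));
  bracket 26%N 16%N.
Qed.

Lemma crossing27 : crossing 27 18.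
Proof.
by apply: (@crossing_intro _ _ (198647671 e- 8) (198647673 e- 8) (70567127 e- 8) (70480570 e- 8));
  bracket 27%N 18%N.
Qed.

Lemma crossing28 : crossing 28 21.
Proof.
by apply: (@crossing_intro _ _ (198742441 e- 8) (198742443 e- 8) (70343057 e- 8) (70287929 e- 8));
  bracket 28%N 21%N.
Qed.

Lemma crossing29 : crossing 29 25.
Proof.
by apply: (@crossing_intro _ _ (198827591 e- 8) (198827592 e- 8) (70160365 e- 8) (70127331 e- 8));
  bracket 29%N 25%N.
Qed.

Lemma crossing30 : crossing 30 30.
Proof.
by apply: (@crossing_intro _ _ (198904379 e- 8) (198904380 e- 8) (70026563 e- 8) (70007261 e- 8));
  bracket 30%N 30%N.
Qed.

Lemma crossing31 : crossing 31 40.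
Proof.
by apply: (@crossing_intro _ _ (198973864 e- 8) (198973865 e- 8) (69893512 e- 8) (69885270 e- 8));
  bracket 31%N 40%N.
Qed.

Lemma crossing32 : crossing 32 71.
Proof.
by apply: (@crossing_intro _ _ (199036945 e- 8) (199036946 e- 8) (69776736 e- 8) (69775240 e- 8));
  bracket 32%N 71%N.
Qed.

(** As [chord p < 2], the values of [y] have a lower bound, and thus [q] has an upper
    bound, for all [p]. *)
Lemma lt33 p q y : (0 < p)%N -> (0 < q)%N ->
  y <= 76 e- 2 -> chord p = y ^+ 2 - 5 * y + 5 -> defect y (chord q) = 0 -> (q < 33)%N.
Proof.
move=> p0 q0 yu yp yq; rewrite ltnNge; apply/negP => qq.
have q33 : chord 33 <= chord q by exact: chord_le.
have p2 : chord p < 2 by exact: chord_lt2.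
have yy : 69722436 e- 8 <= y.
  rewrite leNgt; apply/negP => lt.
  have : 0 < (69722436 e- 8 - y) * (5 - y - 69722436 e- 8).
    by clear -lt; apply: mulr_gt0; lra.
  by rewrite yp in p2; clear -p2; lra.
have gu : chord q <= 2 by rewrite ltW // chord_lt2.
have g33 : 199094384 e- 8 <= chord 33.
  by have := @chord_lb 33 _ isT erefl; clear; lra.
have E0 : 0 < defect (69722436 e- 8) (199094384 e- 8).
  by rewrite /defect golden_sqr; have /andP[] := golden_bounds; clear; lra.
have : defect (69722436 e- 8) (199094384 e- 8) <= defect y (chord q).
  by apply: (defect_mono _ yy yu _ (le_trans g33 q33) gu); clear; lra.
by rewrite yq leNgt E0.
Qed.

(** For each [p], two consecutive crossings leave no integer between the bounds that
    they give for [q]. *)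
Lemma five_triangles_false p q y : (10 <= p)%N -> (10 <= q)%N ->
  69 e- 2 <= y -> y <= 76 e- 2 -> chord p = y ^+ 2 - 5 * y + 5 ->
  defect y (chord q) = 0 -> False.
Proof.
move=> p10 q10 yl yu yp yq.
have p0 : (0 < p)%N := leq_trans (isT : (0 < 10)%N) p10.
have q0 : (0 < q)%N := leq_trans (isT : (0 < 10)%N) q10.
have [l20 u20] := crossing20 p10 q10 yl yu yp yq.
have [l21 u21] := crossing21 p10 q10 yl yu yp yq.
have [l22 u22] := crossing22 p10 q10 yl yu yp yq.
have [l23 u23] := crossing23 p10 q10 yl yu yp yq.
have [l24 u24] := crossing24 p10 q10 yl yu yp yq.
have [l25 u25] := crossing25 p10 q10 yl yu yp yq.
have [l26 u26] := crossing26 p10 q10 yl yu yp yq.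
have [l27 u27] := crossing27 p10 q10 yl yu yp yq.
have [l28 u28] := crossing28 p10 q10 yl yu yp yq.
have [l29 u29] := crossing29 p10 q10 yl yu yp yq.
have [l30 u30] := crossing30 p10 q10 yl yu yp yq.
have [l31 u31] := crossing31 p10 q10 yl yu yp yq.
have [l32 u32] := crossing32 p10 q10 yl yu yp yq.
have u33 := lt33 p0 q0 yu yp yq.
by clear -p10 l20 l21 l22 l23 l24 l25 l26 l27 l28 l29 l30 l31 l32 u21 u22 u23 u24 u25 u26 u27 u28 u29 u30 u31 u32 u33; lia.
Qed.

End Chords.

(** * Two triangles and three pentagons at a vertex *)

Section AngleEquations.
Variable R : realType.
Implicit Types (k l p q : nat) (y g t : R).

Local Notation "n 'e-' k" := (n%N%:R / 10%:R ^+ k%N) (at level 2).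
Local Notation chord := (@chord R).
Local Notation phi := (chord 5).

(** With [phi ^+ 2 = phi + 1] this is a quadratic equation for [y]; only its smaller
    root is in the interval. *)
Lemma three_pentagons_y y : 69 e- 2 <= y -> y <= 76 e- 2 ->
  4 - y = phi ^+ 2 * (3 - phi ^+ 2 * y) ^+ 2 ->
  7182464748 e- 10 <= y <= 7182464750 e- 10.
Proof.
move=> yl yu; have := golden_sqr R; have /andP[] := golden_bounds R.
move: phi => f pl pu g2.
have f4 : (f ^+ 2) ^+ 2 = 3 * f + 2.
  rewrite g2; have -> : (f + 1) ^+ 2 = f ^+ 2 + 2 * f + 1 by ring.
  by rewrite g2; ring.
have f6 : (f ^+ 2) ^+ 3 = 8 * f + 5.
  rewrite exprS f4 g2; have -> : (f + 1) * (3 * f + 2) = 3 * f ^+ 2 + 5 * f + 2 by ring.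
  by rewrite g2; ring.
move=> yE; have {}yE : 4 - y = 9 * f ^+ 2 - 6 * (f ^+ 2) ^+ 2 * y + (f ^+ 2) ^+ 3 * y ^+ 2.
  by rewrite yE; ring.
rewrite f6 f4 g2 in yE.
have mono (z : R) : z <= 76 e- 2 -> 0 < 18 * f + 11 - (8 * f + 5) * (y + z).
  move=> zu; have : (8 * f + 5) * (y + z) <= (8 * f + 5) * (152 e- 2).
    by rewrite ler_pM2l; lra.
  by lra.
have below (z : R) : z <= 76 e- 2 ->
    0 < 9 * (f + 1) - 6 * (3 * f + 2) * z + (8 * f + 5) * z ^+ 2 - 4 + z -> z <= y.
  move=> zu pos; rewrite leNgt; apply/negP => lt.
  have : 0 < (z - y) * (18 * f + 11 - (8 * f + 5) * (y + z)).
    by apply: mulr_gt0; [rewrite subr_gt0|exact: mono].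
  by clear -pos yE; lra.
have above (z : R) : z <= 76 e- 2 ->
    9 * (f + 1) - 6 * (3 * f + 2) * z + (8 * f + 5) * z ^+ 2 - 4 + z < 0 -> y <= z.
  move=> zu neg; rewrite leNgt; apply/negP => lt.
  have : 0 < (y - z) * (18 * f + 11 - (8 * f + 5) * (y + z)).
    by apply: mulr_gt0; [rewrite subr_gt0|exact: mono].
  by clear -neg yE; lra.
by apply/andP; split; [apply: below|apply: above]; clear -pl pu; lra.
Qed.

Lemma le_of_sqr (r z w : R) : 0 <= z -> z ^+ 2 = w -> 0 <= r -> r ^+ 2 <= w -> r <= z.
Proof. by move=> z0 <- r0; rewrite ler_pXn2r ?nnegrE. Qed.

Lemma ge_of_sqr (r z w : R) : 0 <= z -> z ^+ 2 = w -> 0 <= r -> w <= r ^+ 2 -> z <= r.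
Proof. by move=> z0 <- r0; rewrite ler_pXn2r ?nnegrE. Qed.

Lemma chord10_bounds : 1902113032 e- 9 <= chord 10 <= 1902113033 e- 9.
Proof.
have c2 := chord10_sqr R; have /andP[pl pu] := golden_bounds R.
have c0 : 0 <= chord 10 by have := @chord_lb R 10 _ isT erefl; clear; lra.
by apply/andP; split; [apply: (le_of_sqr c0 c2)|apply: (ge_of_sqr c0 c2)];
  clear -pl pu; lra.
Qed.

(** The bounded quantity is the cosine of the sum of the half-angles of a triangle and
    a pentagon. *)
Lemma K_bounds y (A B : R) : 7182464748 e- 10 <= y -> y <= 7182464750 e- 10 ->
  0 <= A -> 0 <= B -> A ^+ 2 = 1 - y / 4 -> B ^+ 2 = 1 - phi ^+ 2 * y / 4 ->
  3688201523 e- 10 <= A * B - phi * y / 4 <= 3688201530 e- 10.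
Proof.
move=> yl yu A0 B0 A2; have /andP[pl pu] := golden_bounds R.
rewrite golden_sqr => B2.
have py : 1618033988 e- 9 * (7182464748 e- 10) <= phi * y.
  by apply: (ler_pM _ _ (ltW pl) yl); clear; lra.
have py' : phi * y <= 1618033989 e- 9 * (7182464750 e- 10).
  by apply: (ler_pM _ _ (ltW pu) yu); [clear -pl; lra|clear -yl; lra].
have Al : 9057805370 e- 10 <= A by apply: (le_of_sqr A0 A2); clear -yu; lra.
have Au : A <= 9057805371 e- 10 by apply: (ge_of_sqr A0 A2); clear -yl; lra.
have Bl : 7279433899 e- 10 <= B by apply: (le_of_sqr B0 B2); clear -yu py'; lra.
have Bu : B <= 7279433902 e- 10 by apply: (ge_of_sqr B0 B2); clear -yl py; lra.
have AB : 9057805370 e- 10 * (7279433899 e- 10) <= A * B.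
  by apply: ler_pM Al Bl; clear; lra.
have AB' : A * B <= 9057805371 e- 10 * (7279433902 e- 10).
  exact (ler_pM A0 B0 Au Bu).
by apply/andP; split; clear -AB AB' py py'; lra.
Qed.

(* The last equation says that the half-angles of the two other polygons complete
   those of the triangle and the pentagon to [pi].  Their cosines [C] and [D]
   decrease as [g], [e] and [y] increase. *)
Section PairOfPolygons.
Variables (y y1 y2 K K1 K2 C D g e : R).
Hypotheses (y10 : 0 <= y1) (yl : y1 <= y) (yu : y <= y2) (Kl : K1 <= K) (Ku : K <= K2).
Hypotheses (C0 : 0 <= C) (D0 : 0 <= D).
Hypotheses (C2 : C ^+ 2 = 1 - g ^+ 2 * y / 4) (D2 : D ^+ 2 = 1 - e ^+ 2 * y / 4).
Hypotheses (g0 : 1 <= g) (e0 : 1 <= e).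
Hypothesis KCD : K + (C * D - g * e * y / 4) = 0.

Let g00 : 0 <= g. Proof. exact: le_trans ler01 g0. Qed.
Let e00 : 0 <= e. Proof. exact: le_trans ler01 e0. Qed.
Let y00 : 0 <= y. Proof. exact: le_trans y10 yl. Qed.

Lemma pair_low (g1 e1 r s : R) : 0 <= g1 -> 0 <= e1 -> g1 <= g -> e1 <= e ->
  0 <= r -> 0 <= s -> 1 - g1 ^+ 2 * y1 / 4 <= r ^+ 2 ->
  1 - e1 ^+ 2 * y1 / 4 <= s ^+ 2 -> r * s - g1 * e1 * y1 / 4 + K2 < 0 -> False.
Proof.
move=> g10 e10 gg ee r0 s0 rE sE neg; move: KCD Ku => KCD' Ku'.
have sq (u w : R) : 0 <= u -> u <= w -> u ^+ 2 * y1 <= w ^+ 2 * y.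
  by move=> u0 uw; rewrite ler_pM ?sqr_ge0 // ler_pXn2r ?nnegrE // (le_trans u0).
have Cr : C <= r.
  by apply: (ge_of_sqr C0 C2) => //; have := sq _ _ g10 gg; lra.
have Ds : D <= s.
  by apply: (ge_of_sqr D0 D2) => //; have := sq _ _ e10 ee; lra.
have CD : C * D <= r * s by exact: ler_pM.
have ge : g1 * e1 * y1 <= g * e * y by rewrite !ler_pM // mulr_ge0.
by lra.
Qed.

Lemma pair_high (g1 e1 r s : R) : g <= g1 -> e <= e1 ->
  0 <= r -> 0 <= s -> r ^+ 2 <= 1 - g1 ^+ 2 * y2 / 4 ->
  s ^+ 2 <= 1 - e1 ^+ 2 * y2 / 4 -> 0 < r * s - g1 * e1 * y2 / 4 + K1 -> False.
Proof.
move=> gg ee r0 s0 rE sE pos; move: KCD Kl => KCD' Kl'.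
have sq (u w : R) : 0 <= u -> u <= w -> u ^+ 2 * y <= w ^+ 2 * y2.
  by move=> u0 uw; rewrite ler_pM ?sqr_ge0 // ler_pXn2r ?nnegrE // (le_trans u0).
have Cr : r <= C.
  by apply: (le_of_sqr C0 C2) => //; have := sq _ _ g00 gg; lra.
have Ds : s <= D.
  by apply: (le_of_sqr D0 D2) => //; have := sq _ _ e00 ee; lra.
have CD : r * s <= C * D by exact: ler_pM.
have ge : g * e * y <= g1 * e1 * y2 by rewrite !ler_pM // mulr_ge0.
by lra.
Qed.

End PairOfPolygons.

(** As [y] is known, the last equation relates [k] and [l].  The sum of the
    half-angles of the [k]-gon and the [l]-gon increases with [k] and [l].  It is too
    small for (13, 16), (12, 18) and (10, 281), and too large for (14, 15), (13, 17),
    (12, 19) and (10, 282). *)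
Lemma three_pentagons_false k l y (A B C D : R) :
  (10 <= k)%N -> (k < l)%N -> k <> 11%N ->
  69 e- 2 <= y -> y <= 76 e- 2 ->
  4 - y = phi ^+ 2 * (3 - phi ^+ 2 * y) ^+ 2 ->
  0 <= A -> 0 <= B -> 0 <= C -> 0 <= D ->
  A ^+ 2 = 1 - y / 4 -> B ^+ 2 = 1 - phi ^+ 2 * y / 4 ->
  C ^+ 2 = 1 - chord k ^+ 2 * y / 4 -> D ^+ 2 = 1 - chord l ^+ 2 * y / 4 ->
  A * B - phi * y / 4 + (C * D - chord k * chord l * y / 4) = 0 -> False.
Proof.
move=> k10 kl k11 yl yu /(three_pentagons_y yl yu)/andP[{}yl {}yu].
move=> A0 B0 C0 D0 A2 B2 C2 D2 ABCD.
have /andP[Kl Ku] := K_bounds yl yu A0 B0 A2 B2.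
have y10 : 0 <= 7182464748 e- 10 :> R by clear; lra.
have k0 : (0 < k)%N by apply: leq_trans k10.
have l0 : (0 < l)%N by apply: leq_trans kl.
have c1 n : (10 <= n)%N -> 1 <= chord n.
  move=> n10; apply: le_trans (chord_le _ _ n10) => //.
  by have /andP[+ _] := chord10_bounds; clear; lra.
have g1 := c1 _ k10; have e1 := c1 _ (leq_trans k10 (ltnW kl)).
have low k' l' (g' e' r s : R) : (0 < k')%N -> (0 < l')%N -> (k' <= k)%N -> (l' <= l)%N ->
    g' <= chord k' -> e' <= chord l' ->
    0 <= g' -> 0 <= e' -> 0 <= r -> 0 <= s ->
    1 - g' ^+ 2 * (7182464748 e- 10) / 4 <= r ^+ 2 ->
    1 - e' ^+ 2 * (7182464748 e- 10) / 4 <= s ^+ 2 ->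
    r * s - g' * e' * (7182464748 e- 10) / 4 + 3688201530 e- 10 < 0 -> False.
  move=> k'0 l'0 kk ll gk el g'0 e'0 r0 s0.
  have gg := le_trans gk (chord_le R k'0 kk); have ee := le_trans el (chord_le R l'0 ll).
  exact: (pair_low y10 yl Ku C0 D0 C2 D2 ABCD g'0 e'0 gg ee r0 s0).
have high k' l' (g' e' r s : R) : (k <= k')%N -> (l <= l')%N ->
    chord k' <= g' -> chord l' <= e' -> 0 <= r -> 0 <= s ->
    r ^+ 2 <= 1 - g' ^+ 2 * (7182464750 e- 10) / 4 ->
    s ^+ 2 <= 1 - e' ^+ 2 * (7182464750 e- 10) / 4 ->
    0 < r * s - g' * e' * (7182464750 e- 10) / 4 + 3688201523 e- 10 -> False.
  move=> kk ll gk el r0 s0.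
  have gg := le_trans (chord_le R k0 kk) gk; have ee := le_trans (chord_le R l0 ll) el.
  exact: (pair_high y10 yl yu Kl C0 D0 C2 D2 g1 e1 ABCD gg ee r0 s0).
have ub n (x := 3141592652 e- 9 / n%:R : R) := @chord_ub R n x.
have lb n (x := 3141592654 e- 9 / n%:R : R) := @chord_lb R n x.
have /andP[c10l c10u] := chord10_bounds.
have [k14|k14] := leqP 14 k.
  by apply: (low 14%N 15%N (1949855824 e- 9) (1956295201 e- 9) (563309779 e- 9)
    (559286475 e- 9) isT isT k14 (leq_ltn_trans k14 kl));
  [have := lb 14%N isT erefl|have := lb 15%N isT erefl| ..]; clear; lra.
have [k13|k13] := eqVneq k 13%N.
  have kk : (k <= 13)%N /\ (13 <= k)%N by rewrite k13.
  have [l16|l16] := leqP l 16.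
    by apply: (high 13%N 16%N (1941884188 e- 9) (1961570720 e- 9) (568232823 e- 9)
      (555958668 e- 9) kk.1 l16);
    [have := ub 13%N isT erefl|have := ub 16%N isT erefl| ..]; clear; lra.
  by apply: (low 13%N 17%N (1941883634 e- 9) (1965946199 e- 9) (568233165 e- 9)
    (553176570 e- 9) isT isT kk.2 l16);
  [have := lb 13%N isT erefl|have := lb 17%N isT erefl| ..]; clear; lra.
have [k12|k12] := eqVneq k 12%N.
  have kk : (k <= 12)%N /\ (12 <= k)%N by rewrite k12.
  have [l18|l18] := leqP l 18.
    by apply: (high 12%N 18%N (1931852546 e- 9) (1969615585 e- 9) (574339878 e- 9)
      (550827786 e- 9) kk.1 l18);
    [have := ub 12%N isT erefl|have := ub 18%N isT erefl| ..]; clear; lra.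
  by apply: (low 12%N 19%N (1931851651 e- 9) (1972722606 e- 9) (574340420 e- 9)
    (548827672 e- 9) isT isT kk.2 l18);
  [have := lb 12%N isT erefl|have := lb 19%N isT erefl| ..]; clear; lra.
have kE : k = 10%N.
  by apply/eqP; move/eqP: k11; clear -k10 k14 k13 k12; lia.
have kk : (k <= 10)%N /\ (10 <= k)%N by rewrite kE.
have [l281|l281] := leqP l 281.
  by apply: (high 10%N 281%N (1902113033 e- 9) (1999875008 e- 9) (591895227 e- 9)
    (530889157 e- 9) kk.1 l281 c10u);
  [have := ub 281%N isT erefl| ..]; clear; lra.
by apply: (low 10%N 282%N (1902113032 e- 9) (1999875892 e- 9) (591895228 e- 9)
  (530888560 e- 9) isT isT kk.2 l281 c10l);
[have := lb 282%N isT erefl| ..]; clear; lra.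
Qed.

End AngleEquations.

(** * The number of polygons of each kind at a vertex *)

Section VertexEquation.
Variable R : realType.
Implicit Types (k l : nat) (x t r : R).

Local Notation "n 'e-' k" := (n%N%:R / 10%:R ^+ k%N) (at level 2).
Local Notation chord := (@chord R).

Lemma sin_lt_inv x r : 0 <= x <= pi / 2 -> 0 <= r <= pi / 2 -> sin x < sin r -> x < r.
Proof.
move=> /andP[x0 x1] /andP[r0 r1]; rewrite ltr_sin // in_itv /=; apply/andP; lra.
Qed.

Lemma angle_ub x r : 0 <= x <= pi / 2 -> 0 <= r -> r <= 157 e- 2 ->
  sin x < r - r ^+ 3 / 6 + r ^+ 5 / 120 - r ^+ 7 / (720 * 7) -> x < r.
Proof.
move=> xp r0 r1 sx; apply: sin_lt_inv => //; last exact: lt_le_trans sx (sin_lb r0).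
by rewrite r0 /=; have := pi_lb R; clear -r1; lra.
Qed.

Lemma angle_lb x r : 0 <= x <= pi / 2 -> 0 <= r -> r <= 157 e- 2 ->
  r - r ^+ 3 / 6 + r ^+ 5 / 120 < sin x -> r < x.
Proof.
move=> xp r0 r1 sx; apply: sin_lt_inv => //; last exact: le_lt_trans (sin_ub r0) sx.
by rewrite r0 /=; have := pi_lb R; clear -r1; lra.
Qed.

(** The sum of the four half-angles increases with [t], which confines [t]; splitting
    the range of [t] at 0.85 makes the resulting bounds on the angles sharp enough
    for [vertex_counts]. *)
Lemma angle_bounds k l t (a b c d : R) : (10 <= k)%N -> (10 <= l)%N ->
  0 < t -> 0 <= a <= pi / 2 -> 0 <= b <= pi / 2 -> 0 <= c <= pi / 2 ->
  0 <= d <= pi / 2 -> sin a = t * chord 3 / 2 -> sin b = t * chord 5 / 2 ->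
  sin c = t * chord k / 2 -> sin d = t * chord l / 2 -> a + b + c + d = pi ->
  [/\ 833 e- 3 <= t <= 866 e- 3, 4295 e- 4 <= a <= 4480 e- 4, 7394 e- 4 <= b <= 7768 e- 4,
      9278 e- 4 <= c <= 10165 e- 4 & 9278 e- 4 <= d <= 10165 e- 4].
Proof.
move=> k10 l10 t0 a0 b0 c0 d0; rewrite chord3 mulr1 => sa sb sc sd abcd.
have pl := pi_lb R; have pu := pi_ub R; have /andP[fl fu] := golden_bounds R.
have ch n : (10 <= n)%N -> 1902 e- 3 <= chord n <= 2.
  move=> n10; have n0 : (0 < n)%N by apply: leq_trans n10.
  rewrite (ltW (chord_lt2 R n0)) andbT; apply: le_trans (chord_le _ _ n10) => //.
  by have /andP[+ _] := chord10_bounds R; clear; lra.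
have /andP[kl ku] := ch _ k10; have /andP[ll lu] := ch _ l10.
have tb : 1618033988 e- 9 * t < chord 5 * t < 1618033989 e- 9 * t.
  by rewrite !ltr_pM2r // fl fu.
have tk : 1902 e- 3 * t <= chord k * t <= 2 * t by rewrite !ler_pM2r // kl ku.
have tl : 1902 e- 3 * t <= chord l * t <= 2 * t by rewrite !ler_pM2r // ll lu.
have /andP[sb1 sb2] : 809016994 e- 9 * t < sin b < 8090169945 e- 10 * t.
  by move/andP: tb => [h1 h2]; apply/andP; rewrite sb; split; clear -h1 h2; lra.
have /andP[sc1 sc2] : 951 e- 3 * t <= sin c <= t.
  by move/andP: tk => [h1 h2]; apply/andP; rewrite sc; split; clear -h1 h2; lra.
have /andP[sd1 sd2] : 951 e- 3 * t <= sin d <= t.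
  by move/andP: tl => [h1 h2]; apply/andP; rewrite sd; split; clear -h1 h2; lra.
have sa1 : sin a = 5 e- 1 * t by rewrite sa; clear; lra.
clear sa sb sc sd tb tk tl ch kl ku ll lu.
have tlow : 833 e- 3 <= t.
  rewrite leNgt; apply/negP => tt.
  have ha : a < 4298 e- 4 by apply: (angle_ub a0); clear -tt sa1 t0; lra.
  have hb : b < 7397 e- 4 by apply: (angle_ub b0); clear -tt sb2 t0; lra.
  have hc : c < 9848 e- 4 by apply: (angle_ub c0); clear -tt sc2 t0; lra.
  have hd : d < 9848 e- 4 by apply: (angle_ub d0); clear -tt sd2 t0; lra.
  by clear -ha hb hc hd abcd pl; lra.
have thigh : t <= 866 e- 3.
  rewrite leNgt; apply/negP => tt.
  have ha : 4470 e- 4 < a by apply: (angle_lb a0); clear -tt sa1 t0; lra.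
  have hb : 7760 e- 4 < b by apply: (angle_lb b0); clear -tt sb1 t0; lra.
  have hc : 9650 e- 4 < c by apply: (angle_lb c0); clear -tt sc1 t0; lra.
  have hd : 9650 e- 4 < d by apply: (angle_lb d0); clear -tt sd1 t0; lra.
  by clear -ha hb hc hd abcd pu; lra.
have [t85|t85] := leP t (85 e- 2).
  have ha1 : 4295 e- 4 < a by apply: (angle_lb a0); clear -tlow sa1; lra.
  have hb1 : 7394 e- 4 < b by apply: (angle_lb b0); clear -tlow sb1; lra.
  have ha2 : a < 4390 e- 4 by apply: (angle_ub a0); clear -t85 sa1; lra.
  have hb2 : b < 7584 e- 4 by apply: (angle_ub b0); clear -t85 sb2; lra.
  have hc2 : c < 10161 e- 4 by apply: (angle_ub c0); clear -t85 sc2; lra.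
  have hd2 : d < 10161 e- 4 by apply: (angle_ub d0); clear -t85 sd2; lra.
  have hc1 : 9278 e- 4 < c by clear -ha2 hb2 hd2 abcd pl; lra.
  have hd1 : 9278 e- 4 < d by clear -ha2 hb2 hc2 abcd pl; lra.
  split; apply/andP; split; [clear -tlow|clear -thigh|clear -ha1|clear -ha2|clear -hb1|
    clear -hb2|clear -hc1|clear -hc2|clear -hd1|clear -hd2]; lra.
have ha1 : 4387 e- 4 < a by apply: (angle_lb a0); clear -t85 sa1; lra.
have hb1 : 7578 e- 4 < b by apply: (angle_lb b0); clear -t85 sb1; lra.
have ha2 : a < 4480 e- 4 by apply: (angle_ub a0); clear -thigh sa1; lra.
have hb2 : b < 7768 e- 4 by apply: (angle_ub b0); clear -thigh sb2; lra.
have hc1 : 9390 e- 4 < c by apply: (angle_lb c0); clear -t85 sc1; lra.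
have hd1 : 9390 e- 4 < d by apply: (angle_lb d0); clear -t85 sd1; lra.
have hc2 : c < 10165 e- 4 by clear -ha1 hb1 hd1 abcd pu; lra.
have hd2 : d < 10165 e- 4 by clear -ha1 hb1 hc1 abcd pu; lra.
split; apply/andP; split; [clear -tlow|clear -thigh|clear -ha1|clear -ha2|clear -hb1|
  clear -hb2|clear -hc1|clear -hc2|clear -hd1|clear -hd2]; lra.
Qed.

Lemma sin5 x : sin (x + x + x + x + x) = 16 * sin x ^+ 5 - 20 * sin x ^+ 3 + 5 * sin x.
Proof.
have e : sin (x + x + x + x + x) = sin x * (5 * (cos x ^+ 2) ^+ 2
    - 10 * cos x ^+ 2 * sin x ^+ 2 + sin x ^+ 4).
  by rewrite !(sinD, cosD); ring.
by rewrite e cos2sin2; ring.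
Qed.

Lemma cos4 x : cos (x + x + x + x) = 8 * sin x ^+ 4 - 8 * sin x ^+ 2 + 1.
Proof.
have e : cos (x + x + x + x) = (cos x ^+ 2) ^+ 2 - 6 * cos x ^+ 2 * sin x ^+ 2 + sin x ^+ 4.
  by rewrite !(sinD, cosD); ring.
by rewrite e cos2sin2; ring.
Qed.

Lemma five_triangles_angles p q t (a b c d : R) : (10 <= p)%N -> (10 <= q)%N ->
  833 e- 3 <= t -> t <= 866 e- 3 -> sin a = t * chord 3 / 2 -> sin b = t * chord 5 / 2 ->
  sin c = t * chord p / 2 -> sin d = t * chord q / 2 -> a + b + c + d = pi ->
  a + a + a + a + a + c = pi -> False.
Proof.
move=> p10 q10 tl tu; rewrite chord3 mulr1 => sa sb sc sd abcd ac.
have t0 : 0 < t by clear -tl; lra.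
apply: (@five_triangles_false R p q (t ^+ 2)) => //.
- by clear -tl t0; nra.
- by clear -tu t0; nra.
- have cE : c = pi - (a + a + a + a + a) by clear -ac; lra.
  have := sc; rewrite cE sinB sinpi cospi mul0r sub0r mulN1r opprK sin5 sa => H.
  by apply: (mulfI (lt0r_neq0 t0)); clear -H; lra.
- have bd : b + d = a + a + a + a by clear -ac abcd; lra.
  have := cosD b d; rewrite bd cos4 => H.
  have : (8 * sin a ^+ 4 - 8 * sin a ^+ 2 + 1 + sin b * sin d) ^+ 2
      = (1 - sin b ^+ 2) * (1 - sin d ^+ 2).
    by rewrite -!cos2sin2 -exprMn H; ring.
  rewrite sa sb sd => {}H.
  have t20 : t ^+ 2 != 0 by rewrite sqrf_eq0 gt_eqF.
  by apply: (mulfI t20); rewrite mulr0 /defect; clear -H; lra.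
Qed.

Lemma three_pentagons_angles k l t (a b c d : R) :
  (10 <= k)%N -> (k < l)%N -> k <> 11%N ->
  833 e- 3 <= t -> t <= 866 e- 3 ->
  0 <= cos a -> 0 <= cos b -> 0 <= cos c -> 0 <= cos d ->
  sin a = t * chord 3 / 2 -> sin b = t * chord 5 / 2 ->
  sin c = t * chord k / 2 -> sin d = t * chord l / 2 -> a + b + c + d = pi ->
  a + a + (b + b + b) = pi -> False.
Proof.
move=> k10 kl k11 tl tu a0 b0 c0 d0; rewrite chord3 mulr1 => sa sb sc sd abcd ab.
have t0 : 0 < t by clear -tl; lra.
apply: (@three_pentagons_false R k l (t ^+ 2) (cos a) (cos b) (cos c) (cos d)) => //.
- by clear -tl t0; nra.
- by clear -tu t0; nra.
- have t20 : t ^+ 2 != 0 by rewrite sqrf_eq0 gt_eqF.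
  have e : a + a = pi - (b + b + b) by clear -ab; lra.
  have := sinD a a; rewrite e sinB sinpi cospi mul0r sub0r mulN1r opprK.
  have -> : sin (b + b + b) = sin b * (3 * cos b ^+ 2 - sin b ^+ 2).
    by rewrite !(sinD, cosD); ring.
  rewrite cos2sin2 => H; have : (sin b * (3 * (1 - sin b ^+ 2) - sin b ^+ 2)) ^+ 2
      = 4 * sin a ^+ 2 * (1 - sin a ^+ 2) by rewrite H -cos2sin2; ring.
  rewrite sa sb => {}H.
  by apply: (mulfI t20); clear -H; lra.
- by rewrite cos2sin2 sa; clear; lra.
- by rewrite cos2sin2 sb; clear; lra.
- by rewrite cos2sin2 sc; clear; lra.
- by rewrite cos2sin2 sd; clear; lra.
- have e : c + d = pi - (a + b) by clear -abcd; lra.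
  have := cosD c d; rewrite e cosB cospi sinpi mul0r addr0 cosD sa sb sc sd => H.
  by clear -H; lra.
Qed.

Lemma natr_comb_le (x y z i j m n : nat) :
  x%:R * i%:R + y%:R * j%:R + z%:R * m%:R <= n%:R :> R ->
  (x * i + y * j + z * m <= n)%N.
Proof. by rewrite -(ler_nat R) !natrD !natrM. Qed.

Lemma natr_comb_ge (x y z i j m n : nat) :
  n%:R <= x%:R * i%:R + y%:R * j%:R + z%:R * m%:R :> R ->
  (n <= x * i + y * j + z * m)%N.
Proof. by rewrite -(ler_nat R) !natrD !natrM. Qed.

(** The bounds on the half-angles leave (1, 1, 2), (5, 0, 1) and (2, 3, 0) for [na],
    [nb] and [nc + nd].  The last two are excluded by [five_triangles_false] and
    [three_pentagons_false]; in the first case [nc] and [nd] are 1 as [c < d]. *)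
Lemma vertex_counts k l t (a b c d : R) (na nb nc nd : nat) :
  (10 <= k)%N -> (k < l)%N -> k <> 11%N -> 0 < t ->
  0 <= a <= pi / 2 -> 0 <= b <= pi / 2 -> 0 <= c <= pi / 2 -> 0 <= d <= pi / 2 ->
  sin a = t * chord 3 / 2 -> sin b = t * chord 5 / 2 ->
  sin c = t * chord k / 2 -> sin d = t * chord l / 2 -> a + b + c + d = pi ->
  na%:R * a + nb%:R * b + nc%:R * c + nd%:R * d = pi ->
  [/\ na = 1, nb = 1, nc = 1 & nd = 1]%N.
Proof.
move=> k10 kl k11 t0 a0 b0 c0 d0 sa sb sc sd abcd nE.
have l10 : (10 <= l)%N := leq_trans k10 (ltnW kl).
have [/andP[tl tu] /andP[al au] /andP[bl bu] /andP[cl cu] /andP[dl du]] :=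
  angle_bounds k10 l10 t0 a0 b0 c0 d0 sa sb sc sd abcd.
have pl := pi_lb R; have pu := pi_ub R.
have scale (n : nat) (x lo hi : R) : lo <= x -> x <= hi -> n%:R * lo <= n%:R * x <= n%:R * hi.
  by move=> lx xh; rewrite !ler_wpM2l.
have /andP[nal nau] := scale na _ _ _ al au. have /andP[nbl nbu] := scale nb _ _ _ bl bu.
have /andP[ncl ncu] := scale nc _ _ _ cl cu. have /andP[ndl ndu] := scale nd _ _ _ dl du.
have na0 : 0 <= na%:R :> R by []. have nb0 : 0 <= nb%:R :> R by [].
have nc0 : 0 <= nc%:R :> R by []. have nd0 : 0 <= nd%:R :> R by [].
have low : (644 * na + 1109 * nb + 1391 * (nc + nd) <= 4713)%N.
  apply: natr_comb_le; rewrite natrD.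
  by clear -nal nbl ncl ndl nE pu na0 nb0 nc0 nd0; lra.
have high : (4712 <= 672 * na + 1166 * nb + 1525 * (nc + nd))%N.
  apply: natr_comb_ge; rewrite natrD.
  by clear -nau nbu ncu ndu nE pl na0 nb0 nc0 nd0; lra.
have cd : c < d.
  apply: sin_lt_inv => //; rewrite sc sd ltr_pM2r ?invr_gt0 // ltr_pM2l //.
  by apply: chord_lt kl; apply: leq_trans k10.
have : (na = 1 /\ nb = 1 /\ nc + nd = 2 \/ na = 5 /\ nb = 0 /\ nc + nd = 1 \/
    na = 2 /\ nb = 3 /\ nc + nd = 0)%N.
  clear -low high; move: (nc + nd)%N low high => m low high; have : (na < 8)%N by lia.
  have : (nb < 5)%N by lia. have : (m < 4)%N by lia.
  lia.
case=> [[na1 [nb1 ncd]]|[[na5 [nb0' ncd]]|[na2 [nb3 ncd]]]]; subst na nb.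
- have : (nc = 1 /\ nd = 1 \/ nc = 2 /\ nd = 0 \/ nc = 0 /\ nd = 2)%N.
    by clear -ncd; lia.
  case=> [[-> ->]//|[[nc2 nd0']|[nc0' nd2]]]; subst nc nd; clear -cd nE abcd; lra.
- exfalso; have : (nc = 1 /\ nd = 0 \/ nc = 0 /\ nd = 1)%N by clear -ncd; lia.
  case=> [[nc1 nd0']|[nc0' nd1]]; subst nc nd.
    by apply: (five_triangles_angles k10 l10 tl tu sa sb sc sd abcd); clear -nE; lra.
  apply: (five_triangles_angles l10 k10 tl tu sa sb sd sc); last by clear -nE; lra.
  by clear -abcd; lra.
- have : (nc = 0 /\ nd = 0)%N by clear -ncd; lia.
  move=> [nc0' nd0']; subst nc nd; exfalso.
  have cos0 x : 0 <= x <= pi / 2 -> 0 <= cos x.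
    move=> /andP[x0 x1]; apply: cos_ge0_pihalf; rewrite x1 andbT.
    by have := pi_ge0 R; clear -x0; lra.
  apply: (three_pentagons_angles k10 kl k11 tl tu (cos0 _ a0) (cos0 _ b0) (cos0 _ c0)
    (cos0 _ d0) sa sb sc sd abcd).
  by clear -nE; lra.
Qed.

End VertexEquation.

(** * The angles of a regular polygon *)

Section RegularPolygons.
Variable R : realType.
Implicit Types (p q z a b : H2 R) (c alpha s x : R).

Notation h := (@hyperboloid R).
Notation mk := (@minkowski R).
Notation orient := (@orientation R).

Lemma mk_cdist p q : mk (h p) (h q) = - cdist p q.
Proof. by rewrite /cdist opprK. Qed.

(** The law of cosines at the apex [p] of an isosceles triangle. *)
Lemma isosceles_angle z p q c (alpha := hangle z p q) : cdist z p = c -> cdist p q = c ->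
  0 < orient z p q ->
  [/\ 1 < c, 0 < alpha < pi, cdist z q = c ^+ 2 - (c ^+ 2 - 1) * cos alpha &
      orient z p q = (c ^+ 2 - 1) * sin alpha].
Proof.
move=> zp pq o0; have c1 : 1 <= c by rewrite -pq cdist_ge1.
have c1' : 1 < c.
  rewrite lt_neqAle c1 andbT eq_sym; apply/eqP => ce.
  by move: o0; rewrite ce in pq; rewrite (cdist_eq1 pq) orient_r ltxx.
have cc : 0 < c ^+ 2 - 1 by rewrite subr_gt0 exprn_egt1.
set e := cdist z q.
have X2 : orient z p q ^+ 2 = (c ^+ 2 - 1) ^+ 2 - (c ^+ 2 - e) ^+ 2.
  rewrite expr2 orientationE gram3 !mkhh (mkC (h p) (h z)) (mkC (h q) (h z)).
  rewrite (mkC (h q) (h p)) !mk_cdist zp pq -/e; ring.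
have aE : alpha = acos ((c ^+ 2 - e) / (c ^+ 2 - 1)).
  rewrite /alpha /hangle /direction !mkE !mkhh (mkC (h p) (h z)) (mkC (h p) (h q)).
  rewrite (mkC (h q) (h p)) !mk_cdist zp pq -/e.
  have -> : -1 + - c * - c + (- c * - c + - c * (- c * -1)) = c ^+ 2 - 1 by ring.
  have -> : - e + - c * - c + (- c * - c + - c * (- c * -1)) = c ^+ 2 - e by ring.
  by rewrite -expr2 sqr_sqrtr // ltW.
set r := (c ^+ 2 - e) / (c ^+ 2 - 1) in aE.
have rE : c ^+ 2 - e = r * (c ^+ 2 - 1) by rewrite /r divfK // gt_eqF.
clearbody r.
have r2 : r ^+ 2 < 1.
  have : 0 < orient z p q ^+ 2 by rewrite exprn_gt0.
  rewrite X2 rE exprMn subr_gt0 => H.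
  by rewrite -(@ltr_pM2r _ ((c ^+ 2 - 1) ^+ 2)) ?mul1r // exprn_gt0.
have r1 : -1 < r < 1.
  by rewrite -ltr_norml -(@ltr_pXn2r _ 2) ?nnegrE // real_normK ?num_real // expr1n.
have /andP[rl ru] := r1.
have cosa : cos alpha = r by rewrite aE acosK // in_itv /= !ltW.
have a0 : 0 < alpha < pi by rewrite aE acos_gt0 ?acos_ltpi ?ltW ?rl ?ru.
split=> //; first by rewrite cosa; lra.
have sa : 0 < sin alpha by apply: sin_gt0_pi.
apply/eqP; rewrite -(@eqrXn2 _ 2) ?ltW ?mulr_gt0 //; apply/eqP.
by rewrite X2 rE !exprMn sin2cos2 cosa; ring.
Qed.

Lemma orth_basis a b (u w : 'rV[R]_3) : det3 (h a) (h b) u != 0 ->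
  mk w (h a) = 0 -> mk w (h b) = 0 -> mk w u = 0 -> w = 0.
Proof.
move=> d0 wa wb wu; apply: form_nondegenerate => x.
have := congr1 (mk w) (cramer (h a) (h b) u (h x)).
rewrite !mkE wa wb wu !mulr0 !addr0 => /eqP.
by rewrite mulf_eq0 (negPf d0) => /eqP.
Qed.

(** Four consecutive vertices of an equilateral and equiangular polygon form an
    isosceles trapezoid. *)
Lemma trapezoid (v0 v1 v2 v3 : H2 R) c e : 1 < c ->
  cdist v0 v1 = c -> cdist v1 v2 = c -> cdist v2 v3 = c ->
  cdist v0 v2 = e -> cdist v1 v3 = e ->
  0 < orient v0 v1 v2 -> 0 < orient v1 v2 v3 ->
  h v3 = h v0 + ((e - c) / (c - 1)) *: (h v2 - h v1).
Proof.
move=> c1 d01 d12 d23 d02 d13 o1 o2; set tau := (e - c) / (c - 1).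
have tE : tau * (c - 1) = e - c by rewrite /tau divfK // gt_eqF // subr_gt0.
set rho := h v0 + _; apply/eqP; rewrite -subr_eq0; apply/eqP.
have rhoE w : mk rho w = mk (h v0) w + tau * (mk (h v2) w - mk (h v1) w).
  by rewrite /rho !mkE.
have r1 : mk rho (h v1) = - e.
  by rewrite rhoE (mkC (h v2)) !mkhh !mk_cdist d01 d12; lra.
have r2 : mk rho (h v2) = - c.
  by rewrite rhoE !mkhh !mk_cdist d12 d02; lra.
have rr : mk rho rho = -1.
  rewrite rhoE (mkC (h v1)) (mkC (h v2)) r1 r2 mkC rhoE.
  rewrite mkhh (mkC (h v2)) (mkC (h v1)) !mk_cdist d01 d02; ring.
apply: (@orth_basis v1 v2 (h v3 + rho)).
- have -> : det3 (h v1) (h v2) (h v3 + rho) = orient v1 v2 v3 + orient v0 v1 v2.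
    rewrite !orientationE (det3_rot (h v0)) det3D3 /rho det3D3 det3Z3 det3D3 det3N3.
    by rewrite det3_23 det3_13; ring.
  by rewrite gt_eqF // addr_gt0.
- by clearbody rho; rewrite !mkE r1 mkC mk_cdist d13; ring.
- by clearbody rho; rewrite !mkE r2 mkC mk_cdist d23; ring.
- by clearbody rho; rewrite !mkE rr mkhh (mkC rho); ring.
Qed.

Fixpoint chebyshev_pair x n : R * R :=
  if n is n'.+1 then let: (a, b) := chebyshev_pair x n' in (b, 2 * x * b - a) else (0, 1).
(** The Chebyshev polynomial of the second kind of degree [n - 1], and 0 for [n = 0]. *)
Definition chebyshev x n : R := (chebyshev_pair x n).1.

Lemma chebyshev0 x : chebyshev x 0 = 0. Proof. by []. Qed.
Lemma chebyshev1 x : chebyshev x 1 = 1. Proof. by []. Qed.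
Lemma chebyshevSS x n : chebyshev x n.+2 = 2 * x * chebyshev x n.+1 - chebyshev x n.
Proof. by rewrite /chebyshev /=; case: (chebyshev_pair x n). Qed.

Lemma chebyshev_sin (theta : R) n : sin theta * chebyshev (cos theta) n = sin (n%:R * theta).
Proof.
elim/ltn_ind: n => -[_|[_|n IH]].
- by rewrite chebyshev0 mulr0 mul0r sin0.
- by rewrite chebyshev1 mulr1 mul1r.
rewrite chebyshevSS mulrBr mulrCA (IH n.+1) // (IH n) //.
have -> : n.+2%:R * theta = n.+1%:R * theta + theta by rewrite -natr1; ring.
have -> : n%:R * theta = n.+1%:R * theta - theta by rewrite -natr1; ring.
by rewrite sinB sinD; ring.
Qed.

Lemma chebyshev_increasing x n : 1 <= x -> 0 <= chebyshev x n /\ chebyshev x n < chebyshev x n.+1.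
Proof.
move=> x1; elim: n => [|n [u0 u1]]; first by rewrite chebyshev0 chebyshev1.
have p : 0 < chebyshev x n.+1 := le_lt_trans u0 u1.
split; first exact: ltW; rewrite chebyshevSS.
have : 0 <= (x - 1) * chebyshev x n.+1 by rewrite mulr_ge0 ?subr_ge0 // ltW.
lra.
Qed.

(** By [chebyshev_sin], the first zero occurs when [n] times the angle is [pi]. *)
Lemma first_zero_cos x n : (1 < n)%N -> 0 < x ->
  (forall j, (0 < j < n)%N -> 0 < chebyshev x j) -> chebyshev x n = 0 -> x = cos (pi / n%:R).
Proof.
move=> n1 x0 Upos Un; have x1 : x < 1.
  rewrite ltNge; apply/negP => x1; have := (chebyshev_increasing n.-1 x1).
  by rewrite prednK ?Un; [lra|lia].
have xr : -1 <= x <= 1 by apply/andP; lra.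
set theta := acos x; have cE : cos theta = x by rewrite acosK // in_itv.
have t0 : 0 < theta by apply: acos_gt0; rewrite x1 andbT; lra.
have tp : theta <= pi by apply: acos_lepi.
have tlt : theta < pi / 2.
  rewrite ltNge; apply/negP => H.
  have : cos theta <= cos (pi / 2) by apply: cos_le => //; have := pi_gt0 R; lra.
  by rewrite cE cos_pihalf leNgt x0.
have s0 : 0 < sin theta by apply: sin_gt0_pi; have := pi_gt0 R => ?; apply/andP; lra.
have step (y : R) : 0 < y < pi -> 0 <= sin (y + theta) ->
    y + theta <= pi.
  move=> /andP[y0 yp] sy; rewrite leNgt; apply/negP => H.
  have : 0 < sin (y + theta - pi) by apply: sin_gt0_pi; apply/andP; lra.
  by rewrite sinB cospi sinpi; lra.
have lt j : (0 < j < n)%N -> 0 < j%:R * theta < pi.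
  elim: j => [//|j IHj] /andP[_ jn].
  have [->|j0] := posnP j; first by rewrite mul1r; apply/andP; have := pi_gt0 R; lra.
  have IH := IHj (introT andP (conj j0 (ltnW jn))).
  have e : j.+1%:R * theta = j%:R * theta + theta by rewrite -natr1; ring.
  have sj : 0 < sin (j.+1%:R * theta) by rewrite -chebyshev_sin mulr_gt0 // cE Upos.
  rewrite mulr_gt0 ?ltr0n //= lt_neqAle e step // -?e ?ltW // andbT.
  by apply/eqP => H; move: sj; rewrite H sinpi ltxx.
have m1 : (0 < n.-1 < n)%N by lia.
have e : n%:R * theta = n.-1%:R * theta + theta.
  by rewrite -{1}(@prednK n) -?natr1; [ring|lia].
have sn : sin (n%:R * theta) = 0 by rewrite -chebyshev_sin cE Un mulr0.
have : n%:R * theta <= pi by rewrite e step ?lt // -e sn.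
rewrite le_eqVlt => /predU1P[nt|nt]; last first.
  have : 0 < sin (n%:R * theta).
    by apply: sin_gt0_pi; rewrite nt mulr_gt0 // ltr0n; lia.
  by rewrite sn ltxx.
by rewrite -cE -nt mulrAC divff ?mul1r // pnatr_eq0; lia.
Qed.

Lemma iter_ordS n (i : 'I_n) j : (i + j < n)%N -> val (iter j (@ordS n) i) = (i + j)%N.
Proof.
elim: j => [|j IHj] ij; first by rewrite addn0.
rewrite iterS val_ordS IHj; last by lia.
by case: eqP; lia.
Qed.

Lemma iter_ordS_last n (i : 'I_n) : nat_of_ord i = 0%N -> iter n (@ordS n) i = i.
Proof.
move=> i0; have n0 : (0 < n)%N := leq_ltn_trans (leq0n i) (ltn_ord i).
have last : val (iter n.-1 (@ordS n) i) = n.-1.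
  by rewrite iter_ordS i0 ?add0n // prednK.
have -> : iter n (@ordS n) i = ordS (iter n.-1 (@ordS n) i) by rewrite -iterS prednK.
by apply: val_inj; rewrite val_ordS last prednK // eqxx /= i0.
Qed.

(** The vertices [v_j] of a regular polygon satisfy a linear recurrence of which
    the signed areas [orient v_0 v_1 v_j] are solutions; these areas are thus
    products of consecutive values of Chebyshev polynomials at
    [cosh (s / 2) * sin (alpha / 2)].  They are positive until the polygon closes
    up, which singles out the first zero. *)
Lemma regular_polygon_angle n s alpha P : regular_polygon n s alpha P ->
  exists2 c, 1 < c /\ arcosh c = s & [/\ forall p q, dart P p q -> cdist p q = c,
    0 < alpha < pi &
    Num.sqrt ((c + 1) / 2) * sin (alpha / 2) = cos (pi / n%:R)].
Proof.
move=> [v [cv vs va PE]]; have n2 := cv.1.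
have n0 : (0 < n)%N by lia.
pose i0 : 'I_n := Ordinal n0.
pose c := cdist (v i0) (v (ordS i0)).
have vc i : cdist (v i) (v (ordS i)) = c by apply: hdist_cdist; rewrite !vs.
have turn i : 0 < orient (v i) (v (ordS i)) (v (ordS (ordS i))).
  by have := turn_gt0 cv (ordS i); rewrite ordSK.
have ang i : hangle (v i) (v (ordS i)) (v (ordS (ordS i))) = alpha.
  by have := va (ordS i); rewrite ordSK.
have iso i := isosceles_angle (vc i) (vc (ordS i)) (turn i).
have [c1 a0 _ _] := iso i0; rewrite ang in a0; exists c.
  by split=> //; exact: vs.
split=> //; first by move=> p q; rewrite PE => /(dart_rep cv)[i [-> ->]].
clear PE P.
pose e := c ^+ 2 - (c ^+ 2 - 1) * cos alpha.
have ve i : cdist (v i) (v (ordS (ordS i))) = e by have [_ _ -> _] := iso i; rewrite ang.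
set C := Num.sqrt _; set x := C * sin (alpha / 2).
have C2 : C ^+ 2 = (c + 1) / 2 by rewrite sqr_sqrtr //; lra.
have x0 : 0 < x.
  have C0 : 0 < C by rewrite sqrtr_gt0; lra.
  rewrite mulr_gt0 //; apply: sin_gt0_pi; apply/andP; lra.
have tauE : (e - c) / (c - 1) = 4 * x ^+ 2 - 1.
  have ca : cos alpha = 1 - 2 * sin (alpha / 2) ^+ 2.
    rewrite {1}(_ : alpha = alpha / 2 + alpha / 2); last by field.
    by rewrite cosD -!expr2 cos2sin2; ring.
  rewrite /e ca /x exprMn C2; field; rewrite subr_eq0 gt_eqF //.
pose V j := h (v (iter j (@ordS n) i0)).
pose f j := det3 (V 0%N) (V 1%N) (V j).
have rec j : f j.+3 = f j + (4 * x ^+ 2 - 1) * (f j.+2 - f j.+1).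
  rewrite /f; set i := iter j (@ordS n) i0.
  have := trapezoid c1 (vc i) (vc _) (vc _) (ve i) (ve _) (turn i) (turn _).
  rewrite tauE => VE; have {}VE : V j.+3 = V j + (4 * x ^+ 2 - 1) *: (V j.+2 - V j.+1) by [].
  by rewrite VE det3D3 det3Z3 det3D3 det3N3.
have f0 : f 0%N = 0 by rewrite /f det3_13.
have f1 : f 1%N = 0 by rewrite /f det3_23.
have f2 : 0 < f 2%N by rewrite /f -orientationE; exact: turn.
have fU j : 2 * x * f j.+1 = f 2%N * (chebyshev x j * chebyshev x j.+1).
  elim/ltn_ind: j => -[_|[_|[_|j IH]]].
  - by rewrite f1 chebyshev0; ring.
  - by rewrite !chebyshevSS chebyshev0 chebyshev1; ring.
  - by rewrite rec f0 f1 !chebyshevSS chebyshev0 chebyshev1; ring.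
  have e3 := IH j.+2 (ltnSn _); have e2 := IH j.+1 (ltnW (ltnSn _)).
  have e1 := IH j (ltnW (ltnW (ltnSn _))).
  have -> : 2 * x * f j.+4 = 2 * x * f j.+1 +
      (4 * x ^+ 2 - 1) * (2 * x * f j.+3 - 2 * x * f j.+2).
    by rewrite rec; clearbody x f; ring.
  by rewrite e1 e2 e3 !chebyshevSS; clearbody x f; ring.
have v1 : val (ordS i0) = 1%N by rewrite val_ordS /=; case: ifP => // /eqP; lia.
have fpos j : (1 < j < n)%N -> 0 < f j.
  move=> /andP[j1 jn]; rewrite /f -orientationE; apply: cv.2.
    by apply/eqP => /(congr1 val); rewrite iter_ordS //=; lia.
  by apply/eqP => /(congr1 val); rewrite v1 iter_ordS //=; lia.
have fn : f n = 0 by rewrite /f /V iter_ordS_last // det3_13.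
have Upos j : (0 < j < n)%N -> 0 < chebyshev x j.
  elim: j => [//|[_ _|j IHj]]; first by rewrite chebyshev1.
  move=> /andP[_ jn]; have u0 : 0 < chebyshev x j.+1 by apply: IHj; lia.
  have : 0 < 2 * x * f j.+2 by apply: mulr_gt0 (mulr_gt0 (ltr0Sn _ _) x0) (fpos _ _); lia.
  by rewrite fU (pmulr_rgt0 _ f2) (pmulr_rgt0 _ u0).
apply: first_zero_cos => //; first by lia.
have := fU n.-1; rewrite prednK // fn mulr0 => /esym/eqP.
rewrite mulf_eq0 (gt_eqF f2) /= mulf_eq0 => /orP[/eqP u0|/eqP//].
have nb : (0 < n.-1 < n)%N by lia.
by have := Upos _ nb; rewrite u0 ltxx.
Qed.

End RegularPolygons.

(** * The angle sum at a vertex *)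

Section Polar.
Variable R : realType.
Implicit Types x y theta : R.

Lemma cos_lt1 x : 0 < x < 2 * pi -> cos x < 1.
Proof.
move=> /andP[x0 x2]; rewrite (_ : x = x / 2 + x / 2); last by field.
have s0 : 0 < sin (x / 2) by apply: sin_gt0_pi; apply/andP; lra.
rewrite cosD -!expr2 cos2sin2; have : 0 < sin (x / 2) ^+ 2 by rewrite exprn_gt0.
lra.
Qed.

Lemma cos_sub2pi x : cos (x - 2 * pi) = cos x.
Proof. by rewrite mulr_natl -(cosD2pi (x - _)) subrK. Qed.

Lemma polar x y : x ^+ 2 + y ^+ 2 = 1 ->
  exists theta, [/\ 0 <= theta < 2 * pi, cos theta = x & sin theta = y].
Proof.
move=> xy; have x1 : -1 <= x <= 1.
  by rewrite -ler_norml -(@ler_pXn2r _ 2) ?nnegrE // real_normK ?num_real // expr1n;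
    have := sqr_ge0 y; lra.
have cE : cos (acos x) = x by rewrite acosK // in_itv.
have sE : sin (acos x) = `|y|.
  by rewrite sin_acos // -xy addrC addKr sqrtr_sqr.
have a0 := acos_ge0 x1; have ap := acos_lepi x1; have p0 := pi_gt0 R.
have [y0|y0] := leP 0 y.
  by exists (acos x); split=> //; [apply/andP; lra|rewrite sE ger0_norm].
have s0 : sin (acos x) != 0 by rewrite sE normr_eq0 lt_eqF.
have a0' : 0 < acos x.
  by rewrite lt_neqAle a0 andbT; apply/eqP => e; move: s0; rewrite -e sin0 eqxx.
exists (2 * pi - acos x); split.
- by apply/andP; lra.
- by rewrite -cosN opprB cos_sub2pi.
- by rewrite mulr_natl addrC sinD2pi sinN sE ltr0_norm // opprK.
Qed.

(** As a multiple of [2 * pi] strictly between [- 2 * pi] and [3 * pi], the number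
    [theta + a - theta'] is 0 or [2 * pi]. *)
Lemma polar_step theta theta' (a : R) : 0 <= theta < 2 * pi -> 0 <= theta' < 2 * pi ->
  0 < a < pi -> cos theta' = cos (theta + a) -> sin theta' = sin (theta + a) ->
  theta' = theta + a - (2 * pi <= theta + a)%R%:R * (2 * pi).
Proof.
move=> /andP[t0 t2] /andP[t0' t2'] /andP[a0 ap] ce se; set d := theta + a - theta'.
have p0 := pi_gt0 R.
have cd : cos d = 1 by rewrite /d cosB -ce -se -!expr2 cos2Dsin2.
have dE : theta + a = theta' + d by rewrite /d; ring.
have [d0|d0|d0] := ltgtP d 0.
- by have := @cos_lt1 (- d); rewrite cosN cd ltxx => /(_ _)/negP[]//; apply/andP; lra.
- have [d2|d2|d2] := ltgtP d (2 * pi).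
  + by have := @cos_lt1 d; rewrite cd ltxx => /(_ _)/negP[]//; apply/andP; lra.
  + have := @cos_lt1 (d - 2 * pi); rewrite cos_sub2pi cd ltxx => /(_ _)/negP[]//.
    by apply/andP; lra.
  + by rewrite (_ : 2 * pi <= theta + a); [rewrite mul1r; lra|rewrite dE; lra].
- by rewrite (_ : (2 * pi <= theta + a) = false); [rewrite mul0r; lra|apply/negbTE; rewrite -ltNge; lra].
Qed.

End Polar.

Section TilesAtAVertex.
Variable R : realType.
Implicit Types (p q z x : H2 R) (t : set (H2 R)) (c : R).

Notation h := (@hyperboloid R).
Notation mk := (@minkowski R).
Notation orient := (@orientation R).

Lemma finite_enumeration (A : set (set (H2 R))) : finite_set A ->
  exists m (f : 'I_m -> set (H2 R)), injective f /\ A = range f.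
Proof.
move=> /finite_seqP[s ->]; exists (size (undup s)), (tnth (in_tuple (undup s))).
split; first by apply/tuple_uniqP; exact: undup_uniq.
apply/seteqP; split=> t /=.
  by rewrite -mem_undup => /(tnthP (in_tuple _))[i ->]; exists i.
by move=> [i _ <-]; rewrite -mem_undup; exact: mem_tnth.
Qed.

(** The vertex is strictly to the left of the other sides of [t], hence so are the points
    of the segment that are near the vertex. *)
Lemma sector_interior t z p q x : dart t z p -> dart t p q ->
  0 < orient p q x -> 0 < orient z p x ->
  exists2 y, interior_point t y & between p x y.
Proof.
move=> zp pq qx zx.
have N : nbhs p [set y | forall a b, dart t a b -> p <> a -> p <> b -> 0 < orient a b y].
  have [n [v [cv tE _]]] := zp.
  have : nbhs p [set y | forall i, p <> v i -> p <> v (ordS i) ->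
                           0 < orient (v i) (v (ordS i)) y].
    apply: (@filter_forall _ _
      (fun i y => p <> v i -> p <> v (ordS i) -> 0 < orient (v i) (v (ordS i)) y)
      (nbhs p)) => i.
    have [pa|pa] := pselect (p = v i); first exact: nearW.
    have [pb|pb] := pselect (p = v (ordS i)); first exact: nearW.
    have d : dart t (v i) (v (ordS i)) by rewrite tE; exact: rep_dart.
    have /orient_gt0_nbhs := dart_gt0 d (dart_vertex_l pq) pa pb.
    by apply: filterS.
  apply: filterS => y H a b; rewrite tE => /(dart_rep cv)[i [-> ->]]; exact: H.
have [e [y [k [e0 k0 Ny yE]]]] := perturb (h x) N.
exists y; last first.
  by exists k, (k * e); rewrite yE scalerDr scalerA !ltW ?mulr_gt0.
move=> a b ab; have [pa|pa] := pselect (p = a).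
  subst a; rewrite (dart_next ab pq) (orient_perturb _ _ yE) orient_l add0r.
  by rewrite !mulr_gt0.
have [pb|pb] := pselect (p = b); last exact: Ny.
subst b; rewrite (dart_prev ab zp) (orient_perturb _ _ yE) orient_r add0r.
by rewrite !mulr_gt0.
Qed.

Section PolarCoordinates.
Variables (p o : H2 R) (c : R).
Hypothesis c1 : 1 < c.
Hypothesis po : cdist p o = c.

(** The cosine and the sine of the angle at [p] from [p o] to [p q], for points [q] at
    the same distance from [p] as [o]. *)
Definition polar_x q := (c ^+ 2 - cdist o q) / (c ^+ 2 - 1).
Definition polar_y q := orient p o q / (c ^+ 2 - 1).

Let cc : 0 < c ^+ 2 - 1. Proof. by rewrite subr_gt0 exprn_egt1. Qed.

Lemma polar_coord_norm q : cdist p q = c -> polar_x q ^+ 2 + polar_y q ^+ 2 = 1.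
Proof.
move=> pq; have e : orient p o q ^+ 2 = (c ^+ 2 - 1) ^+ 2 - (c ^+ 2 - cdist o q) ^+ 2.
  rewrite expr2 orientationE gram3 !mkhh (mkC (h o) (h p)) (mkC (h q) (h p)).
  by rewrite (mkC (h q) (h o)) !mk_cdist po pq; ring.
by rewrite /polar_x /polar_y !exprMn e exprVn; field; rewrite gt_eqF.
Qed.

(** In the tangent plane at [p], rotate the direction of [q] by [a] to get that of
    [z]. *)
Lemma polar_coord_rot z q a : cdist p z = c -> cdist p q = c ->
  cdist z q = c ^+ 2 - (c ^+ 2 - 1) * cos a ->
  orient z p q = (c ^+ 2 - 1) * sin a ->
  polar_x z = polar_x q * cos a - polar_y q * sin a /\
  polar_y z = polar_x q * sin a + polar_y q * cos a.
Proof.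
move=> pz pq ca sa; rewrite orient_rot in sa.
have X : orient p o q * orient p q z = (c ^+ 2 - cdist o q) * (c ^+ 2 - cdist z q)
    - (c ^+ 2 - cdist o z) * (c ^+ 2 - 1).
  rewrite !orientationE gram3 !mkhh (mkC (h o) (h p)) (mkC (h q) (h p)).
  by rewrite (mkC (h q) (h z)) !mk_cdist po pq pz; ring.
have Y : orient p o z * (c ^+ 2 - 1) =
    orient p q z * (c ^+ 2 - cdist o q) + orient p o q * (c ^+ 2 - cdist z q).
  have := congr1 (fun w => mk w (h q) - c * mk w (h p))
    (cramer (h p) (h o) (h z) (h q)).
  rewrite /= !mkE !mkhh (mkC (h o) (h p)) (mkC (h z) (h p)) (mkC (h q) (h p)) !mk_cdist.
  rewrite po pq pz -!orientationE => e; lra.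
have ca' : c ^+ 2 - cdist z q = (c ^+ 2 - 1) * cos a by rewrite ca; ring.
have nz : c ^+ 2 - 1 != 0 by rewrite gt_eqF.
rewrite ca' sa in X Y; split; rewrite /polar_x /polar_y.
  have -> : c ^+ 2 - cdist o z =
      (c ^+ 2 - cdist o q) * cos a - orient p o q * sin a.
    by apply: (mulIf nz); rewrite mulrBl; lra.
  by field.
have -> : orient p o z = (c ^+ 2 - cdist o q) * sin a + orient p o q * cos a.
  by apply: (mulIf nz); rewrite Y; ring.
by field.
Qed.

End PolarCoordinates.

(** Measure the polar angles [theta] of the sides at [p] from one of them, [p o].
    Passing from a tile to the next one adds its interior angle, up to a full
    turn; a full turn can only be subtracted at the tile that has [o p] as a
    side, as another tile would contain points of the segment [p o] in its
    interior. *)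
Lemma angle_sum (T : set (set (H2 R))) c (alpha : set (H2 R) -> R) t0 p :
  tiling T -> edge_to_edge T -> (forall t, T t -> polygonal t) -> 1 < c ->
  (forall t q z, T t -> dart t q z -> cdist q z = c) ->
  (forall t z q r, T t -> dart t z q -> dart t q r -> hangle z q r = alpha t) ->
  T t0 -> vertex_of t0 p ->
  exists m (f : 'I_m -> set (H2 R)), [/\ injective f,
    [set t | T t /\ t p] = range f & \sum_i alpha (f i) = 2 * pi].
Proof.
move=> tT eT pT c1 sideT angT Tt0 vp.
have [m [f [f_inj fE]]] : exists m (f : 'I_m -> set (H2 R)),
    injective f /\ [set t | T t /\ t p] = range f.
  apply: finite_enumeration; have [_ _ /(_ p)[U Up fU]] := tT.
  apply: sub_finite_set fU => t [Tt tp]; split=> //.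
  by exists p; split=> //; exact: nbhs_singleton.
exists m, f; split=> //.
have fT i : T (f i) /\ f i p.
  by have : range f (f i) by []; rewrite -fE.
have fV i : vertex_of (f i) p.
  by have [Ti ip] := fT i; exact: (common_vertex eT Tt0 Ti vp ip).
have nxt i : {q | dart (f i) p q} by apply/cid/vertex_ofP.
have prv i : {z | dart (f i) z p} by apply/cid/vertex_of_prev.
pose q i := sval (nxt i); pose z i := sval (prv i).
have dq i : dart (f i) p (q i) := svalP (nxt i).
have dz i : dart (f i) (z i) p := svalP (prv i).
have zp i : cdist (z i) p = c by apply: sideT (dz i); case: (fT i).
have pq i : cdist p (q i) = c by apply: sideT (dq i); case: (fT i).
have pz i : cdist p (z i) = c by rewrite cdistC.
have [a0 zq oz] : [/\ forall i, 0 < alpha (f i) < pi,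
    forall i, cdist (z i) (q i) = c ^+ 2 - (c ^+ 2 - 1) * cos (alpha (f i)) &
    forall i, orient (z i) p (q i) = (c ^+ 2 - 1) * sin (alpha (f i))].
  have H i := isosceles_angle (zp i) (pq i) (dart_turn (dz i) (dq i)).
  have aE i : hangle (z i) p (q i) = alpha (f i).
    by apply: (angT _ _ _ _ _ (dz i) (dq i)); case: (fT i).
  by split=> i; have [_] := H i; rewrite aE.
have sigma_ex i : {j | q j = z i}.
  apply: cid; have [t' Tt' d'] := dart_reverse tT eT pT (fT i).1 (dz i).
  have : [set t | T t /\ t p] t' by split=> //; exact: vertex_of_in (dart_vertex_l d').
  by rewrite fE => -[j _ ft']; exists j; rewrite -ft' in d'; exact: dart_next (dq j) d'.
pose sigma i := sval (sigma_ex i).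
have qs i : q (sigma i) = z i := svalP (sigma_ex i).
have z_inj i j : z i = z j -> i = j.
  move=> e; apply/f_inj/(dart_tile eT pT (fT i).1 (fT j).1 (dz i)).
  by rewrite e.
have sigma_inj : injective sigma.
  by move=> i j e; apply: z_inj; rewrite -!qs e.
have [i0 _ _] : range f t0 by rewrite -fE; split=> //; exact: vertex_of_in.
pose o := q i0.
have po : cdist p o = c := pq i0.
pose X := polar_x o c; pose Y := polar_y p o c.
have pol i := cid (polar (polar_coord_norm c1 po (pq i))).
pose theta i := sval (pol i).
have [t2 tX tY] : [/\ forall i, 0 <= theta i < 2 * pi,
    forall i, cos (theta i) = X (q i) & forall i, sin (theta i) = Y (q i)].
  by split=> i; have [] := svalP (pol i).
have rot i : X (z i) = cos (theta i + alpha (f i)) /\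
             Y (z i) = sin (theta i + alpha (f i)).
  have [Xz Yz] := polar_coord_rot c1 po (pz i) (pq i) (zq i) (oz i).
  by rewrite cosD sinD tX tY /X /Y Xz Yz; split=> //; ring.
pose w i := 2 * pi <= theta i + alpha (f i).
have step i : theta (sigma i) = theta i + alpha (f i) - (w i)%:R * (2 * pi).
  by apply: polar_step => //; rewrite ?tX ?tY qs; have [] := rot i.
have cc : 0 < c ^+ 2 - 1 by rewrite subr_gt0 exprn_egt1.
have wrap i : w i -> z i = o.
  move=> wi; have /andP[t0' t2'] := t2 i; have /andP[a1 ap] := a0 i.
  have [Xz Yz] := rot i; have p0 := pi_gt0 R.
  move: wi; rewrite /w le_eqVlt => /predU1P[e|lt].
    move: Xz; rewrite -e mulr_natl cos2pi /X /polar_x.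
    move/(congr1 (fun r => r * (c ^+ 2 - 1))); rewrite divfK ?gt_eqF // mul1r => e'.
    by apply/esym/cdist_eq1; lra.
  have s1 : 0 < sin (theta i - pi) by apply: sin_gt0_pi; apply/andP; lra.
  have qo : 0 < orient p (q i) o.
    have -> : orient p (q i) o = - orient p o (q i).
      by rewrite !orientationE det3_swap23.
    have := tY i; rewrite /Y /polar_y => /(congr1 (fun r => r * (c ^+ 2 - 1))).
    rewrite divfK ?gt_eqF // => <-; rewrite -mulNr mulr_gt0 //.
    by move: s1; rewrite sinB cospi sinpi; lra.
  have zo : 0 < orient (z i) p o.
    rewrite orient_rot; have := Yz; rewrite /Y /polar_y.
    move=> /(congr1 (fun r => r * (c ^+ 2 - 1))); rewrite divfK ?gt_eqF // => ->.
    rewrite mulr_gt0 // -[theta i + _](subrK (pi *+ 2)) sinD2pi.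
    by apply: sin_gt0_pi; rewrite -mulr_natl; apply/andP; lra.
  have [y yi yo] := sector_interior (dz i) (dq i) qo zo.
  have e := interior_point_tile eT pT (fT i).1 (fT i0).1 yi (between_in (dq i0) yo).
  by rewrite e in yi; have := yi _ _ (dq i0); rewrite (between_orient0 yo) ltxx.
have total : \sum_i alpha (f i) = (\sum_i (w i)%:R) * (2 * pi).
  have : \sum_i theta i = \sum_i theta (sigma i) by exact: reindex_inj.
  rewrite [RHS](eq_bigr _ (fun i _ => step i)) sumrB big_split /= -mulr_suml; lra.
have [j wj] : exists j, w j.
  apply: contrapT => no.
  have w0 i : w i = false by apply/negbTE/negP => wi; apply: no; exists i.
  move: total; rewrite [X in X * _]big1 => [|i _]; last by rewrite w0.
  rewrite mul0r (bigD1 i0) //=; have /andP[ai _] := a0 i0.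
  have : 0 <= \sum_(i | i != i0) alpha (f i).
    by apply: sumr_ge0 => i _; have /andP[/ltW] := a0 i.
  lra.
rewrite total (bigD1 j) //= wj big1 => [|i ij]; first by rewrite addr0 mul1r.
case wi : (w i) => //; case/eqP: ij; apply: z_inj.
by rewrite !wrap // wi.
Qed.

End TilesAtAVertex.

(** * Tilings by copies of the four polygons *)

Section IsometriesOfRegularPolygons.
Variable R : realType.
Implicit Types (p q z a b c : H2 R) (t P : set (H2 R)) (s alpha : R).

Notation h := (@hyperboloid R).
Notation mk := (@minkowski R).

Lemma hangleC a b c : hangle a b c = hangle c b a.
Proof. by rewrite /hangle mkC [in X in _ / X]mulrC. Qed.

Lemma isometry_hangle g a b c : isometry g -> hangle (g a) (g b) (g c) = hangle a b c.
Proof. by move=> gI; rewrite /hangle /direction !mkE !(isometry_mk gI). Qed.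

Lemma isometry_regular_polygon n s alpha P g : isometry g ->
  regular_polygon n s alpha P -> regular_polygon n s alpha (g @` P).
Proof.
move=> gI [v [cv vs va ->]]; have [f [_ fS] [cf ->]] := isometry_polygon cv gI.
exists (g \o v \o f); split=> // i.
  rewrite /= gI.2; case: fS => -> //.
  have := vs (ord_pred (f i)); rewrite ord_predK => <-.
  by rewrite /hdist mkC.
rewrite /= isometry_hangle //; case: fS => fS.
  suff -> : f (ord_pred i) = ord_pred (f i) by rewrite fS.
  by apply: ordS_inj; rewrite -fS !ord_predK.
suff -> : f (ord_pred i) = ordS (f i) by rewrite fS hangleC.
by rewrite -{2}(ord_predK i) fS ord_predK.
Qed.

Lemma regular_polygon_hangle n s alpha t z p q : regular_polygon n s alpha t ->
  dart t z p -> dart t p q -> hangle z p q = alpha.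
Proof.
move=> [v [cv _ va ->]] /(dart_rep cv)[i [-> ->]] /(dart_rep cv)[j [/(vertex_inj cv)<- ->]].
by have := va (ordS i); rewrite ordSK.
Qed.

End IsometriesOfRegularPolygons.

Section Copies.
Variable R : realType.
Variables k3 k4 : nat.
Hypotheses (hk3 : (10 <= k3)%N) (hk34 : (k3 < k4)%N) (hk3_11 : k3 <> 11%N).

(** By [angle_sum], the interior angles of the tiles at a vertex add up to the
    same angle as one angle of each kind, and [vertex_counts] shows that this is
    only possible for one tile of each kind. *)
Lemma copies_tiling_of_type s (alpha3 alpha5 alphak3 alphak4 : R)
    (P3 P5 Pk3 Pk4 : set (H2 R)) T :
  regular_polygon 3 s alpha3 P3 -> regular_polygon 5 s alpha5 P5 ->
  regular_polygon k3 s alphak3 Pk3 -> regular_polygon k4 s alphak4 Pk4 ->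
  alpha3 + alpha5 + alphak3 + alphak4 = 2 * pi ->
  tiling_by_copies [set P3; P5; Pk3; Pk4] T ->
  tiling_of_type [:: 3; 5; k3; k4]%N T.
Proof.
move=> r3 r5 rk3 rk4 sum_alpha [tT eT copies]; set ks := [:: _; _; _; _].
pose angles := [:: alpha3; alpha5; alphak3; alphak4].
have [c [c1 cs] [c3 a3 ch3]] := regular_polygon_angle r3.
have same_c c' : 1 < c' -> arcosh c' = s -> c' = c.
  by move=> c'1 e; apply: arcosh_inj; rewrite ?ltW // e cs.
have [c' [/same_c ce /ce c'E] [c5 a5 ch5]] := regular_polygon_angle r5.
rewrite {}c'E {ce c'} in c5 ch5.
have [c' [/same_c ce /ce c'E] [ck3 ak3 chk3]] := regular_polygon_angle rk3.
rewrite {}c'E {ce c'} in ck3 chk3.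
have [c' [/same_c ce /ce c'E] [ck4 ak4 chk4]] := regular_polygon_angle rk4.
rewrite {}c'E {ce c'} in ck4 chk4.
have kind_ex t : exists k : 'I_4, T t -> regular_polygon (nth 0%N ks k) s angles`_k t.
  have [Tt|nTt] := pselect (T t); last by exists ord0.
  have [P [g [AP gI ->]]] := copies _ Tt.
  case: AP => [[[]|]|] ->.
  - by exists (inord 0) => _; rewrite inordK //; exact: isometry_regular_polygon.
  - by exists (inord 1) => _; rewrite inordK //; exact: isometry_regular_polygon.
  - by exists (inord 2) => _; rewrite inordK //; exact: isometry_regular_polygon.
  - by exists (inord 3) => _; rewrite inordK //; exact: isometry_regular_polygon.
have [kind kindP] := choice kind_ex.
pose alpha t := angles`_(kind t).
have sideT t p q : T t -> dart t p q -> cdist p q = c.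
  move=> /kindP/regular_polygon_angle[c' [c'1 c's] [H _ _]] /H ->; exact: same_c.
have ngonT t : T t -> is_regular_ngon (nth 0%N ks (kind t)) t.
  by move=> /kindP ?; exists s, angles`_(kind t).
have angT t z p q : T t -> dart t z p -> dart t p q -> hangle z p q = alpha t.
  by move=> /kindP; exact: regular_polygon_hangle.
split=> // [t Tt|t0 p Tt0 vp]; first by exists (nth 0%N ks (kind t)); exact: ngonT.
have pT t : T t -> polygonal t.
  by move=> /ngonT/regular_ngon/ngon_polygonal.
have [m [f [f_inj fE sum_f]]] := angle_sum tT eT pT c1 sideT angT Tt0 vp.
pose N (k : nat) := #|[pred i | val (kind (f i)) == k]|.
have sumN : \sum_(k < 4) (N k)%:R * angles`_k = 2 * pi.
  rewrite -sum_f (partition_big (fun i => kind (f i)) xpredT) //=.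
  apply: eq_bigr => k _; rewrite mulr_natl -sumr_const /alpha.
  by apply: eq_bigr => i /eqP ->.
rewrite !big_ord_recl big_ord0 /= addr0 /bump /= in sumN.
set C := Num.sqrt _ in ch3 ch5 chk3 chk4.
have C0 : 0 < C by rewrite sqrtr_gt0; lra.
have half n a : C * sin (a / 2) = cos (pi / n%:R) -> sin (a / 2) = C^-1 * chord R n / 2.
  by move=> e; rewrite /chord -e; field; rewrite gt_eqF.
have half0 (a : R) : 0 < a < pi -> 0 <= a / 2 <= pi / 2.
  by move=> /andP[*]; apply/andP; lra.
have [N0 N1 N2 N3] : [/\ N 0 = 1, N 1 = 1, N 2 = 1 & N 3 = 1]%N.
  apply: (vertex_counts hk3 hk34 hk3_11 _ (half0 _ a3) (half0 _ a5) (half0 _ ak3)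
    (half0 _ ak4) (half _ _ ch3) (half _ _ ch5) (half _ _ chk3) (half _ _ chk4)).
  - by rewrite invr_gt0.
  - lra.
  - lra.
have Nk (k : 'I_4) : N k = 1%N.
  by case: k => [[|[|[|[|//]]]]].
have one k : exists i, forall j, (kind (f j) = k) <-> j = i.
  have /card1P[i iE] : #|[pred i | kind (f i) == k]| == 1%N by apply/eqP; exact: (Nk k).
  exists i => j; have := iE j; rewrite !inE => e.
  by split=> [/eqP|->]; [rewrite e => /eqP|apply/eqP; have := iE i; rewrite !inE eqxx].
have [g gP] := choice one.
exists (f \o g); split.
- by move=> k l /f_inj e; have [_ <- //] := gP k (g k); have [_ ->] := gP l (g k).
- move=> k; have [_ /(_ erefl) e] := gP k (g k); rewrite -{1}e; apply: ngonT.
  by have : range f (f (g k)) by []; rewrite -fE => -[].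
- rewrite fE; apply/seteqP; split=> t [i _ <-] /=; last by exists (g i).
  by exists (kind (f i)) => //=; have [/(_ erefl) <-] := gP (kind (f i)) i.
Qed.

End Copies.

(** * Weak aperiodicity *)

Theorem mainTheorem3 (R : realType) (k3 k4 : nat)
    (hk3 : (10 <= k3)%N) (hk34 : (k3 < k4)%N) (hk3_11 : k3 <> 11%N) :
  (forall T : set (set (H2 R)),
     tiling_of_type [:: 3; 5; k3; k4]%N T -> ~ strongly_periodic T) /\
  (forall (s alpha3 alpha5 alphak3 alphak4 : R)
          (P3 P5 Pk3 Pk4 : set (H2 R)),
     regular_polygon 3 s alpha3 P3 ->
     regular_polygon 5 s alpha5 P5 ->
     regular_polygon k3 s alphak3 Pk3 ->
     regular_polygon k4 s alphak4 Pk4 ->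
     alpha3 + alpha5 + alphak3 + alphak4 = 2 * pi ->
     weakly_aperiodic [set P3; P5; Pk3; Pk4]).
Proof.
split=> [T|s alpha3 alpha5 alphak3 alphak4 P3 P5 Pk3 Pk4 r3 r5 rk3 rk4 sum_alpha T copies].
  exact: type_not_strongly_periodic.
apply: (type_not_strongly_periodic hk3 hk34).
exact: copies_tiling_of_type r3 r5 rk3 rk4 sum_alpha copies.
Qed.
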